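(* Let $\mathbb{H}$ be the graded affine Hecke algebra of type $B_n$ with real parameters $k_\ell$ on the long roots and $k_s$ on the short roots. Let $X$ be a one $W$-type $\mathbb{H}$-module with $X|_{W}\cong\lambda_L\times\lambda_R$, where $(\lambda_L,\lambda_R)$ is a bipartition of $n$ and $|\lambda_R|=s$. Then every partition $\lambda$ of $n$ whose Littlewood–Richardson coefficient $c^{\lambda}_{\lambda_L,\lambda_R^t}=\dim\mathrm{Hom}_{S_n}[\lambda,\mathrm{Ind}_{S_{n-s}\times S_s}^{S_n}(\lambda_L\boxtimes\lambda_R^t)]$ is nonzero determines the central character of $X$: it is $\chi_{\nu_\lambda}$, where $\nu_\lambda\in\mathbb{R}^n$ is the vector whose entries are the numbers $k_s+k_\ell(j-i)$, one for each box of the Young diagram of $\lambda$ (in row $i$ and column $j$).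
   Context: Type $B_n$: $V=\mathbb{R}^n$ with the standard inner product, identified with $V^*$; $\Phi=\{\pm e_i\pm e_j\ (i<j),\ \pm e_i\}$, $\Pi=\{e_1-e_2,\dots,e_{n-1}-e_n,e_n\}$, $W=W(B_n)=S_n\ltimes(\mathbb{Z}/2\mathbb{Z})^n$, $w_0$ its longest element, $V_{\mathbb{C}}=\mathbb{C}^n$; $k_\alpha=k_\ell$ for the long roots $\pm e_i\pm e_j$ and $k_\alpha=k_s$ for the short roots $\pm e_i$. The graded affine Hecke algebra $\mathbb{H}$ is the unital associative $\mathbb{C}$-algebra generated by $\{t_w:w\in W\}$ and $\{\omega\in V_{\mathbb{C}}\}$ (linear in $\omega$) with relations $t_wt_{w'}=t_{ww'}$; $\omega\omega'=\omega'\omega$; $\omega t_{s_\alpha}-t_{s_\alpha}s_\alpha(\omega)=k_\alpha\frac{2(\alpha,\omega)}{(\alpha,\alpha)}$ for $\alpha\in\Pi$, $\omega\in V_{\mathbb C}$. Its center is $S(V_{\mathbb{C}})^W$; central characters are parameterized by $W\backslash V_{\mathbb{C}}^*$, with $\chi_\nu$ the character $f\mapsto f(\nu)$. $*$ is the conjugate-linear anti-involution of $\mathbb{H}$ with $t_w^*=t_{w^{-1}}$ and $\omega^*=-t_{w_0}\,w_0(\omega)\,t_{w_0}$ for $\omega\in V$. An $\mathbb{H}$-module is $*$-hermitian if it has a nondegenerate hermitian form with $\langle hx,y\rangle=\langle x,h^*y\rangle$. A one $W$-type module is a simple $*$-hermitian $\mathbb{H}$-module whose restriction to $\mathbb{C}[W]$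 is irreducible. Notation: $\lambda^t$ is the transpose partition; a partition of $m$ also denotes the corresponding irreducible $S_m$-representation, with $(m)$ trivial. $\lambda_L\times\lambda_R$ is the irreducible $W(B_n)$-representation induced from $(S_{n-s}\times S_s)\ltimes(\mathbb{Z}/2\mathbb{Z})^n$ of the representation acting by $\lambda_L\boxtimes\lambda_R$ on $S_{n-s}\times S_s$, trivially on the first $n-s$ factors $\mathbb{Z}/2\mathbb{Z}$ and by the sign character on each of the last $s$ factors; so $n\times0$ is trivial and $0\times1^n$ is the sign representation. Young diagrams are left-justified with decreasing rows; the upper left box is row $1$, column $1$. *)

(* Defs.v *)
From HB Require Import structures.
From mathcomp Require Import all_boot all_order all_algebra all_fingroup.
From mathcomp Require Import generic_quotient mxrepresentation character.
From mathcomp Require Import complex mpoly.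
From mathcomp Require Import boolp reals ring.

Set Implicit Arguments.
Unset Strict Implicit.
Unset Printing Implicit Defensive.

Import GRing.Theory Num.Theory GroupScope.
Local Open Scope ring_scope.
Local Open Scope complex_scope.
Local Open Scope quotient_scope.

(* The pair (s, eps) is the signed permutation e_i |-> (-1)^(eps i) e_(s i).
   As for {perm _}, the product x * y means "x, then y"; since inversion is an
   isomorphism onto the opposite group which fixes every involution, neither
   the presentation below nor the parametrization of the irreducible
   representations depends on this choice. *)
Definition bgroup (n : nat) : Type := ('S_n * {ffun 'I_n -> bool})%type.

HB.instance Definition _ n := Finite.on (bgroup n).

Section BGroup.
Variable n : nat.
Implicit Types x y z : bgroup n.

Definition bmul x y : bgroup n :=
  ((x.1 * y.1)%g, [ffun i => x.2 i (+) y.2 (x.1 i)]).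
Definition bone : bgroup n := (1%g, [ffun => false]).
Definition binv x : bgroup n := (x.1^-1%g, [ffun i => x.2 ((x.1)^-1%g i)]).

Fact bmulA : associative bmul.
Proof.
move=> x y z; congr pair; rewrite /= ?mulgA //.
by apply/ffunP=> i; rewrite !ffunE /= permM addbA.
Qed.

Fact bmul1 : left_id bone bmul.
Proof.
move=> [s e]; congr pair; rewrite /= ?mul1g //.
by apply/ffunP=> i; rewrite !ffunE /= perm1.
Qed.

Fact bmulV : left_inverse bone binv bmul.
Proof.
move=> x; congr pair; rewrite /= ?mulVg //.
by apply/ffunP=> i; rewrite !ffunE addbb.
Qed.

End BGroup.

HB.instance Definition _ n :=
  Finite_isGroup.Build (bgroup n) (@bmulA n) (@bmul1 n) (@bmulV n).

Section RootSystem.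
Variable n : nat.

(* alpha_i = e_i - e_(i+1), and alpha_i = e_i for the last index i. *)
Definition simple_root (A : pzRingType) (i : 'I_n) : 'rV[A]_n :=
  if insub i.+1 is Some j then delta_mx 0 i - delta_mx 0 j else delta_mx 0 i.

Definition simple_refl (i : 'I_n) : bgroup n :=
  if insub i.+1 is Some j then (tperm i j, [ffun => false])
  else (1%g, [ffun k => k == i]).

Definition wact (A : pzRingType) (w : bgroup n) (v : 'rV[A]_n) : 'rV[A]_n :=
  \sum_i ((-1) ^+ w.2 i * v 0 i) *: delta_mx 0 (w.1 i).

Definition dot (A : pzRingType) (u v : 'rV[A]_n) : A :=
  \sum_i u 0 i * v 0 i.

Lemma wact_simple_refl (A : fieldType) (i : 'I_n) (v : 'rV[A]_n) :
    (2 : A) != 0 ->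
  wact (simple_refl i) v =
    v - (2 * dot (simple_root A i) v
           / dot (simple_root A i) (simple_root A i)) *: simple_root A i.
Proof.
move=> two_neq0.
have dotE u (w : 'rV[A]_n) : dot u w = (u *m w^T) 0 0.
  by rewrite mxE; apply: eq_bigr => k _; rewrite mxE.
have dotd j (w : 'rV[A]_n) : dot (delta_mx 0 j) w = w 0 j.
  by rewrite dotE -rowE mxE mxE.
have dotB (u u' w : 'rV[A]_n) : dot (u - u') w = dot u w - dot u' w.
  by rewrite !dotE mulmxBl !mxE.
have vE : v = \sum_k v 0 k *: delta_mx 0 k by exact: row_sum_delta.
rewrite /wact /simple_root /simple_refl; case: insubP => [j _ jE|_] /=.
  have neq_ij : i != j by rewrite -val_eqE /= jE neq_ltn ltnSn.
  rewrite !dotB !dotd !mxE !eqxx [j == i]eq_sym (negbTE neq_ij) /=.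
  rewrite subr0 sub0r opprK -[1 + 1]/(2 : A) mulrAC mulfV // mul1r.
  rewrite [X in _ = X - _]vE (bigD1 i) //= (bigD1 j) 1?eq_sym //= ffunE mul1r tpermL.
  rewrite ffunE mul1r tpermR [in RHS](bigD1 i) //= [in RHS](bigD1 j) 1?eq_sym //=.
  rewrite (eq_bigr (fun k => v 0 k *: delta_mx 0 k)); last first.
    by move=> k /andP[ki kj]; rewrite ffunE mul1r tpermD // eq_sym.
  by set S := \sum_(k | _) _; apply/rowP=> k; rewrite !mxE; ring.
rewrite !dotd mxE !eqxx divr1 [X in _ = X - _]vE (bigD1 i) //= [in RHS](bigD1 i) //=.
rewrite ffunE eqxx expr1 perm1 (eq_bigr (fun k => v 0 k *: delta_mx 0 k)).
  by set S := \sum_(k | _) _; apply/rowP=> k; rewrite !mxE; ring.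
by move=> k ki; rewrite ffunE (negbTE ki) mul1r perm1.
Qed.

Definition words (k : nat) : {set bgroup n} :=
  iter k (fun S : {set bgroup n} => [set (x * simple_refl i)%g | x in S, i in 'I_n])
         [set 1%g].

Definition wlength (w : bgroup n) : nat :=
  find (fun k => w \in words k) (iota 0 #|{: bgroup n}|).

Definition longest (w : bgroup n) := forall x, (wlength x <= wlength w)%N.

End RootSystem.

Section Hecke.
Variables (R : realType) (n : nat) (kl ks : R).
Local Notation C := R[i].

Definition kparam (i : 'I_n) : R :=
  if (insub i.+1 : option 'I_n) is Some _ then kl else ks.

(* Formal expressions in the generators t_w and omega (in V_C = C^n), and the
   congruence generated by the axioms of unital associative C-algebras, with
   [hSc c] the scalar c, and by the defining relations. *)
Inductive hterm : Type :=
| hT of bgroup n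
| hOm of 'rV[C]_n
| hSc of C
| hAdd of hterm & hterm
| hMul of hterm & hterm.

Inductive hrel : hterm -> hterm -> Prop :=
| hr_refl x : hrel x x
| hr_sym x y : hrel x y -> hrel y x
| hr_trans y x z : hrel x y -> hrel y z -> hrel x z
| hr_add x x' y y' : hrel x x' -> hrel y y' -> hrel (hAdd x y) (hAdd x' y')
| hr_mul x x' y y' : hrel x x' -> hrel y y' -> hrel (hMul x y) (hMul x' y')
| hr_addA x y z : hrel (hAdd x (hAdd y z)) (hAdd (hAdd x y) z)
| hr_addC x y : hrel (hAdd x y) (hAdd y x)
| hr_add0 x : hrel (hAdd (hSc 0) x) x
| hr_addN x : hrel (hAdd (hMul (hSc (-1)) x) x) (hSc 0)
| hr_mulA x y z : hrel (hMul x (hMul y z)) (hMul (hMul x y) z)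
| hr_mul1 x : hrel (hMul (hSc 1) x) x
| hr_mulDl x y z : hrel (hMul (hAdd x y) z) (hAdd (hMul x z) (hMul y z))
| hr_mulDr x y z : hrel (hMul x (hAdd y z)) (hAdd (hMul x y) (hMul x z))
| hr_scD a b : hrel (hSc (a + b)) (hAdd (hSc a) (hSc b))
| hr_scM a b : hrel (hSc (a * b)) (hMul (hSc a) (hSc b))
| hr_scC a x : hrel (hMul (hSc a) x) (hMul x (hSc a))
| hr_T1 : hrel (hT 1%g) (hSc 1)
| hr_TM w w' : hrel (hMul (hT w) (hT w')) (hT (w * w')%g)
| hr_OmD u v : hrel (hOm (u + v)) (hAdd (hOm u) (hOm v))
| hr_OmZ a v : hrel (hOm (a *: v)) (hMul (hSc a) (hOm v))
| hr_OmC u v : hrel (hMul (hOm u) (hOm v)) (hMul (hOm v) (hOm u))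
| hr_cross i v : let a := simple_root C i in
    hrel (hMul (hOm v) (hT (simple_refl i)))
         (hAdd (hMul (hT (simple_refl i)) (hOm (wact (simple_refl i) v)))
               (hSc ((kparam i)%:C * (2 * dot a v / dot a a)))).

Lemma hrel_equiv : equiv_class_of (fun x y => `[< hrel x y >]).
Proof.
split=> [x|x y|y x z].
- by apply/asboolP; exact: hr_refl.
- by apply/asboolP/asboolP; exact: hr_sym.
- by move=> /asboolP h /asboolP h'; apply/asboolP; exact: hr_trans h h'.
Qed.

HB.instance Definition _ := gen_eqMixin hterm.
HB.instance Definition _ := gen_choiceMixin hterm.

Canonical hrel_equiv_rel := EquivRelPack hrel_equiv.

Definition hecke : Type := {eq_quot hrel_equiv_rel}.
HB.instance Definition _ := Choice.on hecke.
HB.instance Definition _ := EqQuotient.on hecke.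

Implicit Types x y z : hecke.

Lemma hpiP a b : hrel a b <-> \pi_hecke a = \pi_hecke b.
Proof.
by split=> [h|/eqmodP /asboolP //]; apply/eqmodP/asboolP.
Qed.

Definition hadd x y : hecke := \pi_hecke (hAdd (repr x) (repr y)).
Definition hmul x y : hecke := \pi_hecke (hMul (repr x) (repr y)).
Definition hsc c : hecke := \pi_hecke (hSc c).
Definition hopp x : hecke := hmul (hsc (-1)) x.
Definition hscale c x : hecke := hmul (hsc c) x.

Lemma hrepr a : hrel (repr (\pi_hecke a)) a.
Proof. by apply/hpiP; rewrite reprK. Qed.

Lemma haddE a b : hadd (\pi_hecke a) (\pi_hecke b) = \pi_hecke (hAdd a b).
Proof. by apply/hpiP; apply: hr_add; exact: hrepr. Qed.

Lemma hmulE a b : hmul (\pi_hecke a) (\pi_hecke b) = \pi_hecke (hMul a b).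
Proof. by apply/hpiP; apply: hr_mul; exact: hrepr. Qed.

Fact haddA : associative hadd.
Proof.
elim/quotW=> x; elim/quotW=> y; elim/quotW=> z.
rewrite (haddE y z) (haddE x y) (haddE x) (haddE _ z).
by apply/hpiP; apply: hr_addA.
Qed.

Fact haddC : commutative hadd.
Proof. by elim/quotW=> x; elim/quotW=> y; rewrite (haddE x y) (haddE y x); apply/hpiP; apply: hr_addC. Qed.

Fact hadd0 : left_id (hsc 0) hadd.
Proof. by elim/quotW=> x; rewrite haddE; apply/hpiP; apply: hr_add0. Qed.

Fact haddN : left_inverse (hsc 0) hopp hadd.
Proof. by elim/quotW=> x; rewrite /hopp hmulE haddE; apply/hpiP; apply: hr_addN. Qed.

HB.instance Definition _ :=
  GRing.isZmodule.Build hecke haddA haddC hadd0 haddN.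

Fact hmulA : associative hmul.
Proof.
elim/quotW=> x; elim/quotW=> y; elim/quotW=> z.
rewrite (hmulE y z) (hmulE x y) (hmulE x) (hmulE _ z).
by apply/hpiP; apply: hr_mulA.
Qed.

Lemma hmul_scC c x : hmul (hsc c) x = hmul x (hsc c).
Proof. by elim/quotW: x => x; rewrite (hmulE _ x) (hmulE x); apply/hpiP; apply: hr_scC. Qed.

Fact hmul1 : left_id (hsc 1) hmul.
Proof. by elim/quotW=> x; rewrite hmulE; apply/hpiP; apply: hr_mul1. Qed.

Fact hmul1r : right_id (hsc 1) hmul.
Proof. by move=> x; rewrite -hmul_scC hmul1. Qed.

Fact hmulDl : left_distributive hmul hadd.
Proof.
elim/quotW=> x; elim/quotW=> y; elim/quotW=> z; rewrite (haddE x y) (hmulE _ z).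
by rewrite (hmulE x z) (hmulE y z) haddE; apply/hpiP; apply: hr_mulDl.
Qed.

Fact hmulDr : right_distributive hmul hadd.
Proof.
elim/quotW=> x; elim/quotW=> y; elim/quotW=> z; rewrite (haddE y z) (hmulE x).
by rewrite (hmulE x y) (hmulE x z) haddE; apply/hpiP; apply: hr_mulDr.
Qed.

Lemma hscD a b : hsc (a + b) = hadd (hsc a) (hsc b).
Proof. by rewrite haddE; apply/hpiP; apply: hr_scD. Qed.

Lemma hscM a b : hsc (a * b) = hmul (hsc a) (hsc b).
Proof. by rewrite hmulE; apply/hpiP; apply: hr_scM. Qed.

(* The one-dimensional module with t_w = 1 shows that 1 != 0 in hecke. *)
Definition triv_weight (i : 'I_n) : C := (ks + kl * (n - i.+1)%:R)%:C.

Fixpoint heval (a : hterm) : C :=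
  match a with
  | hT _ => 1
  | hOm v => \sum_i v 0 i * triv_weight i
  | hSc c => c
  | hAdd a b => heval a + heval b
  | hMul a b => heval a * heval b
  end.

Lemma triv_weight_root i :
  \sum_k simple_root C i 0 k * triv_weight k = (kparam i)%:C.
Proof.
have dl j : \sum_k (delta_mx 0 j : 'rV[C]_n) 0 k * triv_weight k = triv_weight j.
  rewrite (bigD1 j) //= mxE !eqxx mul1r big1 ?addr0 // => k kj.
  by rewrite mxE (negbTE kj) mul0r.
rewrite /simple_root /kparam; case: insubP => [j lt_j jE|ge_i] /=; last first.
  by rewrite dl /triv_weight (_ : (n - i.+1)%N = 0%N) ?mulr0 ?addr0 //; apply/eqP; rewrite subn_eq0 leqNgt.
under eq_bigr => k _ do rewrite mxE [(- _ : 'rV[C]_n) _ _]mxE mulrBl.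
rewrite sumrB !dl /triv_weight -rmorphB /= jE; congr (_ %:C).
rewrite opprD addrACA subrr add0r -mulrBr -natrB ?leq_sub2l //.
by rewrite -(subnSK lt_j) subSnn mulr1.
Qed.

Lemma heval_rel a b : hrel a b -> heval a = heval b.
Proof.
elim=> //=.
- by move=> x y z _ -> _ ->.
- by move=> x x' y y' _ -> _ ->.
- by move=> x x' y y' _ -> _ ->.
- by move=> x y z; rewrite addrA.
- by move=> x y; rewrite addrC.
- by move=> x; rewrite add0r.
- by move=> x; rewrite mulN1r addNr.
- by move=> x y z; rewrite mulrA.
- by move=> x; rewrite mul1r.
- by move=> x y z; rewrite mulrDl.
- by move=> x y z; rewrite mulrDr.
- by move=> a' x; rewrite mulrC.
- by rewrite mulr1.
- by move=> u v; rewrite -big_split; apply: eq_bigr => i _; rewrite mxE mulrDl.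
- by move=> c v; rewrite mulr_sumr; apply: eq_bigr => i _; rewrite mxE mulrA.
- by move=> u v; rewrite mulrC.
- move=> i v; rewrite mulr1 mul1r wact_simple_refl ?pnatr_eq0 //.
  set c := _ / _; rewrite -(triv_weight_root i) mulr_suml -big_split /=.
  by apply: eq_bigr => k _; rewrite !mxE; ring.
Qed.

Fact honeN0 : hsc 1 != hsc 0.
Proof. by apply/eqP => /hpiP /heval_rel /eqP; rewrite oner_eq0. Qed.

HB.instance Definition _ :=
  GRing.Zmodule_isNzRing.Build hecke hmulA hmul1 hmul1r hmulDl hmulDr honeN0.

Fact hscaleA a b x : hscale a (hscale b x) = hscale (a * b) x.
Proof. by rewrite /hscale hscM hmulA. Qed.

Fact hscale1 : left_id 1 hscale.
Proof. exact: hmul1. Qed.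

Fact hscaleDr : right_distributive hscale +%R.
Proof. by move=> c x y; rewrite /hscale; exact: hmulDr. Qed.

Fact hscaleDl x : {morph hscale^~ x : a b / a + b}.
Proof. by move=> a b; rewrite /hscale hscD; exact: hmulDl. Qed.

HB.instance Definition _ :=
  GRing.Zmodule_isLmodule.Build C hecke hscaleA hscale1 hscaleDr hscaleDl.

Fact hscaleAl c x y : c *: (x * y) = (c *: x) * y.
Proof. exact: hmulA. Qed.

HB.instance Definition _ := GRing.Lmodule_isLalgebra.Build C hecke hscaleAl.

Fact hscaleAr c x y : c *: (x * y) = x * (c *: y).
Proof.
change (hmul (hsc c) (hmul x y) = hmul x (hmul (hsc c) y)).
by rewrite !hmulA hmul_scC.
Qed.

HB.instance Definition _ := GRing.Lalgebra_isAlgebra.Build C hecke hscaleAr.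

Definition hecke_t (w : bgroup n) : hecke := \pi_hecke (hT w).
Definition hecke_om (v : 'rV[C]_n) : hecke := \pi_hecke (hOm v).

Definition is_star (st : hecke -> hecke) : Prop :=
  [/\ forall x y, st (x + y) = st x + st y,
      forall (c : C) x, st (c *: x) = c^*%C *: st x,
      forall x y, st (x * y) = st y * st x,
      forall x, st (st x) = x &
      (forall w, st (hecke_t w) = hecke_t w^-1%g) /\
      forall w0, longest w0 -> forall v : 'rV[R]_n,
        let vC := map_mx (real_complex R) v in
        st (hecke_om vC)
          = - (hecke_t w0 * hecke_om (wact w0 vC) * hecke_t w0)].

Section Modules.
Variable X : lmodType hecke.

Definition is_simple : Prop :=
  (exists u : X, u <> 0) /\
  forall P : X -> Prop,
    P 0 -> (forall u v, P u -> P v -> P (u + v)) ->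
    (forall h u, P u -> P (h *: u)) ->
    (forall u, P u -> u = 0) \/ (forall u, P u).

Definition is_star_hermitian (st : hecke -> hecke) : Prop :=
  exists form : X -> X -> C,
    [/\ forall u v w, form (u + v) w = form u w + form v w,
        forall (c : C) u v, form (c%:A *: u) v = c * form u v,
        forall u v, form v u = (form u v)^*%C,
        forall u, (forall v, form u v = 0) -> u = 0 &
        forall h u v, form (h *: u) v = form u (st h *: v)].

Definition is_W_irreducible : Prop :=
  (exists u : X, u <> 0) /\
  forall P : X -> Prop,
    P 0 -> (forall u v, P u -> P v -> P (u + v)) ->
    (forall (c : C) u, P u -> P (c%:A *: u)) ->
    (forall w u, P u -> P (hecke_t w *: u)) ->
    (forall u, P u -> u = 0) \/ (forall u, P u).

Definition one_W_type (st : hecke -> hecke) : Prop :=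
  [/\ is_simple, is_star_hermitian st & is_W_irreducible].

(* Matrices act on columns here because X is a left module. *)
Definition W_restriction_iso (d : nat)
    (rW : mx_representation C [set: bgroup n]%G d) : Prop :=
  exists f : 'cV[C]_d -> X,
    [/\ bijective f,
        forall a b, f (a + b) = f a + f b,
        forall (c : C) a, f (c *: a) = c%:A *: f a &
        forall w a, f (rW w *m a) = hecke_t w *: f a].

(* S(V_C) is the polynomial ring in 'X_i = e_i. *)
Definition W_invariant (f : {mpoly C[n]}) : Prop :=
  forall w : bgroup n,
    f \mPo [tuple ((-1) ^+ w.2 i *: 'X_(w.1 i) : {mpoly C[n]}) | i < n] = f.

Definition hecke_poly (f : {mpoly C[n]}) : hecke :=
  mmap (fun c : C => c%:A) (fun i => hecke_om (delta_mx 0 i)) f.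

Definition has_central_character (nu : 'I_n -> C) : Prop :=
  forall f : {mpoly C[n]}, W_invariant f ->
  forall u : X, hecke_poly f *: u = (f.@[nu])%:A *: u.

End Modules.

End Hecke.

Section Induction.
Variables (F : fieldType) (kT gT : finGroupType) (j : kT -> gT) (d : nat).
Variable rK : mx_representation F [set: kT]%G d.

(* Row x of a matrix A : 'M_(#|gT|, d) is the value at x of a function
   gT -> 'rV_d.  With j an injective morphism, the induced module consists of
   the functions with f (x * j k) = f x *m rK k, on which g acts by
   (f g) x = f (g * x); this is a right action, as in [mx_representation]. *)
Definition lshift_mx (g : gT) : 'M[F]_#|gT| :=
  \matrix_(x, y) (enum_val y == (g * enum_val x)%g)%:R.
Definition rshift_mx (g : gT) : 'M[F]_#|gT| :=
  \matrix_(x, y) (enum_val y == (enum_val x * g)%g)%:R.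

Lemma lshift_mxE p (A : 'M[F]_(#|gT|, p)) g x :
  row x (lshift_mx g *m A) = row (enum_rank (g * enum_val x)%g) A.
Proof.
apply/rowP=> q; rewrite !mxE (bigD1 (enum_rank (g * enum_val x)%g)) //= !mxE.
rewrite enum_rankK eqxx mul1r big1 ?addr0 // => y /negbTE ney.
by rewrite mxE -(inj_eq (@enum_rank_inj gT)) enum_valK ney mul0r.
Qed.

Lemma rshift_mxE p (A : 'M[F]_(#|gT|, p)) g x :
  row x (rshift_mx g *m A) = row (enum_rank (enum_val x * g)%g) A.
Proof.
apply/rowP=> q; rewrite !mxE (bigD1 (enum_rank (enum_val x * g)%g)) //= !mxE.
rewrite enum_rankK eqxx mul1r big1 ?addr0 // => y /negbTE ney.
by rewrite mxE -(inj_eq (@enum_rank_inj gT)) enum_valK ney mul0r.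
Qed.

Lemma fun_mx_repr :
  mx_repr [set: gT]%G (fun g => lin_mulmx (lshift_mx g) : 'M[F]_(#|gT| * d)).
Proof.
split=> [|g h _ _]; apply/row_matrixP=> i; rewrite !rowE.
  rewrite -[delta_mx 0 i]vec_mxK mulmx1 mul_vec_lin /=; congr mxvec.
  by apply/row_matrixP=> x; rewrite lshift_mxE mul1g enum_valK.
rewrite mulmxA -[delta_mx 0 i]vec_mxK !mul_vec_lin /=; congr mxvec.
by apply/row_matrixP=> x; rewrite !lshift_mxE enum_rankK mulgA.
Qed.
Definition fun_repr := MxRepresentation fun_mx_repr.

Definition ind_space : 'M[F]_(#|gT| * d) :=
  (\bigcap_(k : kT) kermx (lin_mulmx (rshift_mx (j k)) - lin_mulmxr (rK k)))%MS.

Lemma ind_spaceP (A : 'M[F]_(#|gT|, d)) :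
  reflect (forall k, rshift_mx (j k) *m A = A *m rK k) (mxvec A <= ind_space)%MS.
Proof.
apply: (iffP sub_bigcapmxP) => h k => [|_].
  have /sub_kermxP := h k isT; rewrite mulmxBr !mul_vec_lin /= => /eqP.
  by rewrite subr_eq0 => /eqP/(can_inj mxvecK).
by apply/sub_kermxP; rewrite mulmxBr !mul_vec_lin /= h subrr.
Qed.

Lemma ind_mxmodule : mxmodule fun_repr ind_space.
Proof.
apply/mxmoduleP=> g _; apply/row_subP=> i; rewrite row_mul.
rewrite -[row i _]vec_mxK mul_vec_lin /=; apply/ind_spaceP=> k.
have /ind_spaceP h : (mxvec (vec_mx (row i ind_space)) <= ind_space)%MS.
  by rewrite vec_mxK row_sub.
rewrite -mulmxA -h; apply/row_matrixP=> x.
by rewrite rshift_mxE !lshift_mxE rshift_mxE !enum_rankK mulgA.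
Qed.

Definition ind_repr := submod_repr ind_mxmodule.

End Induction.

Section OuterTensor.
Variables (F : fieldType) (gT1 gT2 : finGroupType) (d1 d2 : nat).
Variables (r1 : mx_representation F [set: gT1]%G d1).
Variables (r2 : mx_representation F [set: gT2]%G d2).

Lemma outer_mx_repr :
  mx_repr [set: gT1 * gT2]%G (fun x => tprod (r1 x.1) (r2 x.2)).
Proof.
split=> [|x y _ _]; first by rewrite !repr_mx1 tprod1.
by rewrite -tprodE -!repr_mxM ?inE.
Qed.
Definition outer_repr := MxRepresentation outer_mx_repr.

End OuterTensor.

(* The rank is dim Hom_G (r1, r2): a row in this space is mxvec A for a matrix A
   with r1 g *m A = A *m r2 g for all g. *)
Definition hom_dim (F : fieldType) (gT : finGroupType) (d1 d2 : nat)
    (r1 : mx_representation F [set: gT]%G d1)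
    (r2 : mx_representation F [set: gT]%G d2) : nat :=
  \rank (\bigcap_(g : gT) kermx (lin_mulmx (r1 g) - lin_mulmxr (r2 g)
                                  : 'M_(d1 * d2, d1 * d2)))%MS.

Definition is_partition_of (m : nat) (la : seq nat) : bool :=
  [&& sorted geq la, 0%N \notin la & sumn la == m].

Definition conj_part (la : seq nat) : seq nat :=
  [seq count (fun l => j < l)%N la | j <- iota 0 (head 0%N la)].

(* Boxes (row, column) of the Young diagram, rows and columns numbered from 0,
   listed row by row. *)
Definition boxes (la : seq nat) : seq (nat * nat) :=
  [seq (i, j) | i <- iota 0 (size la), j <- iota 0 (nth 0%N la i)].

Section Specht.
Variables (F : fieldType) (m : nat) (la : seq nat).

(* The box containing k in the tableau with 0, ..., m-1 entered row by row. *)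
Definition box_of (k : 'I_m) : nat * nat := nth (0, 0)%N (boxes la) k.

Definition row_stab : {set 'S_m} :=
  [set p : 'S_m | [forall k, (box_of (p k)).1 == (box_of k).1]].
Definition col_stab : {set 'S_m} :=
  [set q : 'S_m | [forall k, (box_of (q k)).2 == (box_of k).2]].

(* [gring_row] turns an element of the group algebra, given by its matrix in the
   regular representation, into its coordinate row, so that [specht] is the
   right ideal generated by the Young symmetrizer. *)
Definition young_symmetrizer : 'rV[F]_(gcard [set: 'S_m]%G) :=
  gring_row (\sum_(p in row_stab) \sum_(q in col_stab)
               (-1) ^+ q *: regular_repr F [set: 'S_m]%G (p * q)%g).

Definition specht :=
  submod_repr (cyclic_mx_module (regular_repr F [set: 'S_m]%G)
                                young_symmetrizer).

End Specht.

Section Bipartitions.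
Variables (F : fieldType) (m s : nat).

Definition sum_fun (sg : 'S_m) (tau : 'S_s) (i : 'I_(m + s)) : 'I_(m + s) :=
  match split i with
  | inl a => lshift s (sg a)
  | inr b => rshift m (tau b)
  end.

Lemma sum_fun_inj sg tau : injective (sum_fun sg tau).
Proof.
apply: (can_inj (g := sum_fun sg^-1%g tau^-1%g)) => i; rewrite /sum_fun.
by rewrite -[RHS]splitK; case: (split i) => a /=;
  [rewrite (unsplitK (inl _)) | rewrite (unsplitK (inr _))]; rewrite permK.
Qed.

Definition sym_embed (x : 'S_m * 'S_s) : 'S_(m + s) :=
  perm (@sum_fun_inj x.1 x.2).

Definition bgroup_embed (x : bgroup m * bgroup s) : bgroup (m + s) :=
  (sym_embed (x.1.1, x.2.1),
   [ffun i => match split i with inl a => x.1.2 a | inr b => x.2.2 b end]).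

Lemma sym_embedE (x : 'S_m * 'S_s) (i : 'I_(m + s)) :
  sym_embed x i = match split i with
                  | inl a => lshift s (x.1 a)
                  | inr b => rshift m (x.2 b)
                  end.
Proof. by rewrite permE. Qed.

Lemma sym_embedM : {morph sym_embed : x y / (x * y)%g}.
Proof.
move=> x y; apply/permP=> i; rewrite permM !sym_embedE.
case: (split i) => a; first by rewrite (unsplitK (inl _)) permM.
by rewrite (unsplitK (inr _)) permM.
Qed.

Lemma sym_embed_inj : injective sym_embed.
Proof.
move=> [x1 x2] [y1 y2] /permP h; congr pair; apply/permP=> a.
  by have := h (lshift s a); rewrite !sym_embedE (unsplitK (inl _)) => /lshift_inj.
by have := h (rshift m a); rewrite !sym_embedE (unsplitK (inr _)) => /rshift_inj.
Qed.

Lemma bgroup_embedM : {morph bgroup_embed : x y / (x * y)%g}.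
Proof.
move=> x y; congr pair; first exact: (sym_embedM (_, _) (_, _)).
apply/ffunP=> i; rewrite !ffunE /= sym_embedE.
case: (split i) => a; first by rewrite (unsplitK (inl _)) ffunE.
by rewrite (unsplitK (inr _)) ffunE.
Qed.

Lemma bgroup_embed_inj : injective bgroup_embed.
Proof.
move=> [[x1 d1] [x2 d2]] [[y1 e1] [y2 e2]] [h /ffunP hs].
have [-> ->] := sym_embed_inj h; congr (_, _, (_, _)); apply/ffunP=> a.
  by have := hs (lshift s a); rewrite !ffunE (unsplitK (inl _)).
by have := hs (rshift m a); rewrite !ffunE (unsplitK (inr _)).
Qed.

Definition LR_coef (la laL laR : seq nat) : nat :=
  hom_dim (specht F (m + s) la)
          (ind_repr sym_embed (outer_repr (specht F m laL) (specht F s laR))).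

End Bipartitions.

Section Inflation.
Variables (F : fieldType) (n d : nat) (r : mx_representation F [set: 'S_n]%G d).

Lemma infl_mx_repr : mx_repr [set: bgroup n]%G (fun w => r w.1).
Proof. by split=> [|x y _ _]; rewrite ?repr_mx1 // -repr_mxM ?inE. Qed.
Definition infl_repr := MxRepresentation infl_mx_repr.

Lemma infl_sign_mx_repr :
  mx_repr [set: bgroup n]%G (fun w => (\prod_i (-1) ^+ w.2 i) *: r w.1).
Proof.
split=> [|x y _ _].
  by rewrite repr_mx1 big1 ?scale1r // => i _; rewrite ffunE.
rewrite -scalemxAl -scalemxAr scalerA -repr_mxM ?inE //; congr (_ *: _).
rewrite [X in _ * X](reindex_inj (@perm_inj _ x.1)) -big_split /=.
by apply: eq_bigr => i _; rewrite ffunE signr_addb.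
Qed.
Definition infl_sign_repr := MxRepresentation infl_sign_mx_repr.

End Inflation.

(* laL x laR, induced from W(B_m) x W(B_s) = (S_m x S_s) |x (Z/2)^(m+s). *)
Definition bipartition_repr (F : fieldType) (m s : nat) (laL laR : seq nat) :=
  ind_repr (@bgroup_embed m s)
    (outer_repr (infl_repr (specht F m laL)) (infl_sign_repr (specht F s laR))).

(* j - i does not depend on numbering from 0 or from 1; the order of the
   entries is that of [boxes]. *)
Definition nu_vec (R : realType) (kl ks : R) (n : nat) (la : seq nat)
    (k : 'I_n) : R :=
  let b := nth (0, 0)%N (boxes la) k in ks + kl * (b.2%:R - b.1%:R).

(* Main.v *)
(* Write t_w and E_i for the matrices of t_w and e_i on X, and tau_i for the sign
   change of the i-th coordinate.  On lambda_L x lambda_R there is a second action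
   sigma of S_n, twisted by the sign character of the factor S_s, such that
   (1 + tau_i tau_j) sigma_ij = (tau_i + tau_j) t_ij, and for which the induced
   representation of lambda_L and lambda_R^t maps injectively to X.  Hence if an
   invariant polynomial f of the elements L_k = ks + kl (Jucys-Murphy element of
   sigma) commutes with W, it acts by f(nu_lambda), the contents of lambda being
   the weights of the Jucys-Murphy elements on lambda.

   If lambda_L or lambda_R is empty then all tau_i are one sign, and the E_k are,
   up to that sign, the L_k for the reversed order of the indices.  If kl = 0 then
   E_k = ks tau_k.  Otherwise E_1 E_2 = E_2 E_1 and sum tau_i = n - 2s force
   E_1 to be a scalar q, so that E_k = q - kl (Jucys-Murphy element of t), and the
   cross relation with tau_n makes every sum of the (i j), j <> i, a scalar on
   lambda_L and on lambda_R, which are therefore rectangles.  The same relation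
   gives tau_n L_n + L_n tau_n = 2 q, so f(L) commutes with W.  Both f(E) and f(L)
   are then read off from the contents of the diagram obtained by putting two
   rectangles side by side, and the two lists agree up to order and signs. *)

Require Import Defs.
From mathcomp Require Import all_boot all_order all_algebra all_fingroup.
From mathcomp Require Import mxrepresentation character complex reals.
From HB Require Import structures.
From mathcomp Require Import ssrcomplements mpoly zify ring.

Set Implicit Arguments.
Unset Strict Implicit.
Unset Printing Implicit Defensive.

Import Order.TTheory GRing.Theory Num.Theory.
Local Open Scope ring_scope.

(** * Evaluation of invariant polynomials at matrices *)

(** Nothing is diagonalised. Once an invariant polynomial acts by a scalar, the scalar is read off
    from one nonzero row on which all its arguments act by numbers. Young symmetrizers are such rows
    for the Jucys-Murphy elements in column reading order, and symmetric polynomials do not see the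
    order. So any constituent may serve; two rectangles are juxtaposed because the symmetrizer of
    that diagram is visibly a nonzero image of a vector of the induced module.

    The action sigma is formally t conjugated by a sign function on S_n that changes by the sign
    character of S_s along cosets of S_m x S_s. When both factors are nontrivial, n - 2s differs
    from n and -n; this forces E_1 to be scalar and fails for a single block, hence the case
    distinction.

    For rectangles with a rows and b columns, resp. a2 and b2, the star sums give q - ks = kl (b -
    a) and q + ks = kl (b2 - a2). So the arguments of f are kl / 2 times integers, and agreement up
    to order and signs becomes a count of absolute values. *)

Section MxEval.
Variables (F : fieldType) (n : nat).
Implicit Types (f g : {mpoly F[n]}) (i j : 'I_n).

(** The factors are taken in the fixed order of the indices, so evaluation makes sense at any
    matrices; it becomes multiplicative once they commute. *)
Definition mxmono d (x : 'I_n -> 'M[F]_d) (m : 'X_{1..n}) : 'M[F]_d :=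
  \prod_(i < n) x i ^+ m i.

Definition mxeval d (x : 'I_n -> 'M[F]_d) f : 'M[F]_d :=
  \sum_(m <- msupp f) f@_m *: mxmono x m.

Section OnePoint.
Variables (d : nat) (x : 'I_n -> 'M[F]_d).

Lemma mxevalw f k : (msize f <= k)%N ->
  mxeval x f = \sum_(m : 'X_{1..n < k}) f@_m *: mxmono x m.
Proof.
move=> le_fk; pose I : subFinType _ := 'X_{1..n < k}.
rewrite /mxeval (big_mksub I) ?msupp_uniq //=; last first.
  by move=> m /msize_mdeg_lt /leq_trans; apply.
by rewrite big_rmcond //= => m /memN_msupp_eq0 ->; rewrite scale0r.
Qed.

Lemma mxeval_linear : linear (mxeval x).
Proof.
move=> c f g; pose k := maxn (msize f) (maxn (msize g) (msize (c *: f + g))).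
rewrite !(mxevalw (k := k)) /k ?leq_max ?leqnn ?orbT // scaler_sumr -big_split.
by apply: eq_bigr => m _; rewrite mcoeffD mcoeffZ scalerDl scalerA.
Qed.

HB.instance Definition _ :=
  GRing.isLinear.Build F {mpoly F[n]} 'M[F]_d *:%R (mxeval x) mxeval_linear.

Lemma mxevalX m : mxeval x 'X_[m] = mxmono x m.
Proof. by rewrite /mxeval msuppX big_seq1 mcoeffX eqxx scale1r. Qed.

Lemma mxeval1 : mxeval x 1 = 1%:M.
Proof. by rewrite -mpolyX0 mxevalX /mxmono big1 // => i _; rewrite mnm0E. Qed.

Hypothesis xC : forall i j, x i *m x j = x j *m x i.

Lemma mxmonoU i m : mxmono x (U_(i) + m) = x i *m mxmono x m.
Proof.
rewrite /mxmono; have : i \in index_enum 'I_n by rewrite mem_index_enum.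
have : uniq (index_enum 'I_n) by rewrite index_enum_uniq.
have comm_xi k j : GRing.comm (x i) (x j ^+ k).
  by apply: commrX; rewrite /GRing.comm; apply: xC.
elim: (index_enum 'I_n) => // j r IHr /= /andP[jr ur].
rewrite !big_cons mnmDE mnm1E inE; case: eqVneq => [eij _|ij /= /(IHr ur) ->]; last first.
  by rewrite add0n !mulmxE !mulrA comm_xi.
rewrite -{j}eij in jr *.
rewrite add1n exprS mulmxE -mulrA; congr (_ * (_ * _)).
rewrite !big_seq; apply: eq_bigr => k kr; rewrite mnmDE mnm1E.
by case: eqVneq jr => // ->; rewrite kr.
Qed.

Lemma mxevalXM i f : mxeval x ('X_i * f) = x i *m mxeval x f.
Proof.
elim/mpolyind: f => [|c m f _ _ IH]; first by rewrite mulr0 !linear0.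
by rewrite mulrDr -scalerAr -mpolyXD !linearD !linearZ /= IH !mxevalX mxmonoU.
Qed.

End OnePoint.

(** Induction one variable at a time, because the cross relation extends to polynomials by a twisted
    Leibniz rule for multiplication by a variable. *)
Lemma mpoly_varind (P : {mpoly F[n]} -> Prop) :
  P 1 -> (forall i f, P f -> P ('X_i * f)) ->
  (forall c f g, P f -> P g -> P (c *: f + g)) -> forall f, P f.
Proof.
move=> P1 PX PD; have P0 : P 0 by rewrite -(addNr 1) -scaleN1r; apply: PD.
have PM m : P 'X_[m].
  have [k] := ubnP (mdeg m); elim: k m => // k IHk m.
  have [->|m0] := eqVneq m 0%MM; first by rewrite mpolyX0.
  have [i mi] : exists i, m i != 0%N.
    apply/existsP; apply: contraNT m0; rewrite negb_exists => /forallP m0.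
    by apply/eqP/mnmP => i; rewrite mnm0E; have := m0 i; rewrite negbK => /eqP.
  rewrite ltnS => le_mk; have mE : (m = U_(i) + (m - U_(i)))%MM.
    by rewrite addmC submK // lep1mP.
  rewrite mE mpolyXD; apply: PX; apply: IHk.
  by move: le_mk; rewrite [in mdeg m]mE mdegD mdeg1.
by elim/mpolyind => // c m f _ _ Pf; apply: PD.
Qed.

Lemma mxeval_rowE d p (x : 'I_n -> 'M[F]_d) (y : 'M[F]_(p, d)) (c : 'I_n -> F) f :
  (forall i, y *m x i = c i *: y) -> y *m mxeval x f = f.@[c] *: y.
Proof.
move=> yx; have yxn i k : y *m (x i ^+ k) = c i ^+ k *: y.
  elim: k => [|k IHk]; first by rewrite !expr0 scale1r mulmx1.
  by rewrite !exprS -mulmxE mulmxA yx -scalemxAl IHk scalerA.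
rewrite mevalE /mxeval mulmx_sumr scaler_suml; apply: eq_bigr => m _.
rewrite -scalemxAr -scalerA; congr (_ *: _); rewrite /mxmono.
elim: (index_enum _) => [|i r IHr]; first by rewrite !big_nil mulmx1 scale1r.
by rewrite !big_cons -mulmxE mulmxA yxn -scalemxAl IHr scalerA.
Qed.

Lemma mxeval_intertwine d e (x : 'I_n -> 'M[F]_d) (y : 'I_n -> 'M[F]_e)
    (J : 'M[F]_(d, e)) f :
  (forall i, x i *m J = J *m y i) -> mxeval x f *m J = J *m mxeval y f.
Proof.
move=> xJ; have xJn i k : x i ^+ k *m J = J *m (y i ^+ k).
  elim: k => [|k IHk]; first by rewrite !expr0 mulmx1 mul1mx.
  by rewrite !exprS -!mulmxE -mulmxA IHk !mulmxA xJ.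
rewrite /mxeval mulmx_sumr mulmx_suml; apply: eq_bigr => m _.
rewrite -scalemxAr -scalemxAl; congr (_ *: _); rewrite /mxmono.
elim: (index_enum _) => [|i r IHr]; first by rewrite !big_nil mulmx1 mul1mx.
by rewrite !big_cons -!mulmxE -mulmxA IHr !mulmxA xJn.
Qed.

Definition signed_subst (w : bgroup n) f : {mpoly F[n]} :=
  f \mPo [tuple ((-1) ^+ w.2 i *: 'X_(w.1 i) : {mpoly F[n]}) | i < n].

Lemma signed_substP w c f g :
  signed_subst w (c *: f + g) = c *: signed_subst w f + signed_subst w g.
Proof. exact: linearP. Qed.

Lemma signed_substXM w i f :
  signed_subst w ('X_i * f) = (-1) ^+ w.2 i *: ('X_(w.1 i) * signed_subst w f).
Proof.
by rewrite /signed_subst rmorphM /= comp_mpolyXU -tnth_nth tnth_mktuple scalerAl.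
Qed.

Lemma mxeval_subst d (x : 'I_n -> 'M[F]_d) w f :
  (forall i j, x i *m x j = x j *m x i) ->
  mxeval x (signed_subst w f) = mxeval (fun i => (-1) ^+ w.2 i *: x (w.1 i)) f.
Proof.
move=> xC; elim/mpoly_varind: f => [|i f IH|c f g IHf IHg].
- by rewrite [signed_subst _ _]comp_mpoly1 !mxeval1.
- rewrite signed_substXM linearZ /= mxevalXM // IH mxevalXM ?scalemxAl //.
  by move=> j k; rewrite -!scalemxAl -!scalemxAr xC scalerA mulrC -scalerA.
by rewrite signed_substP !linearP /= -IHf -IHg.
Qed.

Lemma meval_subst (c : 'I_n -> F) w f :
  (signed_subst w f).@[c] = f.@[fun i => (-1) ^+ w.2 i * c (w.1 i)].
Proof.
rewrite comp_mpoly_meval; apply: meval_eq => i.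
by rewrite tnth_mktuple mevalZ mevalXU.
Qed.

(* Evaluated form of the relation T f = s(f) T + k (f - s f) / alpha of a
   graded Hecke algebra, alpha being a linear form. *)
Lemma mxeval_cross d (x : 'I_n -> 'M[F]_d) (T : 'M[F]_d) (w : bgroup n)
    (al : {mpoly F[n]}) (k : F) (a : 'I_n -> F) f :
    (forall i j, x i *m x j = x j *m x i) ->
    al != 0 ->
    (forall i, 'X_i - (-1) ^+ w.2 i *: 'X_(w.1 i) = a i *: al :> {mpoly F[n]}) ->
    (forall i, T *m x i = ((-1) ^+ w.2 i *: x (w.1 i)) *m T + (k * a i)%:M) ->
    signed_subst w f = f ->
  T *m mxeval x f = mxeval x f *m T.
Proof.
move=> xC al0 alE TE sf.
(* [g] is the divided difference of [f] along [al], built together with the formula. If [f] is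
   invariant then [al * g = 0], and [g] vanishes because polynomials form a domain. *)
suff [g] : exists g, al * g = f - signed_subst w f /\
    T *m mxeval x f = mxeval x (signed_subst w f) *m T + k *: mxeval x g.
  rewrite sf subrr => -[/eqP]; rewrite mulf_eq0 (negbTE al0) /= => /eqP ->.
  by rewrite linear0 scaler0 addr0.
elim/mpoly_varind: f {sf} => [|i f [g [fE IH]]|c f h [g [fE IH]] [g' [hE IH']]].
- exists 0; rewrite [signed_subst _ _]comp_mpoly1 subrr mulr0 linear0 scaler0 addr0.
  by rewrite mxeval1 mulmx1 mul1mx.
(* Leibniz rule for divided differences: that of X_i f is s(X_i) times that of f, plus [a i] times
   f. *)
- exists ((-1) ^+ w.2 i *: ('X_(w.1 i) * g) + a i *: f); split.
    rewrite signed_substXM mulrDr -!scalerAr mulrCA fE [a i *: _]scalerAl -alE.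
    by rewrite mulrBr scalerBr mulrBl -scalerAl addrC addrA subrK.
  rewrite mxevalXM // mulmxA TE mulmxDl mul_scalar_mx -mulmxA IH.
  rewrite signed_substXM mulmxDr !linearD !linearZ /= !mxevalXM //.
  by rewrite -!scalemxAl !scalerA mulmxA [k * (-1) ^+ _]mulrC [k * a i]mulrC -!addrA.
exists (c *: g + g'); split.
  rewrite mulrDr -scalerAr fE hE signed_substP /= scalerBr.
  by rewrite opprD addrACA.
rewrite signed_substP !linearP /= IH IH' mulmxDl.
by rewrite scalerDr -scalemxAl addrACA.
Qed.

End MxEval.

(** * Jucys-Murphy elements *)

(** Jucys-Murphy element for the order in which [o] ranks the indices. Besides the natural order,
    column reading orders (Young symmetrizers) and the reversed order (a single block) occur. *)
Definition jm n (F : fieldType) d (r : 'S_n -> 'M[F]_d) (o : 'S_n) (k : 'I_n) : 'M[F]_d :=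
  \sum_(j | (o j < o k)%N) r (tperm j k).

Lemma perm_adjacent_ind n (P : 'S_n -> Prop) :
  P 1%g -> (forall p q, P p -> P q -> P (p * q)%g) ->
  (forall i j : 'I_n, j = i.+1 :> nat -> P (tperm i j)) -> forall p, P p.
Proof.
move=> P1 PM Padj.
have Plt (i j : 'I_n) : (i < j)%N -> P (tperm i j).
  have [k] := ubnP (j - i); elim: k i j => // k IHk i j le_jik lt_ij.
  have [/eqP/esym eq_ij|ne_ij] := boolP (i.+1 == j :> nat); first exact: Padj eq_ij.
  have lt_j'n : (j.-1 < n)%N by apply: leq_ltn_trans (leq_pred j) _.
  pose j' := Ordinal lt_j'n; have j'E : j = j'.+1 :> nat by rewrite /= prednK //; case: (j : nat) lt_ij.
  have lt_ij' : (i < j')%N by rewrite ltn_neqAle -ltnS -j'E lt_ij -(eqn_add2r 1) !addn1 -j'E ne_ij.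
  have <- : (tperm j' j * tperm i j' * tperm j' j)%g = tperm i j.
    rewrite -{1}[tperm j' j]tpermV -mulgA -conjgE tpermJ tpermL tpermD //.
      by rewrite -val_eqE /= -?j'E gtn_eqF.
    by rewrite -val_eqE /= gtn_eqF.
  have le_j : (j' - i < k)%N by move: le_jik; rewrite ltnS j'E subSn // ltnW.
  by apply: (PM) (Padj _ _ j'E); apply: (PM) (Padj _ _ j'E) (IHk _ _ le_j lt_ij').
move=> p; have [ts -> _] := prod_tpermP p.
elim: ts => [|[i j] ts IH]; first by rewrite big_nil.
rewrite big_cons; apply: PM => //=; case: (ltngtP i j) => [/Plt //|/Plt|/val_inj ->].
  by rewrite tpermC.
by rewrite tperm1.
Qed.

Section JucysMurphy.
Variables (n d : nat) (F : fieldType) (r : 'S_n -> 'M[F]_d).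
Hypotheses (r1 : r 1%g = 1%:M) (rM : forall p q, r (p * q)%g = r p *m r q).
Implicit Types (o p q : 'S_n) (i j k : 'I_n).

Lemma jm_conj o p k : jm r o k *m r p = r p *m jm r (p^-1 * o)%g (p k).
Proof.
rewrite /jm mulmx_suml mulmx_sumr [RHS](reindex_inj (@perm_inj _ p)) /=.
apply: eq_big => [j|j _]; first by rewrite !permM !permK.
by rewrite -!rM -tpermJ conjgE !mulgA mulgV mul1g.
Qed.

(** If i precedes j, each transposition in the element of i permutes the indices before j and fixes
    j, hence commutes with the element of j. *)
Lemma jm_comm o i j : jm r o i *m jm r o j = jm r o j *m jm r o i.
Proof.
wlog lt_ij : i j / (o i < o j)%N.
  by move=> IH; case: (ltngtP (o i) (o j)) => [/IH|/IH|/val_inj/perm_inj->] //.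
rewrite [jm r o i]/jm [LHS]mulmx_suml [RHS]mulmx_sumr; apply: eq_bigr => a lt_ai.
rewrite jm_conj; have ne_aj : a != j by apply: contraTneq lt_ai => ->; rewrite -leqNgt ltnW.
have ne_ij : i != j by apply: contraTneq lt_ij => ->; rewrite ltnn.
rewrite tpermD //; congr (_ *m _); apply: eq_bigl => k.
rewrite !permM tpermV [tperm a i j]tpermD //.
have lt_aj := ltn_trans lt_ai lt_ij.
by case: tpermP => [->|->|//]; rewrite ?lt_ij ?lt_aj.
Qed.

Lemma jm_adjacent o i j : o j = (o i).+1 :> nat ->
  jm r o j = r (tperm i j) *m jm r o i *m r (tperm i j) + r (tperm i j).
Proof.
move=> oj; have ne_ij : i != j.
  by apply/eqP => eij; move: oj; rewrite eij => /eqP; rewrite -[X in X == _]addn0 -addn1 eqn_add2l.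
have rtt : r (tperm i j) *m r (tperm i j) = 1%:M by rewrite -rM tperm2 r1.
rewrite -mulmxA jm_conj mulmxA rtt mul1mx tpermL /jm (bigD1 i) ?oj //= addrC.
congr (_ + _); apply: eq_bigl => k; rewrite !permM tpermV tpermR.
case: tpermP => [->|->|/eqP ki kj].
- by rewrite eqxx andbF oj ltnNge leqnSn.
- by rewrite oj !ltnn.
by rewrite ki andbT ltnS leq_eqVlt val_eqE (inj_eq perm_inj) (negbTE ki).
Qed.

Variables (q c : F).
Let x o k := q%:M + c *: jm r o k.

Lemma affine_jm_comm o i j : x o i *m x o j = x o j *m x o i.
Proof.
rewrite /x !mulmxDl !mulmxDr -!scalemxAl -!scalemxAr jm_comm !scalar_mxC.
rewrite -!addrA; congr (_ + _); rewrite !addrA; congr (_ + _).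
by rewrite addrC scalemxAr.
Qed.

Definition symmetric_under_perms (f : {mpoly F[n]}) :=
  forall p, signed_subst (p, [ffun => false]) f = f.

Variable f : {mpoly F[n]}.
Hypothesis fS : symmetric_under_perms f.

Lemma mxeval_perm (y : 'I_n -> 'M[F]_d) p :
  (forall i j, y i *m y j = y j *m y i) -> mxeval (y \o p) f = mxeval y f.
Proof.
move=> yC; rewrite -[in RHS](fS p) mxeval_subst //; congr mxeval.
by apply: boolp.funext => i; rewrite /= ffunE scale1r.
Qed.

(** The elements [x 1 k] satisfy the type A cross relations with parameter -c for adjacent
    transpositions, so [mxeval_cross] applies with the linear form X_i - X_j. *)
Lemma mxeval_jm_central p : mxeval (x 1%g) f *m r p = r p *m mxeval (x 1%g) f.
Proof.
elim/perm_adjacent_ind: p => [|p p' IH IH'|i j jE].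
- by rewrite r1 mulmx1 mul1mx.
- by rewrite rM mulmxA IH -!mulmxA IH'.
have ne_ij : i != j by rewrite -val_eqE /= jE ltn_eqF.
have oj : (1%g : 'S_n) j = ((1%g : 'S_n) i).+1 :> nat by rewrite !perm1.
have rtt : r (tperm i j) *m r (tperm i j) = 1%:M by rewrite -rM tperm2 r1.
have xj : r (tperm i j) *m x 1%g i = x 1%g j *m r (tperm i j) - c%:M.
  rewrite /x (jm_adjacent oj) mulmxDr mulmxDl scalar_mxC -scalemxAr.
  rewrite scalerDr mulmxDl -!scalemxAl -[_ *m _ *m _ *m _]mulmxA rtt mulmx1.
  by rewrite scalemx1 addrA addrK.
have xi : r (tperm i j) *m x 1%g j = x 1%g i *m r (tperm i j) + c%:M.
  apply/(canRL (subrK _))/esym; set T := r _ in rtt xj *.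
  rewrite -{1}[x 1%g i]mul1mx -{1}rtt -[T *m T *m _]mulmxA {}xj mulmxBr mulmxBl.
  by rewrite scalar_mxC -!mulmxA rtt !mulmx1.
symmetry.
apply: (@mxeval_cross F n d (x 1%g) _ (tperm i j, [ffun => false])
         ('X_i - 'X_j) (- c) (fun k => (k == i)%:R - (k == j)%:R)) => //.
- exact: affine_jm_comm.
- rewrite subr_eq0; apply: contraNneq ne_ij => /(congr1 (meval (fun k => (k == i)%:R : F))).
  rewrite !mevalXU eqxx eq_sym; case: (i == j) => // /eqP; by rewrite /= oner_eq0.
- move=> k /=; rewrite ffunE scale1r; case: tpermP => [->|->|/eqP/negbTE-> /eqP/negbTE->].
  + by rewrite eqxx (negbTE ne_ij) subr0 scale1r.
  + by rewrite eqxx eq_sym (negbTE ne_ij) sub0r scaleN1r opprB.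
  + by rewrite !subrr scale0r.
move=> k /=; rewrite ffunE scale1r; case: tpermP => [->|->|/eqP ki /eqP kj].
- by rewrite eqxx (negbTE ne_ij) subr0 mulr1 xj raddfN.
- by rewrite eqxx eq_sym (negbTE ne_ij) sub0r mulrNN mulr1.
rewrite (negbTE ki) (negbTE kj) subrr mulr0 raddf0 addr0 /x mulmxDr mulmxDl scalar_mxC.
congr (_ + _); rewrite -scalemxAr -scalemxAl jm_conj tpermD 1?eq_sym //.
congr (_ *: (_ *m _)); apply: eq_bigl => l; rewrite !permM tpermV [tperm i j k]tpermD 1?eq_sym //.
rewrite !perm1; case: tpermP => [->|->|//]; move: ki kj; rewrite -!val_eqE jE /=; lia.
Qed.

(** Changing the order conjugates the family by [r o] and permutes it; a symmetric polynomial
    ignores the permutation and, being central, the conjugation. *)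
Lemma mxeval_jm_order o : mxeval (x o) f = mxeval (x 1%g) f.
Proof.
have roV : r o *m r o^-1%g = 1%:M by rewrite -rM mulgV r1.
have rVo : r o^-1%g *m r o = 1%:M by rewrite -rM mulVg r1.
have -> : x o = fun k => r o *m x 1%g (o k) *m r o^-1%g.
  apply: boolp.funext => k; rewrite /x mulmxDr mulmxDl -scalemxAr -scalemxAl.
  rewrite scalar_mxC -mulmxA roV mulmx1; congr (_ + _ *: _).
  by rewrite -mulmxA jm_conj invgK mulmxA roV mul1mx mulg1 permK.
have xo : mxeval (fun k => r o *m x 1%g (o k) *m r o^-1%g) f *m r o
            = r o *m mxeval (x 1%g \o o) f.
  by apply: mxeval_intertwine => i /=; rewrite -!mulmxA rVo mulmx1.
rewrite mxeval_perm -?mxeval_jm_central in xo; last exact: affine_jm_comm.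
by have := congr1 (mulmx^~ (r o^-1%g)) xo; rewrite -!mulmxA roV !mulmx1.
Qed.

End JucysMurphy.

(** * Young symmetrizers and contents *)

Section Garnir.
Variables (F : numFieldType) (n d : nat) (r : 'S_n -> 'M[F]_d).
Hypotheses (r1 : r 1%g = 1%:M) (rM : forall p q, r (p * q)%g = r p *m r q).
Variable pos : 'I_n -> nat * nat.
Hypothesis pos_inj : injective pos.
Hypothesis pos_left : forall k c, (c < (pos k).2)%N -> exists j, pos j = ((pos k).1, c).
Hypothesis pos_up : forall k i, (i < (pos k).1)%N -> exists j, pos j = (i, (pos k).2).

(** A tableau is any injective [pos] whose image is closed under moving left and up, not only a row
    by row filling: juxtaposed diagrams keep the numbering of their two blocks. *)
Definition row_stabilizer : {set 'S_n} := [set p : 'S_n | [forall k, (pos (p k)).1 == (pos k).1]].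
Definition col_stabilizer : {set 'S_n} := [set p : 'S_n | [forall k, (pos (p k)).2 == (pos k).2]].
Definition row_sym : 'M[F]_d := \sum_(p in row_stabilizer) r p.
Definition col_antisym : 'M[F]_d := \sum_(q in col_stabilizer) (-1) ^+ q *: r q.

Lemma row_stabP (p : 'S_n) : reflect (forall k, (pos (p k)).1 = (pos k).1) (p \in row_stabilizer).
Proof. by rewrite inE; apply: (iffP forallP) => h k; apply/eqP. Qed.

Lemma col_stabP (p : 'S_n) : reflect (forall k, (pos (p k)).2 = (pos k).2) (p \in col_stabilizer).
Proof. by rewrite inE; apply: (iffP forallP) => h k; apply/eqP. Qed.

Lemma row_symM p : p \in row_stabilizer -> row_sym *m r p = row_sym.
Proof.
move=> /row_stabP pr; rewrite [RHS](reindex_inj (mulIg p)) /= /row_sym mulmx_suml.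
apply: eq_big => [q|q _]; last by rewrite rM.
by apply/row_stabP/row_stabP => h k; have := h k; rewrite permM pr.
Qed.

Lemma col_antisymM p : p \in col_stabilizer ->
  col_antisym *m r p = (-1) ^+ p *: col_antisym.
Proof.
move=> /col_stabP pr; rewrite /col_antisym mulmx_suml scaler_sumr.
rewrite [RHS](reindex_inj (mulIg p)) /=.
apply: eq_big => [q|q _].
  by apply/col_stabP/col_stabP => h k; have := h k; rewrite permM pr.
by rewrite odd_permM signr_addb rM scalerA mulrC -mulrA -expr2 sqrr_sign mulr1 scalemxAl.
Qed.

Lemma tperm_col i j : (pos i).2 = (pos j).2 -> tperm i j \in col_stabilizer.
Proof. by move=> h; apply/col_stabP => k; case: tpermP => [->|->|]. Qed.

Lemma tperm_row i j : (pos i).1 = (pos j).1 -> tperm i j \in row_stabilizer.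
Proof. by move=> h; apply/row_stabP => k; case: tpermP => [->|->|]. Qed.

(** A Garnir relation. For each [q] in the column group one transposition, pulled through [q], falls
    into the row group and is absorbed; the other terms cancel in pairs of opposite sign. *)
Lemma garnir k c : (c < (pos k).2)%N ->
  row_sym *m col_antisym *m (\sum_(j | (pos j).2 == c) r (tperm j k)) =
  row_sym *m col_antisym.
Proof.
move=> lt_ck.
have /fin_all_exists[v vE] (u : 'I_n) : exists j, (c < (pos u).2)%N -> pos j = ((pos u).1, c).
  case: ltnP => [/pos_left[j jE]|_]; by [exists j | exists u].
(* The image under [q] of the entry of column c lying in the row of [q^-1 k]: the transposition of k
   and [vq q] is the one absorbed by [row_sym]. *)
pose vq (q : 'S_n) := q (v (q^-1%g k)).
have colV (q : 'S_n) u : q \in col_stabilizer -> (pos (q^-1%g u)).2 = (pos u).2.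
  by move=> /col_stabP qc; rewrite -[in RHS](permKV q u) qc.
have vqc (q : 'S_n) : q \in col_stabilizer -> (pos (vq q)).2 = c.
  by move=> qc; have /col_stabP -> := qc; rewrite vE // colV.
have ne_kc j : (pos j).2 = c -> j != k.
  by move=> jc; apply: contraTneq lt_ck => <-; rewrite jc ltnn.
set A := row_sym.
have Aq (q : 'S_n) : q \in col_stabilizer -> A *m r q *m r (tperm k (vq q)) = A *m r q.
  move=> qc; rewrite -mulmxA -rM.
  have -> : (q * tperm k (vq q) = tperm (q^-1 k) (v (q^-1 k)) * q)%g.
    by rewrite -[X in tperm X (vq q)](permKV q k) -tpermJ conjgE !mulgA mulgV mul1g.
  by rewrite rM mulmxA row_symM // tperm_row // vE ?colV.
have -> : A *m col_antisym = \sum_(q in col_stabilizer) (-1) ^+ q *: (A *m r q).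
  by rewrite /col_antisym mulmx_sumr; apply: eq_bigr => q _; rewrite scalemxAr.
pose S0 := \sum_(q in col_stabilizer) (-1) ^+ q *: (A *m r q).
pose f (x : 'S_n * 'I_n) := (-1) ^+ x.1 *: (A *m r x.1 *m r (tperm x.2 k)).
pose P (x : 'S_n * 'I_n) := (x.1 \in col_stabilizer) && ((pos x.2).2 == c).
(* The sign-reversing involution on the remaining pairs. It keeps the product unchanged because
   [A q] absorbs the transposition of k and [vq q]. *)
pose h (x : 'S_n * 'I_n) := ((x.1 * tperm x.2 (vq x.1))%g, vq x.1).
pose Q x := P x && (x.2 != vq x.1).
have S1E : S0 *m (\sum_(j | (pos j).2 == c) r (tperm j k)) = \sum_(x | P x) f x.
  rewrite /S0 mulmx_suml -(pair_big_dep (mem col_stabilizer) (fun _ j => (pos j).2 == c) (fun q j => f (q, j))).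
  by apply: eq_bigr => q _; rewrite mulmx_sumr; apply: eq_bigr => j _; rewrite /f /= -!scalemxAl.
have hv x : Q x -> vq (h x).1 = x.2.
  case: x => q j /andP[/andP[/= qc /eqP jc] ne].
  have invk : (q * tperm j (vq q))^-1%g k = q^-1%g k.
    by rewrite invMg tpermV permM tpermD ?ne_kc ?vqc.
  by rewrite {1}/vq invk permM tpermR.
have hQ x : Q x -> Q (h x).
  move=> Qx; rewrite /Q hv //; case: x Qx => q j /andP[/andP[/= qc /eqP jc] ne].
  rewrite /P /= vqc // eqxx eq_sym ne !andbT; apply/col_stabP => i; rewrite permM.
  have /col_stabP -> : tperm j (vq q) \in col_stabilizer by apply: tperm_col; rewrite jc vqc.
  by have /col_stabP -> := qc.
have hh x : Q x -> h (h x) = x.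
  move=> Qx; rewrite {1}/h hv //=; case: x Qx => q j Qx /=.
  by rewrite -mulgA [tperm (vq q) j]tpermC tperm2 mulg1.
have split_sum : \sum_(x | P x) f x = 
     \sum_(q in col_stabilizer) (-1) ^+ q *: (A *m r q *m r (tperm (vq q) k)) + \sum_(x | Q x) f x.
  rewrite (bigID (fun x => x.2 != vq x.1)) /= addrC; congr (_ + _).
  rewrite (reindex_onto (fun q : 'S_n => (q, vq q)) fst) /=; last first.
    by case=> q j /andP[_]; rewrite negbK /= => /eqP ->.
  apply: eq_bigl => q; rewrite /P /= eqxx !andbT.
  by case: (boolP (q \in _)) => //= qc; rewrite vqc ?eqxx.
have sum1 : \sum_(q in col_stabilizer) (-1) ^+ q *: (A *m r q *m r (tperm (vq q) k)) = S0.
  by apply: eq_bigr => q qc; rewrite tpermC Aq.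
have sumQ : \sum_(x | Q x) f x = - \sum_(x | Q x) f x.
  rewrite {1}(reindex_onto h h) //=; rewrite -sumrN.
  apply: eq_big => [x|x Qhx].
    apply/andP/idP => [[Qh /eqP <-]|Qx]; first exact: hQ.
    by rewrite hQ // hh.
  have Qx : Q x by have /andP[Qh /eqP <-] := Qhx; apply: hQ.
  case: x Qx {Qhx} => q j Qx; have := Qx => /andP[/andP[/= qc /eqP jc] ne].
  rewrite /f /h /= odd_permM odd_tperm ne signr_addb expr1 mulrN1 scaleNr; congr (- (_ *: _)).
  rewrite -[in RHS](Aq q qc) -!mulmxA -!rM; congr (_ *m r _); rewrite -!mulgA; congr (_ * _)%g.
  have ne_jk := ne_kc _ jc; have ne_vk := ne_kc _ (vqc _ qc).
  apply/permP => i; rewrite !permM; move: (vq q) ne ne_vk => w ne_jw ne_wk {Qx qc jc}.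
have [->|ne_ij] := eqVneq i j.
    by rewrite !tpermL (tpermD (z := j)) 1?eq_sym // tpermL.
  have [->|ne_iw] := eqVneq i w.
    by rewrite !tpermR tpermD // eq_sym.
  have [->|ne_ik] := eqVneq i k.
    by rewrite tpermL [tperm j w k]tpermD // tpermR tpermD // eq_sym.
  by rewrite !tpermD // eq_sym.
(* A sum equal to its own negative vanishes after division by 2. *)
have sumQ0 : \sum_(x | Q x) f x = 0.
  have : (2 : F) *: \sum_(x | Q x) f x = 0.
    by rewrite scaler_nat mulr2n {1}sumQ addNr.
  by move/eqP; rewrite scaler_eq0 pnatr_eq0 => /eqP.
by rewrite S1E split_sum sum1 sumQ0 addr0.
Qed.

Variable o : 'S_n.
Hypothesis oE : forall j k, (o j < o k)%N =
  ((pos j).2 < (pos k).2)%N || (((pos j).2 == (pos k).2) && ((pos j).1 < (pos k).1)%N).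

(** In column reading order the predecessors of k are the full columns to its left, each
    contributing +1 by [garnir], and the boxes above it, each contributing -1 by antisymmetry: the
    eigenvalue is the content. *)
Lemma young_jm k : row_sym *m col_antisym *m jm r o k =
  ((pos k).2%:R - (pos k).1%:R) *: (row_sym *m col_antisym).
Proof.
set Y := row_sym *m col_antisym.
have -> : jm r o k = \sum_(j | ((pos j).2 < (pos k).2)%N) r (tperm j k) +
    \sum_(j | ((pos j).2 == (pos k).2) && ((pos j).1 < (pos k).1)%N) r (tperm j k).
  rewrite /jm (bigID (fun j => (pos j).2 < (pos k).2)%N) /=; congr (_ + _).
    by apply: eq_bigl => j; rewrite oE; case: ltngtP; rewrite ?andbF ?andbT ?orbF.
  by apply: eq_bigl => j; rewrite oE; case: ltngtP => /=; rewrite ?andbF ?andbT.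
rewrite mulmxDr scalerBl; congr (_ + _).
  have -> : \sum_(j | ((pos j).2 < (pos k).2)%N) r (tperm j k) =
      \sum_(c < (pos k).2) \sum_(j | (pos j).2 == c) r (tperm j k).
    rewrite (exchange_big_dep (fun j => ((pos j).2 < (pos k).2)%N)) /=; last first.
      by move=> c j _ /eqP ->.
    apply: eq_bigr => j lt_jk; rewrite (big_pred1 (Ordinal lt_jk)) //.
  rewrite mulmx_sumr (eq_bigr (fun=> Y)) => [|c _]; last by rewrite garnir.
  by rewrite sumr_const card_ord scaler_nat.
rewrite mulmx_sumr (eq_bigr (fun=> - Y)) => [|j /andP[/eqP jk lt_jk]]; last first.
  rewrite -mulmxA col_antisymM; last exact: tperm_col.
  have ne_jk : j != k by apply: contraTneq lt_jk => ->; rewrite ltnn.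
  by rewrite odd_tperm ne_jk expr1 scaleN1r mulmxN.
rewrite sumr_const -scaler_nat scalerN; congr (- (_%:R *: _)).
rewrite -sum1_card.
have -> : (\sum_(j in [pred j | ((pos j).2 == (pos k).2) && ((pos j).1 < (pos k).1)%N]) 1 =
  \sum_(i < (pos k).1) \sum_(j | pos j == (i : nat, (pos k).2)) 1)%N.
  rewrite (exchange_big_dep (fun j => ((pos j).2 == (pos k).2) && ((pos j).1 < (pos k).1)%N)) /=.
    apply: eq_bigr => j /andP[/eqP jk lt_jk]; rewrite (big_pred1 (Ordinal lt_jk)) // => i.
    by rewrite -pair_eqE /pair_eq /= jk eqxx andbT eq_sym.
  by move=> i j _ /eqP -> /=; rewrite eqxx ltn_ord.
rewrite (eq_bigr (fun=> 1%N)) ?sum1_card ?card_ord // => i _.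
have [j jE] := pos_up (ltn_ord i); rewrite (big_pred1 j) // => j'.
by rewrite -jE (inj_eq pos_inj).
Qed.

End Garnir.

(** * Reading orders and coordinates of boxes *)

Lemma perm_of_order n (lt : rel 'I_n) :
  irreflexive lt -> transitive lt -> (forall j k, j != k -> lt j k || lt k j) ->
  exists o : 'S_n, forall j k, (o j < o k)%N = lt j k.
Proof.
move=> irr tr tot; pose c k := #|[pred j | lt j k]|.
have ltc j k : lt j k -> (c j < c k)%N.
  move=> ljk; apply: proper_card; apply/properP; split.
    by apply/subsetP => i; rewrite !inE => /tr; apply.
  by exists j; rewrite !inE ?irr.
have ltc_eq j k : (c j < c k)%N = lt j k.
  apply/idP/idP => [|/ltc //]; have [->|/tot/orP[//|/ltc]] := eqVneq j k; first by rewrite ltnn.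
  by case: ltngtP.
have cn k : (c k < n)%N.
  rewrite -[X in (_ < X)%N]card_ord; apply: proper_card; apply/properP; split; first exact/subsetP.
  by exists k; rewrite !inE ?irr.
have c_inj : injective (fun k => Ordinal (cn k)).
  move=> j k /(congr1 val) /= cjk; apply/eqP; apply: contraT => /tot.
  by rewrite -!ltc_eq cjk ltnn.
by exists (perm c_inj) => j k; rewrite !permE /= ltc_eq.
Qed.

Section Boxes.
Variables (n : nat) (la : seq nat).
Hypothesis la_part : is_partition_of n la.

Lemma mem_boxes (b : nat * nat) : (b \in boxes la) = (b.2 < nth 0 la b.1)%N.
Proof.
case: b => i j; apply/allpairsPdep/idP => [[x [y [_ + [-> ->]]]]|/= lt_j].
  by rewrite mem_iota.
exists i, j; split => //; rewrite mem_iota //= add0n ltnNge.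
by apply: contraL lt_j => le_i; rewrite nth_default.
Qed.

Lemma boxes_uniq : uniq (boxes la).
Proof.
apply: allpairs_uniq_dep => [|i _|]; rewrite ?iota_uniq //.
by move=> [x x'] [y y'] _ _ /= [-> ->].
Qed.

Lemma size_boxes : size (boxes la) = n.
Proof.
case/and3P: la_part => _ _ /eqP <-; rewrite size_allpairs_dep; congr sumn.
by under eq_map => i do rewrite size_iota; rewrite -/(mkseq _ _) mkseq_nth.
Qed.

Lemma nth_part i j : (i <= j)%N -> (nth 0 la j <= nth 0 la i)%N.
Proof.
move=> le_ij; have [le_lj|lt_jl] := leqP (size la) j; first by rewrite nth_default.
case/and3P: la_part => sla _ _.
have /= := sorted_leq_nth (leT := geq) (rev_trans leq_trans) leqnn 0%N sla; apply => //.
by rewrite inE (leq_ltn_trans le_ij).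
Qed.

Lemma box_of_mem (k : 'I_n) : box_of la k \in boxes la.
Proof. by rewrite mem_nth // size_boxes. Qed.

Lemma box_of_inj : injective (box_of la : 'I_n -> _).
Proof.
move=> j k /eqP; rewrite /box_of nth_uniq ?size_boxes ?boxes_uniq // => /eqP.
exact: val_inj.
Qed.

Lemma box_of_ex i j : (j < nth 0 la i)%N -> exists k : 'I_n, box_of la k = (i, j).
Proof.
move=> lt_j; have bx : (i, j) \in boxes la by rewrite mem_boxes.
have lt_k : (index (i, j) (boxes la) < n)%N by rewrite -size_boxes index_mem.
by exists (Ordinal lt_k); rewrite /box_of nth_index.
Qed.

Lemma box_of_left (k : 'I_n) c :
  (c < (box_of la k).2)%N -> exists j : 'I_n, box_of la j = ((box_of la k).1, c).
Proof.
by move=> lt_c; apply: box_of_ex; apply: ltn_trans lt_c _; rewrite -mem_boxes box_of_mem.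
Qed.

Lemma box_of_up (k : 'I_n) i :
  (i < (box_of la k).1)%N -> exists j : 'I_n, box_of la j = (i, (box_of la k).2).
Proof.
move=> lt_i; apply: box_of_ex; apply: leq_trans (nth_part (ltnW lt_i)).
by rewrite -mem_boxes box_of_mem.
Qed.

End Boxes.

Lemma col_order n (pos : 'I_n -> nat * nat) : injective pos ->
  exists o : 'S_n, forall j k, (o j < o k)%N =
    ((pos j).2 < (pos k).2)%N || (((pos j).2 == (pos k).2) && ((pos j).1 < (pos k).1)%N).
Proof.
move=> pos_inj; apply: perm_of_order => [k|k j i|j k ne_jk]; first by rewrite !ltnn andbF.
  case: (pos k) (pos j) (pos i) => [a b] [a' b'] [a'' b''] /=; lia.
have : pos j != pos k by rewrite (inj_eq pos_inj).
by case: (pos j) (pos k) => [a b] [a' b']; rewrite -pair_eqE /pair_eq /=; lia.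
Qed.

Section SpechtContent.
Variables (F : numFieldType) (n : nat).
Local Notation G := [set: 'S_n]%G.
Local Notation aG := (regular_repr F G).

Section Content.
Variables (q c : F) (f : {mpoly F[n]}).
Hypothesis fS : symmetric_under_perms f.

Lemma repr_setM d (r : mx_representation F G d) (x y : 'S_n) : r (x * y)%g = r x *m r y.
Proof. by rewrite repr_mxM ?inE. Qed.

Lemma mxeval_young d (r : mx_representation F G d) (pos : 'I_n -> nat * nat)
    (pos_inj : injective pos)
    (pos_left : forall k c, (c < (pos k).2)%N -> exists j, pos j = ((pos k).1, c))
    (pos_up : forall k i, (i < (pos k).1)%N -> exists j, pos j = (i, (pos k).2)) :
  row_sym r pos *m col_antisym r pos *m mxeval (fun k => q%:M + c *: jm r 1%g k) f =
    f.@[fun k => q + c * ((pos k).2%:R - (pos k).1%:R)] *: (row_sym r pos *m col_antisym r pos).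
Proof.
have [o oE] := col_order pos_inj.
rewrite -(mxeval_jm_order (repr_mx1 r) (repr_setM r) q c fS o).
apply: mxeval_rowE => k.
by rewrite mulmxDr -scalemxAr (young_jm (repr_setM r)) // scalar_mxC mul_scalar_mx [RHS]scalerDl scalerA.
Qed.

Lemma young_symmetrizerE la :
  young_symmetrizer F n la =
  gring_row (row_sym aG (box_of la) *m col_antisym aG (box_of la)).
Proof.
congr gring_row; rewrite mulmx_suml; apply: eq_bigr => p _.
rewrite mulmx_sumr; apply: eq_bigr => p' _.
by rewrite repr_mxM ?inE // scalemxAr.
Qed.

(** The value is known on the generating Young symmetrizer, and centrality carries it to the whole
    cyclic module, which lies in the kernel of [Z - v%:M]. *)
Lemma specht_content la : is_partition_of n la ->
  mxeval (fun k => q%:M + c *: jm (specht F n la) 1%g k) f =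
    (f.@[fun k => q + c * ((box_of la k).2%:R - (box_of la k).1%:R)])%:M.
Proof.
move=> la_part; set v := f.@[_]; pose Z := mxeval (fun k => q%:M + c *: jm aG 1%g k) f.
have yZ : young_symmetrizer F n la *m Z = v *: young_symmetrizer F n la.
  rewrite young_symmetrizerE -gring_row_mul mxeval_young ?linearZ //.
  - exact: box_of_inj.
  - exact: box_of_left.
  exact: box_of_up.
have ZC p : Z *m aG p = aG p *m Z.
  by apply: mxeval_jm_central => //; [exact: repr_mx1 | exact: repr_setM].
set U := cyclic_mx aG (young_symmetrizer F n la).
have UZ : (U <= kermx (Z - v%:M))%MS.
  apply: cyclic_mx_sub; last by apply/sub_kermxP; rewrite mulmxBr yZ scalar_mxC mul_scalar_mx subrr.
  apply/mxmoduleP => p _; apply/sub_kermxP; rewrite -mulmxA.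
  have -> : aG p *m (Z - v%:M) = (Z - v%:M) *m aG p by rewrite mulmxBr mulmxBl ZC scalar_mxC.
  by rewrite mulmxA mulmx_ker mul0mx.
have VZ : val_submod (1%:M : 'M_(\rank U)) *m Z = v *: val_submod 1%:M.
  have /sub_kermxP : (val_submod (1%:M : 'M_(\rank U)) <= kermx (Z - v%:M))%MS.
    by apply: submx_trans UZ; rewrite val_submodP.
  by rewrite mulmxBr scalar_mxC mul_scalar_mx => /eqP; rewrite subr_eq0 => /eqP.
apply: (@val_submod_inj _ _ U); rewrite val_submodE.
rewrite (@mxeval_intertwine _ _ _ _ _ (fun k => q%:M + c *: jm aG 1%g k)) => [|k].
  by rewrite VZ -[in RHS]scalemx1 [RHS]linearZ.
rewrite mulmxDr mulmxDl scalar_mxC -scalemxAl -scalemxAr; congr (_ + _ *: _).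
rewrite /jm mulmx_sumr mulmx_suml; apply: eq_bigr => j _.
have := val_submodJ (cyclic_mx_module aG (young_symmetrizer F n la)) 1%:M (in_setT (tperm j k)).
by rewrite mul1mx => <-; rewrite [RHS]val_submodE.
Qed.

End Content.

(** The coefficient of the identity is 1: a permutation preserving all rows and all columns fixes
    every position, so only p = q = 1 contributes. *)
Lemma young_neq0 (pos : 'I_n -> nat * nat) : injective pos ->
  gring_row (row_sym aG pos *m col_antisym aG pos) != 0.
Proof.
move=> pos_inj; apply/eqP => y0.
have : gring_proj 1%g (row_sym aG pos *m col_antisym aG pos) = 0.
  by rewrite /gring_proj /= y0 !linear0.
rewrite mulmx_suml linear_sum (bigD1 1%g) /=; last by apply/row_stabP => k; rewrite perm1.
rewrite mulmx_sumr linear_sum (bigD1 1%g) /=; last by apply/col_stabP => k; rewrite perm1.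
have projE c (p q : 'S_n) : gring_proj 1%g (aG p *m (c *: aG q)) = c *: (1%g == (p * q)%g)%:R.
  by rewrite -scalemxAr linearZ /= -repr_setM gring_projE ?inE.
rewrite big1 => [|q /andP[_ q1]]; last by rewrite projE mul1g eq_sym (negbTE q1) scaler0.
rewrite big1 => [|p /andP[/row_stabP pr p1]]; last first.
  rewrite mulmx_sumr linear_sum big1 // => q /col_stabP qc /=.
  rewrite projE [_ == _](_ : _ = false) ?scaler0 //; apply/negbTE.
  apply: contraNneq p1 => /esym/eqP; rewrite -eq_invg_mul => /eqP pq.
  apply/eqP/permP => k; rewrite perm1; apply: pos_inj.
  have qE : p k = q^-1%g k by rewrite -pq invgK.
  rewrite [LHS]surjective_pairing [RHS]surjective_pairing pr; congr pair.
  by rewrite qE -qc permKV.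
rewrite projE mul1g eqxx odd_perm1 scale1r !addr0 => /eqP.
by rewrite oner_eq0.
Qed.

End SpechtContent.

(** * Induced modules through their evaluations *)

Section InducedEvaluation.
Variables (F : fieldType) (kT gT : finGroupType) (j : kT -> gT) (d : nat).
Variable rK : mx_representation F [set: kT]%G d.
Local Notation U := (ind_space j rK).

(* Rows of [ind_repr] are functions on the group; right multiplication by
   [ind_eval x] evaluates them at x. *)
Definition ind_eval (x : gT) : 'M[F]_(\rank U, d) :=
  lin1_mx (row (enum_rank x) \o vec_mx \o val_submod (m := 1) (U := U)).

Lemma ind_evalE (x : gT) (u : 'rV_(\rank U)) :
  u *m ind_eval x = row (enum_rank x) (vec_mx (val_submod u)).
Proof. by rewrite mul_rV_lin1. Qed.

Lemma ind_eval_act w x : ind_repr j rK w *m ind_eval x = ind_eval (w * x)%g.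
Proof.
apply/row_matrixP => i; rewrite row_mul !rowE !ind_evalE val_submodJ ?inE //.
by rewrite -{1}[val_submod _]vec_mxK mul_vec_lin mxvecK /= lshift_mxE enum_rankK.
Qed.

Lemma ind_eval_equiv x k : ind_eval (x * j k)%g = ind_eval x *m rK k.
Proof.
apply/row_matrixP => i; rewrite row_mul !rowE !ind_evalE.
set A := val_submod _; have /ind_spaceP h : (mxvec (vec_mx A) <= U)%MS.
  by rewrite vec_mxK val_submodP.
by rewrite -row_mul -h rshift_mxE enum_rankK.
Qed.

Lemma ind_eval_inj p (M : 'M_(p, \rank U)) : (forall x, M *m ind_eval x = 0) -> M = 0.
Proof.
move=> h; apply/row_matrixP => i; rewrite row0; apply: (@val_submod_inj _ _ U).
rewrite linear0; apply: (can_inj vec_mxK); rewrite linear0; apply/row_matrixP => x.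
by rewrite -[x]enum_valK -ind_evalE -row_mul h !row0.
Qed.

(** Frobenius reciprocity in coordinates: an equivariant family of matrices is a map into the
    induced module. Operators and intertwiners below are all produced this way. *)
Lemma ind_eval_ex p (phi : gT -> 'M_(p, d)) :
  (forall x k, phi (x * j k)%g = phi x *m rK k) ->
  exists M : 'M_(p, \rank U), forall x, M *m ind_eval x = phi x.
Proof.
move=> h; pose A i : 'M_(#|gT|, d) := \matrix_x row i (phi (enum_val x)).
exists (\matrix_i in_submod U (mxvec (A i))) => x; apply/row_matrixP => i.
rewrite row_mul rowK ind_evalE in_submodK.
  by rewrite mxvecK rowK enum_rankK.
apply/ind_spaceP => k; apply/row_matrixP => y.
by rewrite rshift_mxE row_mul !rowK enum_rankK h row_mul.
Qed.

End InducedEvaluation.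

(** * Conjugate partitions *)

Lemma count_part la i j : sorted geq la ->
  (j < count (fun l => i < l)%N la)%N = (i < nth 0 la j)%N.
Proof.
elim: la j => [|x la IH] j /=; first by rewrite nth_nil.
move=> path_la; have sla := path_sorted path_la.
have [lt_ix|le_xi] /= := ltnP i x; first by case: j => [//|j]; rewrite add1n ltnS IH.
have -> : count (fun l => i < l)%N la = 0%N.
  apply/eqP; rewrite -leqn0 leqNgt -has_count -all_predC; apply/allP => y /=.
  have /(order_path_min (rev_trans leq_trans))/allP := path_la.
  by move=> h /h /= le_yx; rewrite -leqNgt (leq_trans le_yx).
rewrite ltn0; apply/esym/negbTE; rewrite -leqNgt; case: j => [//|j] /=.
have [lt_j|le_j] := ltnP j (size la); last by rewrite nth_default.
have /(order_path_min (rev_trans leq_trans))/allP := path_la.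
by move/(_ _ (mem_nth 0%N lt_j)) => /leq_trans; apply.
Qed.

Lemma mem_boxes_conj la (b : nat * nat) : sorted geq la ->
  (b \in boxes (conj_part la)) = ((b.2, b.1) \in boxes la).
Proof.
move=> sla; rewrite !mem_boxes /=; case: b => i j /=; rewrite /conj_part.
have [lt_i|le_i] := ltnP i (head 0%N la).
  by rewrite (nth_map 0%N) ?size_iota // nth_iota // add0n count_part.
rewrite nth_default ?size_map ?size_iota // ltn0; apply/esym/negbTE.
rewrite -leqNgt; apply: leq_trans le_i; case: la sla => [|x la] //=; first by rewrite nth_nil.
move=> /(order_path_min (rev_trans leq_trans))/allP h; case: j => [//|j] /=.
have [lt_j|le_j] := ltnP j (size la); last by rewrite nth_default.
exact: h _ (mem_nth 0%N lt_j).
Qed.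

Lemma size_boxes_conj n la : is_partition_of n la -> size (boxes (conj_part la)) = n.
Proof.
move=> la_part; have /and3P[sla _ _] := la_part.
have /perm_size <- : perm_eq [seq (b.2, b.1) | b <- boxes la] (boxes (conj_part la)).
  apply: uniq_perm; first by rewrite map_inj_uniq ?boxes_uniq // => -[a b] [c d] /= [-> ->].
    exact: boxes_uniq.
  move=> [i j]; rewrite mem_boxes_conj //=; apply/mapP/idP => [[[k l] kl [-> ->]] //|ji].
  by exists (j, i).
by rewrite size_map (size_boxes la_part).
Qed.

Lemma conj_boxes_perm n la : is_partition_of n la ->
  exists pi : 'S_n, forall k : 'I_n,
    box_of (conj_part la) k = ((box_of la (pi k)).2, (box_of la (pi k)).1).
Proof.
move=> la_part; have sz := size_boxes_conj la_part; have /and3P[sla _ _] := la_part.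
have /fin_all_exists[g gE] (k : 'I_n) : exists k' : 'I_n, 
    box_of la k' = ((box_of (conj_part la) k).2, (box_of (conj_part la) k).1).
  by apply: box_of_ex => //; rewrite -(mem_boxes la (_, _)) -mem_boxes_conj // mem_nth ?sz.
have g_inj : injective g.
  move=> j k /(congr1 (box_of la)); rewrite !gE => -[h2 h1].
  have /eqP : box_of (conj_part la) j = box_of (conj_part la) k.
    by rewrite [LHS]surjective_pairing [RHS]surjective_pairing h1 h2.
  by rewrite /box_of nth_uniq ?sz ?boxes_uniq // => /eqP/val_inj.
by exists (perm g_inj) => k; rewrite permE gE /= -surjective_pairing.
Qed.

(** The diagonal entries of the product are the squared norms of the columns of X. This positivity
    is what gives injectivity in [conj_map_inj]. *)
Lemma conjmx_positive (F : numClosedFieldType) p n (X : 'M[F]_(p, n)) :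
  (map_mx Num.conj X)^T *m X = 0 -> X = 0.
Proof.
move=> h; apply/matrixP => i j; rewrite mxE.
have /matrixP/(_ j j) := h; rewrite !mxE => /eqP.
rewrite psumr_eq0 => [/allP/(_ i (mem_index_enum _))|k _]; rewrite !mxE mulrC.
  by rewrite mul_conjC_eq0 => /eqP.
by rewrite mul_conjC_ge0.
Qed.

(** * The Specht module of the conjugate partition inside a sign twist *)

Section SignTwist.
Variables (F : fieldType) (n d : nat).
Local Notation G := [set: 'S_n]%G.
Variable r : mx_representation F G d.

Lemma sgn_mx_repr : mx_repr G (fun g : 'S_n => (-1) ^+ g *: r g).
Proof.
split=> [|x y _ _]; first by rewrite odd_perm1 scale1r repr_mx1.
by rewrite odd_permM signr_addb repr_mxM ?inE // -scalemxAl -scalemxAr scalerA.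
Qed.
Definition sgn_repr := MxRepresentation sgn_mx_repr.

End SignTwist.

Section ConjugateSpecht.
Variables (F : numClosedFieldType) (n : nat) (la : seq nat).
Hypothesis la_part : is_partition_of n la.
Local Notation G := [set: 'S_n]%G.
Local Notation aG := (regular_repr F G).
Local Notation tw := (gring_mx (sgn_repr aG)).
Local Notation a := (row_sym aG (box_of la)).
Local Notation b := (col_antisym aG (box_of la)).

Lemma regular_adjoint (g : 'S_n) : (map_mx Num.conj (aG g))^T = aG g^-1%g.
Proof.
apply/matrixP => i j; rewrite !mxE conjC_nat /=; congr (_%:R : F); congr nat_of_bool.
rewrite -(can_eq (@gring_valK _ G)) gring_indexK ?inE //.
rewrite -[j == _](can_eq (@gring_valK _ G)) gring_indexK ?inE //.
apply/eqP/eqP => [->|->]; first by rewrite mulgK.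
by rewrite mulgKV.
Qed.

Lemma row_sym_adjoint : (map_mx Num.conj a)^T = a.
Proof.
rewrite /row_sym raddf_sum linear_sum (reindex_inj invg_inj) /=.
apply: eq_big => [g|g _]; last by rewrite regular_adjoint invgK.
apply/row_stabP/row_stabP => h k; first by rewrite -[in RHS](permK g k) h.
by rewrite -[in RHS](permKV g k) h.
Qed.

Lemma col_antisym_adjoint : (map_mx Num.conj b)^T = b.
Proof.
rewrite /col_antisym raddf_sum linear_sum (reindex_inj invg_inj) /=.
apply: eq_big => [g|g _].
  apply/col_stabP/col_stabP => h k; first by rewrite -[in RHS](permK g k) h.
  by rewrite -[in RHS](permKV g k) h.
by rewrite map_mxZ linearZ /= regular_adjoint invgK odd_permV rmorphXn /= rmorphN1.
Qed.

Lemma sgn_gring_mx_inj u : tw u = 0 -> u = 0.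
Proof.
move=> tu0; pose D : 'M[F]_(gcard G) := diag_mx (\row_i (-1) ^+ (enum_val i : 'S_n)).
have DD : D *m D = 1%:M.
  rewrite mulmx_diag -diag_const_mx; congr diag_mx; apply/rowP => i.
  by rewrite !mxE -expr2 sqrr_sign.
suff uD : u *m D = 0 by rewrite -[u]mulmx1 -DD mulmxA uD mul0mx.
rewrite -[u *m D]gring_mxK (_ : gring_mx aG (u *m D) = tw u) ?tu0 ?linear0 //.
have DE : D *m enveloping_algebra_mx aG = enveloping_algebra_mx (sgn_repr aG).
  apply/row_matrixP => i; rewrite row_mul row_diag_mx -scalemxAl -rowE !rowK mxE.
  by rewrite linearZ.
by rewrite /gring_mx /= -mulmxA DE.
Qed.

Variable pi : 'S_n.
Hypothesis piE : forall k : 'I_n,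
  box_of (conj_part la) k = ((box_of la (pi k)).2, (box_of la (pi k)).1).
Local Notation Pi := (aG pi).
Local Notation PiV := (aG pi^-1%g).
Local Notation y' := (young_symmetrizer F n (conj_part la)).

Lemma regularV : PiV *m Pi = 1%:M.
Proof. by rewrite -repr_setM mulVg repr_mx1. Qed.

(** Transposing the diagram exchanges the row and column groups up to conjugation by [pi], and the
    sign twist exchanges symmetrizing with antisymmetrizing. *)
Lemma tw_young_symmetrizer : tw y' = Pi *m b *m a *m PiV.
Proof.
have twS A : tw (gring_row A) = gring_op (sgn_repr aG) A by [].
rewrite twS linear_sum.
have -> : Pi *m b *m a *m PiV = (Pi *m b *m PiV) *m (Pi *m a *m PiV).
  by rewrite !mulmxA -[_ *m PiV *m Pi]mulmxA regularV mulmx1.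
rewrite {1}/col_antisym mulmx_sumr !mulmx_suml [RHS](reindex_inj (conjg_inj pi)).
apply: eq_big => [p|p _].
  rewrite inE; apply/forallP/col_stabP => h k.
    by have /eqP := h (pi^-1%g k); rewrite !piE /= conjgE !permM permKV.
  by have := h (pi k); rewrite !piE /= conjgE !permM permK => ->.
rewrite linear_sum {1}/row_sym !(mulmx_sumr, mulmx_suml) [RHS](reindex_inj (conjg_inj pi)).
apply: eq_big => [q|q _].
  rewrite inE; apply/forallP/row_stabP => h k.
    by have /eqP := h (pi^-1%g k); rewrite !piE /= conjgE !permM permKV.
  by have := h (pi k); rewrite !piE /= conjgE !permM permK => ->.
have opZ (z : F) A : gring_op (sgn_repr aG) (z *: A) = z *: gring_op (sgn_repr aG) A by rewrite linearZ.
etransitivity; first exact: opZ.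
rewrite gring_opG ?inE //.
have -> : sgn_repr aG (p * q)%g = (-1) ^+ (p * q)%g *: aG (p * q)%g by [].
rewrite scalerA odd_permM signr_addb mulrCA -expr2 sqrr_sign mulr1.
rewrite odd_permJ -scalemxAr -!scalemxAl; congr (_ *: _); rewrite -!repr_setM; congr (aG _).
by rewrite !conjgE !mulgA !mulgK !mulgV !mul1g.
Qed.

(** The left factor turns the twisted conjugate symmetrizer [Pi b a PiV] into [a b a PiV], which
    lies in the right ideal generated by [a b]. Left multiplication commutes with the right action,
    so only the sign twist shows in [conj_mapJ]. *)
Definition conj_map (u : 'rV[F]_(gcard G)) : 'rV_(gcard G) := gring_row (a *m PiV *m tw u).

Lemma conj_map_linear : linear conj_map.
Proof. by move=> c u v; rewrite /conj_map !linearP. Qed.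

HB.instance Definition _ := GRing.isLinear.Build F _ _ _ conj_map conj_map_linear.

Lemma conj_mapJ u g : conj_map (u *m aG g) = (-1) ^+ g *: (conj_map u *m aG g).
Proof.
have sE : sgn_repr aG g = (-1) ^+ g *: aG g by [].
have rZ (z : F) (A : 'M[F]_(gcard G)) : gring_row (z *: A) = z *: gring_row A by rewrite linearZ.
by rewrite /conj_map gring_mxJ ?inE // sE -!scalemxAr rZ mulmxA gring_row_mul.
Qed.

Lemma conj_map_young : conj_map y' = young_symmetrizer F n la *m (a *m PiV).
Proof.
rewrite /conj_map tw_young_symmetrizer young_symmetrizerE -gring_row_mul !mulmxA.
by rewrite -[a *m PiV *m Pi]mulmxA regularV mulmx1.
Qed.

Lemma row_sym_envelop : (a \in group_ring F G)%MS.
Proof. by rewrite linear_sum; apply: summx_sub => p _; apply: envelop_mx_id; rewrite inE. Qed.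

Lemma conj_map_mem u : (u <= cyclic_mx aG y' -> conj_map u <= cyclic_mx aG (young_symmetrizer F n la))%MS.
Proof.
case/cyclic_mxP => A /envelop_mxP[c ->] ->; rewrite mulmx_sumr linear_sum summx_sub //= => g _.
rewrite -scalemxAr linearZ scalemx_sub //= conj_mapJ scalemx_sub // conj_map_young -mulmxA.
apply/cyclic_mxP; exists (a *m PiV *m aG g) => //.
by rewrite !envelop_mxM ?row_sym_envelop ?envelop_mx_id ?inE.
Qed.

(** With z = [PiV *m Z], what must be shown is that a b a z = 0 implies X = b a z = 0. As a and b
    are self-adjoint and b b is a multiple of b, the product of the adjoint of X with X is a
    multiple of z^* a b a z, so it vanishes. *)
Lemma conj_map_inj u : (u <= cyclic_mx aG y')%MS -> conj_map u = 0 -> u = 0.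
Proof.
case/cyclic_mxP => A /envelop_mxP[c ->] -> {A u}.
set u := _ *m _ => u0; apply: sgn_gring_mx_inj.
pose Z := \sum_(g in G) c g *: sgn_repr aG g.
have twu : tw u = Pi *m b *m a *m PiV *m Z.
  rewrite -tw_young_symmetrizer /u /Z !mulmx_sumr linear_sum; apply: eq_bigr => g Gg.
  have twZ z v : tw (z *: v) = z *: tw v by rewrite linearZ.
  rewrite -!scalemxAr; etransitivity; first exact: twZ.
  by rewrite gring_mxJ // [in RHS]scalemxAr.
have aba0 : a *m b *m a *m PiV *m Z = 0.
  have -> : a *m b *m a *m PiV *m Z = a *m PiV *m tw u.
    by rewrite twu !mulmxA -[a *m PiV *m Pi]mulmxA regularV mulmx1.
  rewrite -[LHS](@gring_rowK F _ G) ?[gring_row _]u0 ?linear0 //.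
  have bE : (b \in group_ring F G)%MS.
    by rewrite linear_sum; apply: summx_sub => p _; rewrite linearZ scalemx_sub //; apply: envelop_mx_id; rewrite inE.
  have ZE : (Z \in group_ring F G)%MS.
    rewrite linear_sum; apply: summx_sub => p _; rewrite linearZ scalemx_sub // linearZ scalemx_sub //.
    by apply: envelop_mx_id; rewrite inE.
  by rewrite twu !envelop_mxM ?row_sym_envelop ?envelop_mx_id ?inE.
have bb : b *m b = #|col_stabilizer (box_of la : 'I_n -> _)|%:R *: b.
  rewrite {2}/col_antisym mulmx_sumr (eq_bigr (fun=> b)) => [|p pc].
    by rewrite sumr_const scaler_nat.
  by rewrite -scalemxAr col_antisymM // ?scalerA -?expr2 ?sqrr_sign ?scale1r //; exact: repr_setM.
pose X := b *m a *m PiV *m Z.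
suff X0 : X = 0 by rewrite twu -!mulmxA (mulmxA b) (mulmxA _ PiV) -/X X0 mulmx0.
apply: conjmx_positive.
have -> : (map_mx Num.conj X)^T = (map_mx Num.conj (PiV *m Z))^T *m a *m b.
  by rewrite /X -!mulmxA !map_mxM !trmx_mul row_sym_adjoint col_antisym_adjoint !mulmxA.
rewrite /X !mulmxA -[_ *m b *m b]mulmxA bb -scalemxAr -!scalemxAl -!mulmxA.
by rewrite -!mulmxA in aba0; rewrite aba0 mulmx0 scaler0.
Qed.

End ConjugateSpecht.

Lemma specht_conj (F : numClosedFieldType) n la : is_partition_of n la ->
  exists K : 'M[F]_(\rank (cyclic_mx (regular_repr F [set: 'S_n]%G) (young_symmetrizer F n (conj_part la))),
                    \rank (cyclic_mx (regular_repr F [set: 'S_n]%G) (young_symmetrizer F n la))),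
    (forall p (M : 'M_(p, _)), M *m K = 0 -> M = 0) /\
    (forall g : 'S_n, specht F n (conj_part la) g *m K = (-1) ^+ g *: (K *m specht F n la g)).
Proof.
move=> la_part; have [pi piE] := conj_boxes_perm la_part.
set U := cyclic_mx _ (young_symmetrizer F n la).
set U' := cyclic_mx _ (young_symmetrizer F n (conj_part la)).
pose Op := lin1_mx (conj_map (F := F) la pi).
have OpE u : u *m Op = conj_map la pi u by rewrite mul_rV_lin1.
pose K := in_submod U (val_submod (1%:M : 'M_(\rank U')) *m Op).
have VK p (M : 'M_(p, \rank U')) : val_submod (M *m K) = val_submod M *m Op.
  have -> : M *m K = in_submod U (val_submod M *m Op).
    by rewrite /K /in_submod /= [val_submod M]val_submodE !mulmxA.
  apply: in_submodK.
  apply/row_subP => i; rewrite row_mul OpE conj_map_mem //.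
  by apply: submx_trans (val_submodP M); apply: row_sub.
exists K; split=> [p M MK0|g].
  apply/row_matrixP => i; rewrite row0; apply: (@val_submod_inj _ _ U'); rewrite linear0.
  apply: (conj_map_inj piE); first exact: val_submodP.
  by rewrite -OpE -VK -row_mul MK0 row0 linear0.
have J p (W : 'M_(p, \rank U)) :
    val_submod (W *m specht F n la g) = val_submod W *m regular_repr F [set: 'S_n]%G g.
  exact: val_submodJ (in_setT g).
have J' p (W : 'M_(p, \rank U')) :
    val_submod (W *m specht F n (conj_part la) g) = val_submod W *m regular_repr F [set: 'S_n]%G g.
  exact: val_submodJ (in_setT g).
apply: (@val_submod_inj _ _ U); rewrite VK -[specht _ _ _ _ in LHS]mul1mx J'.
have vZ (z : F) (W : 'M_(_, \rank U)) : val_submod (z *: W) = z *: val_submod W by rewrite linearZ.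
rewrite vZ J; rewrite -[K]mul1mx VK; apply/row_matrixP => i.
have rZ (z : F) (A : 'M_(_, gcard [set: 'S_n])) : row i (z *: A) = z *: row i A by rewrite linearZ.
by rewrite rZ !row_mul !OpE conj_mapJ.
Qed.

(** * Juxtaposed diagrams *)

Lemma tprodZr (F : fieldType) m1 n1 (A : 'M[F]_(m1, n1)) m2 n2 c (B : 'M[F]_(m2, n2)) :
  tprod A (c *: B) = c *: tprod A B.
Proof.
elim: m1 A => [|m1 IH] A /=; first by rewrite scaler0.
by rewrite IH linearZ scale_col_mx.
Qed.

Lemma tprod11 (F : fieldType) (a b : 'M[F]_1) : tprod a b = (a 0 0 * b 0 0)%:M :> 'M_1.
Proof.
have := mxtrace_prod a b; rewrite {2 3}/mxtrace !big_ord1 => <-.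
rewrite [LHS]mx11_scalar; congr (_%:M).
by change (tprod a b 0 0 = \sum_(i < 1) tprod a b i i); rewrite big_ord1.
Qed.

Lemma gring_mx_sum (F : fieldType) (gT : finGroupType) d (r : mx_representation F [set: gT]%G d)
    (u : 'rV[F]_(gcard [set: gT]%G)) :
  gring_mx r u = \sum_(g : gT) u 0 (gring_index [set: gT]%G g) *: r g.
Proof.
rewrite /gring_mx /= mulmx_sum_row linear_sum /=.
have idxK : cancel (gring_index [set: gT]%G) enum_val.
  by move=> g; rewrite gring_indexK ?inE.
rewrite [RHS](reindex_onto enum_val (gring_index [set: gT]%G)) => [|g _]; last exact: idxK.
apply: eq_big => [i|i _]; first by rewrite gring_valK eqxx.
by rewrite linearZ /= rowK mxvecK gring_valK.
Qed.

Lemma gring_mx_young (F : numFieldType) n d (r : mx_representation F [set: 'S_n]%G d) la :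
  gring_mx r (young_symmetrizer F n la) =
  row_sym r (box_of la) *m col_antisym r (box_of la).
Proof.
rewrite /young_symmetrizer -[LHS]/(gring_op r _) linear_sum mulmx_suml.
apply: eq_bigr => p _; rewrite linear_sum mulmx_sumr; apply: eq_bigr => q _.
have opZ (z : F) A : gring_op r (z *: A) = z *: gring_op r A by rewrite linearZ.
by etransitivity; first exact: opZ; rewrite gring_opG ?inE // repr_setM scalemxAr.
Qed.

Section SpechtCoef.
Variables (F : fieldType) (n : nat) (la : seq nat).
Local Notation G := [set: 'S_n]%G.
Local Notation aG := (regular_repr F G).
Local Notation U := (cyclic_mx aG (young_symmetrizer F n la)).

Definition specht_gen : 'rV[F]_(\rank U) := in_submod U (young_symmetrizer F n la).

(** The linear form reading the coefficient of the identity. Against the generator, its matrix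
    coefficients are the coefficients of the Young symmetrizer at inverse elements. *)
Definition specht_coef1 : 'cV[F]_(\rank U) :=
  val_submod 1%:M *m delta_mx (gring_index G 1%g) 0.

Lemma specht_gen_coef (g : 'S_n) :
  (specht_gen *m specht F n la g *m specht_coef1) 0 0 =
  young_symmetrizer F n la 0 (gring_index G g^-1%g).
Proof.
have -> : specht_gen *m specht F n la g *m specht_coef1 =
          young_symmetrizer F n la *m aG g *m delta_mx (gring_index G 1%g) 0.
  rewrite /specht_coef1 mulmxA -val_submodE; congr (_ *m _).
  etransitivity; first exact: val_submodJ (in_setT g).
  by rewrite in_submodK // cyclic_mx_id.
rewrite -mulmxA -colE mxE (bigD1 (gring_index G g^-1%g)) //= big1 ?addr0.
  by rewrite !mxE gring_indexK ?inE // mulVg !eqxx mulr1.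
move=> i ne_i; rewrite !mxE /= [_ == gring_index _ _](_ : _ = false) ?mulr0 //.
apply/negbTE; apply: contraNneq ne_i.
move=> /(congr1 enum_val); rewrite !gring_indexK ?inE // => e.
by rewrite -(gring_valK i); apply/eqP; congr gring_index; apply: (mulIg g); rewrite mulVg e.
Qed.

End SpechtCoef.

Section JuxtaposedDiagrams.
Variables (F : numFieldType) (m s : nat) (la1 la2 : seq nat).
Hypotheses (la1_part : is_partition_of m la1) (la2_part : is_partition_of s la2).
Local Notation n := (m + s)%N.
Local Notation G := [set: 'S_n]%G.
Local Notation aG := (regular_repr F G).
Local Notation rK := (outer_repr (specht F m la1) (specht F s la2)).
Local Notation N := (ind_repr (@sym_embed m s) rK).
Local Notation ev := (ind_eval (@sym_embed m s) rK).

Variable pos : 'I_n -> nat * nat.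
Variables u1 u2 : nat.
Hypothesis posL : forall i, pos (lshift s i) = ((box_of la1 i).1, (box_of la1 i).2 + u1)%N.
Hypothesis posR : forall i, pos (rshift m i) = ((box_of la2 i).1, (box_of la2 i).2 + u2)%N.
Hypothesis pos_disjoint : forall i j, (pos (lshift s i)).2 != (pos (rshift m j)).2.
Hypothesis pos_left : forall k c, (c < (pos k).2)%N -> exists j, pos j = ((pos k).1, c).
Hypothesis pos_up : forall k i, (i < (pos k).1)%N -> exists j, pos j = (i, (pos k).2).

Lemma juxtaposed_inj : injective pos.
Proof.
move=> i j; rewrite -(splitK i) -(splitK j); case: (split i) (split j) => i' [] j' /= eij.
- move: eij; rewrite !posL => -[h1 /addIn h2]; congr lshift.
  by apply: (box_of_inj la1_part); rewrite [LHS]surjective_pairing h1 h2 -surjective_pairing.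
- by have := pos_disjoint i' j'; rewrite eij eqxx.
- by have := pos_disjoint j' i'; rewrite -eij eqxx.
move: eij; rewrite !posR => -[h1 /addIn h2]; congr rshift.
by apply: (box_of_inj la2_part); rewrite [LHS]surjective_pairing h1 h2 -surjective_pairing.
Qed.

Lemma sym_embedL (x : 'S_m * 'S_s) i : sym_embed x (lshift s i) = lshift s (x.1 i).
Proof. by rewrite sym_embedE (unsplitK (inl _)). Qed.

Lemma sym_embedR (x : 'S_m * 'S_s) i : sym_embed x (rshift m i) = rshift m (x.2 i).
Proof. by rewrite sym_embedE (unsplitK (inr _)). Qed.

Lemma ord_sumP (P : 'I_n -> Prop) :
  (forall i, P (lshift s i)) -> (forall i, P (rshift m i)) -> forall k, P k.
Proof. by move=> PL PR k; rewrite -[k]splitK; case: (split k) => i /=. Qed.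

(** The blocks occupy disjoint sets of columns, so the column group is a product. Rows are shared,
    which is why row groups only give the inclusion [sym_embed_row]. *)
Lemma col_stab_juxtaposed (q : 'S_n) : q \in col_stabilizer pos ->
  exists x : 'S_m * 'S_s, [/\ q = sym_embed x,
    x.1 \in col_stabilizer (box_of la1) & x.2 \in col_stabilizer (box_of la2)].
Proof.
move=> /col_stabP qc.
have /fin_all_exists[f fE] i : exists i', q (lshift s i) = lshift s i'.
  have := qc (lshift s i); rewrite -[q _]splitK; case: (split _) => i' /=; first by exists i'.
  by move=> /esym/eqP; rewrite (negbTE (pos_disjoint _ _)).
have /fin_all_exists[g gE] i : exists i', q (rshift m i) = rshift m i'.
  have := qc (rshift m i); rewrite -[q _]splitK; case: (split _) => i' /=; last by exists i'.
  by move=> /eqP; rewrite (negbTE (pos_disjoint _ _)).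
have f_inj : injective f.
  by move=> i j fij; apply/(@lshift_inj m s)/(@perm_inj _ q); rewrite !fE fij.
have g_inj : injective g.
  by move=> i j gij; apply/(@rshift_inj m s)/(@perm_inj _ q); rewrite !gE gij.
exists (perm f_inj, perm g_inj); split.
- by apply/permP; apply: ord_sumP => i; rewrite ?sym_embedL ?sym_embedR ?fE ?gE permE.
- apply/col_stabP => i; rewrite permE; have := qc (lshift s i).
  by rewrite fE !posL => /addIn.
apply/col_stabP => i; rewrite permE; have := qc (rshift m i).
by rewrite gE !posR => /addIn.
Qed.

Lemma sym_embed_col (x : 'S_m * 'S_s) :
  (sym_embed x \in col_stabilizer pos) =
  (x.1 \in col_stabilizer (box_of la1)) && (x.2 \in col_stabilizer (box_of la2)).
Proof.
apply/idP/andP => [/col_stab_juxtaposed[y [/sym_embed_inj -> ? ?]] //|[/col_stabP h1 /col_stabP h2]].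
by apply/col_stabP; apply: ord_sumP => i; rewrite ?sym_embedL ?sym_embedR ?posL ?posR /= ?h1 ?h2.
Qed.

Lemma sym_embed_row (x : 'S_m * 'S_s) :
  x.1 \in row_stabilizer (box_of la1) -> x.2 \in row_stabilizer (box_of la2) ->
  sym_embed x \in row_stabilizer pos.
Proof.
move=> /row_stabP h1 /row_stabP h2; apply/row_stabP; apply: ord_sumP => i.
  by rewrite sym_embedL !posL /= h1.
by rewrite sym_embedR !posR /= h2.
Qed.

Lemma odd_sym_embed (x : 'S_m * 'S_s) : odd_perm (sym_embed x) = x.1 (+) x.2 :> bool.
Proof.
have oddL (p : 'S_m) : odd_perm (sym_embed (p, 1%g : 'S_s)) = p :> bool.
  elim/perm_adjacent_ind: p => [|p q hp hq|i j ij].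
  - have -> : sym_embed (1%g : 'S_m, 1%g : 'S_s) = 1%g.
      by apply/permP; apply: ord_sumP => i; rewrite ?sym_embedL ?sym_embedR !perm1.
    by rewrite !odd_perm1.
  - have -> : (p * q, 1)%g = ((p, 1) * (q, 1))%g :> 'S_m * 'S_s by congr pair; rewrite mulg1.
    by rewrite sym_embedM !odd_permM hp hq.
  have -> : sym_embed (tperm i j, 1%g : 'S_s) = tperm (lshift s i) (lshift s j).
    apply/permP; apply: ord_sumP => k; rewrite ?sym_embedL ?sym_embedR /=.
      rewrite -[RHS]/(tperm _ _ (lshift s k)) /=; case: (tpermP i j k) => [->|->|/eqP ki /eqP kj].
      + by rewrite tpermL. + by rewrite tpermR.
      by rewrite tpermD // (inj_eq (@lshift_inj m s)) eq_sym.
    by rewrite perm1 tpermD // eq_lrshift.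
  by rewrite !odd_tperm (inj_eq (@lshift_inj m s)).
have oddR (p : 'S_s) : odd_perm (sym_embed (1%g : 'S_m, p)) = p :> bool.
  elim/perm_adjacent_ind: p => [|p q hp hq|i j ij].
  - have -> : sym_embed (1%g : 'S_m, 1%g : 'S_s) = 1%g.
      by apply/permP; apply: ord_sumP => i; rewrite ?sym_embedL ?sym_embedR !perm1.
    by rewrite !odd_perm1.
  - have -> : (1, p * q)%g = ((1, p) * (1, q))%g :> 'S_m * 'S_s by congr pair; rewrite mulg1.
    by rewrite sym_embedM !odd_permM hp hq.
  have -> : sym_embed (1%g : 'S_m, tperm i j) = tperm (rshift m i) (rshift m j).
    apply/permP; apply: ord_sumP => k; rewrite ?sym_embedL ?sym_embedR /=.
      by rewrite perm1 tpermD // eq_rlshift.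
    case: (tpermP i j k) => [->|->|/eqP ki /eqP kj].
    + by rewrite tpermL. + by rewrite tpermR.
    by rewrite tpermD // (inj_eq (@rshift_inj m s)) eq_sym.
  by rewrite !odd_tperm (inj_eq (@rshift_inj m s)).
have -> : x = ((x.1, 1) * (1, x.2))%g by case: x => p q; congr pair; rewrite /= ?mulg1 ?mul1g.
by rewrite sym_embedM odd_permM oddL oddR /= mulg1 mul1g.
Qed.

Section Restricted.
Variables (d : nat) (r : mx_representation F G d).
Local Notation rL := (fun p : 'S_m => r (sym_embed (p, 1%g : 'S_s))).
Local Notation rR := (fun p : 'S_s => r (sym_embed (1%g : 'S_m, p))).

Lemma sym_embed1 : sym_embed (1%g : 'S_m, 1%g : 'S_s) = 1%g.
Proof. by apply/permP; apply: ord_sumP => i; rewrite ?sym_embedL ?sym_embedR !perm1. Qed.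

Lemma restrL_mx_repr : mx_repr [set: 'S_m]%G rL.
Proof.
split=> [|p q _ _]; first by rewrite sym_embed1 repr_mx1.
by rewrite -repr_setM -sym_embedM; congr (r (sym_embed (_, _))); rewrite mulg1.
Qed.

Lemma restrR_mx_repr : mx_repr [set: 'S_s]%G rR.
Proof.
split=> [|p q _ _]; first by rewrite sym_embed1 repr_mx1.
by rewrite -repr_setM -sym_embedM; congr (r (sym_embed (_, _))); rewrite mulg1.
Qed.

Lemma restrE (x : 'S_m * 'S_s) : r (sym_embed x) = rL x.1 *m rR x.2.
Proof.
rewrite -repr_setM -sym_embedM; congr (r (sym_embed _)).
by case: x => p q; congr pair; rewrite /= ?mulg1 ?mul1g.
Qed.

Lemma restrC p q : rR q *m rL p = rL p *m rR q.
Proof.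
rewrite -!repr_setM -!sym_embedM; congr (r (sym_embed _)).
by congr pair; rewrite /= ?mulg1 ?mul1g.
Qed.

Local Notation y1 x := (young_symmetrizer F m la1 0 (gring_index [set: 'S_m]%G x)).
Local Notation y2 x := (young_symmetrizer F s la2 0 (gring_index [set: 'S_s]%G x)).

(** The row symmetrizer of the whole diagram absorbs those of the blocks, each at the cost of the
    order of its row group, and the two column antisymmetrizers multiply to the one of the whole
    diagram. *)
Lemma young_juxtaposed :
  row_sym r pos *m (\sum_(x : 'S_m * 'S_s) (y1 x.1 * y2 x.2) *: r (sym_embed x)) =
  (#|row_stabilizer (box_of la1 : 'I_m -> _)| * #|row_stabilizer (box_of la2 : 'I_s -> _)|)%:R *:
    (row_sym r pos *m col_antisym r pos).
Proof.
have -> : \sum_(x : 'S_m * 'S_s) (y1 x.1 * y2 x.2) *: r (sym_embed x) =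
   row_sym rL (box_of la1) *m col_antisym rL (box_of la1) *m
   (row_sym rR (box_of la2) *m col_antisym rR (box_of la2)).
  have -> : row_sym rL (box_of la1) *m col_antisym rL (box_of la1) = \sum_p y1 p *: rL p.
    by rewrite -(gring_mx_sum (MxRepresentation restrL_mx_repr)) gring_mx_young.
  have -> : row_sym rR (box_of la2) *m col_antisym rR (box_of la2) = \sum_p y2 p *: rR p.
    by rewrite -(gring_mx_sum (MxRepresentation restrR_mx_repr)) gring_mx_young.
  rewrite mulmx_suml; under [RHS]eq_bigr => p _ do rewrite mulmx_sumr.
  rewrite pair_bigA; apply: eq_bigr => x _ /=.
  by rewrite restrE -scalemxAl -scalemxAr scalerA.
have RC : col_antisym rL (box_of la1) *m row_sym rR (box_of la2) =
          row_sym rR (box_of la2) *m col_antisym rL (box_of la1).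
  rewrite /col_antisym /row_sym mulmx_suml mulmx_sumr; apply: eq_bigr => p _.
  rewrite mulmx_suml mulmx_sumr; apply: eq_bigr => q _.
  by rewrite -scalemxAl -scalemxAr restrC.
have CC : col_antisym rL (box_of la1) *m col_antisym rR (box_of la2) = col_antisym r pos.
  rewrite /col_antisym mulmx_suml.
  under eq_bigr => p _ do rewrite mulmx_sumr.
  rewrite pair_big [RHS](reindex_onto (@sym_embed m s) 
    (fun q => odflt (1%g, 1%g) [pick x : 'S_m * 'S_s | sym_embed x == q])) /=; last first.
    move=> q /col_stab_juxtaposed[x [-> _ _]]; case: pickP => [y /eqP //|/(_ x)].
    by rewrite eqxx.
  apply: eq_big => [x|x _].
    rewrite sym_embed_col; case: pickP => [y /eqP/sym_embed_inj -> /=|/(_ x)]; last by rewrite eqxx.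
    by rewrite eqxx andbT.
  by rewrite odd_sym_embed signr_addb (restrE x) -scalemxAl -scalemxAr scalerA.
have RL : row_sym r pos *m row_sym rL (box_of la1) =
    #|row_stabilizer (box_of la1 : 'I_m -> _)|%:R *: row_sym r pos.
  rewrite {2}/row_sym mulmx_sumr (eq_bigr (fun=> row_sym r pos)) => [|p pr].
    by rewrite sumr_const scaler_nat.
  rewrite row_symM //; first exact: repr_setM.
  by rewrite sym_embed_row //; apply/row_stabP => k; rewrite perm1.
have RR : row_sym r pos *m row_sym rR (box_of la2) =
    #|row_stabilizer (box_of la2 : 'I_s -> _)|%:R *: row_sym r pos.
  rewrite {2}/row_sym mulmx_sumr (eq_bigr (fun=> row_sym r pos)) => [|p pr].
    by rewrite sumr_const scaler_nat.
  rewrite row_symM //; first exact: repr_setM.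
  by rewrite sym_embed_row //; apply/row_stabP => k; rewrite perm1.
rewrite !mulmxA RL -!scalemxAl -[_ *m col_antisym rL _ *m row_sym rR _]mulmxA RC mulmxA RR.
by rewrite -!scalemxAl -mulmxA CC scalerA natrM.
Qed.

End Restricted.

Section Quotient.
Variables (q c : F) (f : {mpoly F[n]}) (al : F).
Hypothesis fS : symmetric_under_perms f.

(** A homomorphism from the induced module to the regular one sends some row to a nonzero multiple
    of the Young symmetrizer of the juxtaposed diagram; comparing the two actions there identifies
    the scalar. *)
Lemma ind_juxtaposed : mxeval (fun k => q%:M + c *: jm N 1%g k) f = al%:M ->
  al = f.@[fun k => q + c * ((pos k).2%:R - (pos k).1%:R)].
Proof.
move=> fN; pose D := (\rank (cyclic_mx (regular_repr F [set: 'S_m]%G) (young_symmetrizer F m la1)) *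
  \rank (cyclic_mx (regular_repr F [set: 'S_s]%G) (young_symmetrizer F s la2)))%N.
pose theta : 'M[F]_(D, 1) := tprod (specht_coef1 F m la1) (specht_coef1 F s la2).
pose y : 'M[F]_(1, D) := tprod (specht_gen F m la1) (specht_gen F s la2).
have [A AE] : exists A, A = row_sym aG pos by exists (row_sym aG pos).
(* [theta] is a linear form on values; summation over the group makes [Q] equivariant, and [A]
   places the row symmetrizer of the whole diagram on the left. *)
pose Q := \sum_(x : 'S_n) ev x *m theta *m gring_row (A *m aG x^-1%g).
have QJ g : N g *m Q = Q *m aG g.
  rewrite mulmx_sumr mulmx_suml [RHS](reindex_inj (mulgI g)) /=.
  apply: eq_bigr => x _; rewrite !mulmxA ind_eval_act -!mulmxA -gring_row_mul -mulmxA -repr_setM.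
  by rewrite invMg mulgKV.
(* [y0] is the function supported on the embedded S_m x S_s whose value at 1 is the product of the
   two generators. *)
have [y0 y0E] : exists M : 'M_(1, _), forall x, M *m ev x = \sum_(k | sym_embed k == x) y *m rK k.
  apply: ind_eval_ex => x k; rewrite mulmx_suml (reindex_inj (mulIg k)).
  apply: eq_big => [k'|k' _]; first by rewrite sym_embedM (inj_eq (mulIg _)).
  by rewrite repr_mxM ?inE // mulmxA.
have thetaE k : y *m rK k *m theta =
    (young_symmetrizer F m la1 0 (gring_index [set: 'S_m]%G k.1^-1%g) *
     young_symmetrizer F s la2 0 (gring_index [set: 'S_s]%G k.2^-1%g))%:M.
  rewrite -!specht_gen_coef -tprod11.
  rewrite (tprodE (specht_gen F m la1 *m specht F m la1 k.1) (specht_coef1 F m la1)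
                  (specht_gen F s la2 *m specht F s la2 k.2) (specht_coef1 F s la2)).
  by rewrite (tprodE (specht_gen F m la1) (specht F m la1 k.1)
                     (specht_gen F s la2) (specht F s la2 k.2)).
have yQ : y0 *m Q = gring_row (A *m \sum_(x : 'S_m * 'S_s)
    (young_symmetrizer F m la1 0 (gring_index [set: 'S_m]%G x.1) *
     young_symmetrizer F s la2 0 (gring_index [set: 'S_s]%G x.2)) *: aG (sym_embed x)).
  pose z k := young_symmetrizer F m la1 0 (gring_index [set: 'S_m]%G k.1^-1%g) *
     young_symmetrizer F s la2 0 (gring_index [set: 'S_s]%G k.2^-1%g).
  have y0x x : y0 *m (ev x *m theta *m gring_row (A *m aG x^-1%g)) =
      \sum_(k | sym_embed k == x) z k *: gring_row (A *m aG (sym_embed k)^-1%g).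
    rewrite !mulmxA y0E !mulmx_suml; apply: eq_bigr => k /eqP <-.
    by rewrite thetaE mul_scalar_mx.
  rewrite mulmx_sumr (eq_bigr _ (fun x _ => y0x x)).
  rewrite (exchange_big_dep predT) //= mulmx_sumr linear_sum.
  rewrite [RHS](reindex_inj invg_inj); apply: eq_bigr => k _.
  rewrite (big_pred1 (sym_embed k)); last by move=> x; rewrite /= eq_sym.
  rewrite -scalemxAr linearZ /=; congr (_ *: gring_row (_ *m aG _)).
  apply: (mulIg (sym_embed k)); rewrite mulVg -sym_embedM mulVg.
  exact/esym/sym_embed1.
have /(congr1 (mulmx y0)) : mxeval (fun k => q%:M + c *: jm N 1%g k) f *m Q =
    Q *m mxeval (fun k => q%:M + c *: jm aG 1%g k) f.
  apply: mxeval_intertwine => k; rewrite mulmxDr mulmxDl scalar_mxC -scalemxAl -scalemxAr.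
  congr (_ + _ *: _); rewrite /jm mulmx_suml mulmx_sumr.
  by apply: eq_bigr => j _; apply: QJ.
rewrite fN mul_scalar_mx -scalemxAr [in RHS]mulmxA yQ AE young_juxtaposed.
set C := _%:R; have C0 : C != 0.
  rewrite pnatr_eq0 muln_eq0 negb_or -!lt0n; apply/andP; split; apply/card_gt0P; exists 1%g.
    by apply/row_stabP => k; rewrite perm1.
  by apply/row_stabP => k; rewrite perm1.
have rZ (z : F) (X : 'M[F]_(gcard G)) : gring_row (z *: X) = z *: gring_row X by rewrite linearZ.
rewrite rZ -scalemxAl -gring_row_mul mxeval_young //; last exact: juxtaposed_inj.
rewrite rZ !scalerA mulrC => /eqP; rewrite -subr_eq0 -scalerBl scaler_eq0 (negbTE (young_neq0 _ juxtaposed_inj)) orbF.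
by rewrite -mulrBr mulf_eq0 (negbTE C0) /= subr_eq0 => /eqP.
Qed.

End Quotient.

End JuxtaposedDiagrams.

(** * Rectangular diagrams *)

Lemma sum_boxes (V : nmodType) n la (g : nat * nat -> V) : is_partition_of n la ->
  \sum_(k < n) g (box_of la k) = \sum_(0 <= i < size la) \sum_(0 <= j < nth 0%N la i) g (i, j).
Proof.
move=> la_part; rewrite /box_of -(big_mkord predT (fun k => g (nth (0, 0)%N (boxes la) k))).
rewrite -{1}(size_boxes la_part) -(big_nth (0, 0)%N predT g) /boxes big_allpairs_dep /=.
rewrite /index_iota subn0; apply: eq_bigr => i _.
by rewrite subn0.
Qed.

(** [k0] is the bottom box of the last column. The rows down to it form a rectangle, which satisfies
    the equation by itself, and every further row would make the left side strictly too small. *)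
Lemma content_rectangle n la (k0 : 'I_n) : is_partition_of n la ->
    (forall k : 'I_n, ((box_of la k).2 < (box_of la k0).2)%N ||
       (((box_of la k).2 == (box_of la k0).2) && ((box_of la k).1 <= (box_of la k0).1)%N)) ->
    2%:Z * \sum_(k < n) ((box_of la k).2%:Z - (box_of la k).1%:Z) =
      n%:Z * ((box_of la k0).2%:Z - (box_of la k0).1%:Z) ->
  la = nseq (box_of la k0).1.+1 (box_of la k0).2.+1.
Proof.
move=> la_part k0_last; set r1 := (box_of la k0).1; set b1 := (box_of la k0).2 => sumE.
have lt_b1 : (b1 < nth 0 la r1)%N by rewrite -mem_boxes box_of_mem.
have row_le i : (nth 0 la i <= b1.+1)%N.
  rewrite leqNgt; apply/negP => /(box_of_ex la_part)[k kE].
  by have := k0_last k; rewrite kE -/b1 -/r1 /=; lia.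
have row_lt i : (r1 < i)%N -> (nth 0 la i < b1.+1)%N.
  move=> lt_i; rewrite ltnNge; apply/negP => /(box_of_ex la_part)[k kE].
  by have := k0_last k; rewrite kE -/b1 -/r1 /=; lia.
have row_eq i : (i <= r1)%N -> nth 0%N la i = b1.+1.
  by move=> le_i; apply/eqP; rewrite eqn_leq row_le (leq_trans lt_b1) ?(nth_part la_part).
have lt_r1 : (r1 < size la)%N by rewrite ltnNge; apply: contraL lt_b1 => le_s; rewrite nth_default.
(* Row i's share of twice the sum of contents minus n times the content of [k0]. *)
pose t i : int := (nth 0%N la i)%:Z * ((nth 0%N la i)%:Z - 2 * i%:Z - b1%:Z - 1 + r1%:Z).
have sumj (l : nat) : \sum_(0 <= j < l) (2 * (j%:Z : int)) = l%:Z * (l%:Z - 1).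
  elim: l => [|l IH]; first by rewrite big_nil mul0r.
  by rewrite big_nat_recr //= IH; lia.
have t0 : \sum_(0 <= i < size la) t i = 0.
  have -> : \sum_(0 <= i < size la) t i =
     2%:Z * \sum_(k < n) ((box_of la k).2%:Z - (box_of la k).1%:Z) - n%:Z * (b1%:Z - r1%:Z).
    rewrite (sum_boxes (fun b => b.2%:Z - b.1%:Z : int)) //.
    have -> : n%:Z * (b1%:Z - r1%:Z) = \sum_(k < n) (b1%:Z - r1%:Z).
      by rewrite sumr_const card_ord -mulr_natl natz.
    rewrite (@sum_boxes _ n la (fun=> b1%:Z - r1%:Z)) // mulr_sumr -sumrB.
    apply: eq_bigr => i _; rewrite mulr_sumr -sumrB /t.
    under eq_bigr => j _ do rewrite mulrBr -addrA.
    rewrite big_split /= sumj sumr_const_nat subn0 -[_ *+ _]mulr_natl natz; ring.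
  by rewrite sumE subrr.
have t_low : \sum_(0 <= i < r1.+1) t i = 0.
  have -> : \sum_(0 <= i < r1.+1) t i = \sum_(0 <= i < r1.+1) (b1.+1%:Z * r1%:Z - b1.+1%:Z * (2 * i%:Z)).
    by rewrite !big_nat; apply: eq_bigr => i /andP[_ lt_i]; rewrite /t row_eq //; lia.
  by rewrite sumrB -[X in _ - X]mulr_sumr sumj sumr_const_nat subn0 -[_ *+ _]mulr_natl natz; ring.
have sz : size la = r1.+1.
  apply/eqP; rewrite eqn_leq lt_r1 andbT leqNgt; apply/negP => lt_sz.
  have : \sum_(r1.+1 <= i < size la) t i < 0.
    have tneg i : (r1.+1 <= i < size la)%N -> t i < 0.
      move=> /andP[lt_i lt_is]; rewrite /t.
      have : (0 < nth 0 la i)%N.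
        rewrite lt0n; apply: contraTneq la_part => l0; rewrite /is_partition_of -l0.
        by rewrite mem_nth //= andbF.
      move=> l_gt0; have := row_lt _ lt_i; rewrite pmulr_rlt0 //; lia.
    rewrite big_ltn //; apply: ltr_wnDr; last by apply: tneg; rewrite leqnn.
    rewrite big_nat; apply: sumr_le0 => i /andP[lt_i lt_is]; apply/ltW/tneg.
    by rewrite ltnW.
  by rewrite (big_cat_nat (n := r1.+1)) //= ?t_low ?add0r // in t0; rewrite t0 ltxx.
apply: (@eq_from_nth _ 0%N); rewrite ?size_nseq // => i.
by rewrite sz ltnS nth_nseq ltnS => le_i; rewrite le_i row_eq.
Qed.

Section StarSums.
Variables (F : numFieldType) (n : nat) (la : seq nat).
Hypothesis la_part : is_partition_of n la.
Local Notation G := [set: 'S_n]%G.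
Local Notation aG := (regular_repr F G).
Variable c : F.
Hypothesis n_gt0 : (0 < n)%N.
Hypothesis starE : forall i, specht_gen F n la *m (\sum_(j | j != i) specht F n la (tperm j i)) =
  c *: specht_gen F n la.

(** For the last index in column reading order the star sum is a Jucys-Murphy element, so c is the
    content of the last box. The star sums together contain each transposition twice, so n c is
    twice the sum of the contents, and [content_rectangle] applies. *)
Lemma star_sum_rectangle : exists a b, [/\ la = nseq a b, (0 < a)%N, (0 < b)%N & c = b%:R - a%:R].
Proof.
have last_idx : (n.-1 < n)%N by rewrite prednK.
have pos_inj := @box_of_inj n la la_part.
pose spe := specht F n la.
have [o oE] := col_order pos_inj.
pose k0 : 'I_n := o^-1%g (Ordinal last_idx).
have k0_last k : k != k0 -> (o k < o k0)%N.
  move=> ne_k; rewrite permKV ltn_neqAle -ltnS prednK // ltn_ord andbT.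
  by apply: contra ne_k => /eqP e; apply/eqP/(@perm_inj _ o)/val_inj; rewrite permKV.
pose y := specht_gen F n la.
have yV : young_symmetrizer F n la = val_submod y by rewrite in_submodK // cyclic_mx_id.
pose ct (k : 'I_n) : F := (box_of la k).2%:R - (box_of la k).1%:R.
have y_neq0 : y != 0.
  by apply: contraNneq (young_neq0 F pos_inj) => y0; rewrite -young_symmetrizerE yV y0 linear0.
have val_jm k : val_submod (y *m jm spe o k) = val_submod y *m jm aG o k.
  rewrite /jm !mulmx_sumr linear_sum; apply: eq_bigr => j _.
  exact: val_submodJ (in_setT _).
have ys_jm k : young_symmetrizer F n la *m jm aG o k = ct k *: young_symmetrizer F n la.
  rewrite young_symmetrizerE -gring_row_mul young_jm ?linearZ //.
  - exact: repr_setM.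
  - exact: box_of_left.
  exact: box_of_up.
have y_jm k : y *m jm spe o k = ct k *: y.
  apply: (@val_submod_inj _ _ (cyclic_mx aG (young_symmetrizer F n la))).
  by rewrite val_jm -yV ys_jm [RHS]linearZ /= -/(val_submod y) -yV.
have ct_k0 : ct k0 = c.
  apply/eqP; rewrite -subr_eq0; have : (ct k0 - c) *: y == 0.
    rewrite scalerBl -y_jm -(starE k0) /jm subr_eq0; apply/eqP; congr (_ *m _).
    apply: eq_bigl => j; have [->|/k0_last -> //] := eqVneq j k0; by rewrite ltnn.
  by rewrite scaler_eq0 (negbTE y_neq0) orbF.
have sumE : n%:R * c = 2 * \sum_k ct k.
  apply/eqP; rewrite -subr_eq0; have : (n%:R * c - 2 * \sum_k ct k) *: y == 0.
    rewrite scalerBl subr_eq0; apply/eqP.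
    have -> : (n%:R * c) *: y = y *m \sum_i \sum_(j | j != i) spe (tperm j i).
      rewrite mulmx_sumr (eq_bigr (fun=> c *: y)) => [|i _]; last exact: starE.
      by rewrite sumr_const card_ord -scaler_nat scalerA.
    have -> : \sum_i \sum_(j | j != i) spe (tperm j i) = \sum_i jm spe o i + \sum_i jm spe o i.
      under eq_bigr => i _ do rewrite (bigID (fun j => o j < o i)%N) /=.
      rewrite big_split /=; congr (_ + _).
        apply: eq_bigr => i _; apply: eq_bigl => j; case: eqVneq => [->|//]; by rewrite ltnn.
      rewrite (exchange_big_dep predT) //=; apply: eq_bigr => j _.
      under eq_bigr => i _ do rewrite tpermC.
      apply: eq_bigl => i; case: eqVneq => [->|ne]; first by rewrite ltnn.
      by rewrite -leqNgt leq_eqVlt val_eqE (inj_eq perm_inj) eq_sym (negbTE ne).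
    rewrite -mulr2n -scaler_nat -scalemxAr mulmx_sumr -scalerA scaler_suml.
    by congr (_ *: _); apply: eq_bigr => k _; rewrite y_jm.
  by rewrite scaler_eq0 (negbTE y_neq0) orbF.
have ctE k : ct k = ((box_of la k).2%:Z - (box_of la k).1%:Z)%:~R by rewrite rmorphB /=.
exists (box_of la k0).1.+1, (box_of la k0).2.+1; split => //; last first.
  by rewrite -ct_k0 /ct -!natr1; ring.
apply: (content_rectangle la_part) => [k|].
  have [->|/k0_last] := eqVneq k k0; first by rewrite eqxx leqnn orbT.
  by rewrite oE => /orP[->//|/andP[-> /ltnW ->]]; rewrite orbT.
apply/eqP; rewrite -(eqr_int F) !rmorphM /= rmorph_sum /=.
under eq_bigr => k _ do rewrite -ctE.
by rewrite -ctE ct_k0 -sumE.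
Qed.

End StarSums.

(** * Counting contents of rectangles up to sign *)

Section RectangleCount.
Variable v : int.

(** Counts k up to sign, with weight 2 at k = v = 0. As a sum of two indicators it has the simple
    antidifference below. *)
Definition twin_count (k : int) : int := (k == v)%:Z + (k == - v)%:Z.

(* A second antidifference, with step 2, of [twin_count]. *)
Definition twin_potential (k : int) : int :=
  if (2 %| k - v)%Z then `|k - v| + `|k + v| else 0.

Lemma twin_countN k : twin_count (- k) = twin_count k.
Proof. by rewrite /twin_count eqr_opp addrC -eqr_oppLR. Qed.

Lemma twin_potentialN k : twin_potential (- k) = twin_potential k.
Proof.
rewrite /twin_potential; have -> : (2 %| - k - v)%Z = (2 %| k - v)%Z.
  by apply/dvdzP/dvdzP => -[c cE]; exists (- c - v); lia.
by case: ifP => // _; lia.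
Qed.

(** If k and v have the same parity, k - v and k + v are even, and on even integers the absolute
    value has second difference 4 at 0 and 0 elsewhere, for step 2. This is the origin of the factor
    4. *)
Lemma twin_potential_diff k :
  twin_potential (k + 2) - twin_potential k *+ 2 + twin_potential (k - 2) = 4 * twin_count k.
Proof.
rewrite /twin_potential /twin_count.
have dv2 e : (2 %| k + e * 2 - v)%Z = (2 %| k - v)%Z.
  by apply/dvdzP/dvdzP => -[c cE]; [exists (c - e) | exists (c + e)]; lia.
have := dv2 1; have := dv2 (- 1); rewrite mulN1r mul1r => -> ->.
case: ifP => [/dvdzP[c cE]|/negbT kv].
  by case: (k =P v) => kv; case: (k =P - v) => kv'; lia.
case: (k =P v) => [kv'|_]; first by rewrite kv' subrr dvdz0 in kv.
case: (k =P - v) => [kv'|_]; last by rewrite mul0rn subr0 addr0.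
by case/negP: kv; apply/dvdzP; exists (- v); lia.
Qed.

(** The second difference telescopes along the rows and then down the columns, leaving the potential
    at four corners. *)
Lemma sum_rectangle (a b : nat) (z : int) :
  4 * \sum_(0 <= i < a) \sum_(0 <= j < b) twin_count (z + 2 * (j%:Z - i%:Z)) =
  twin_potential (z + 2 * b%:Z) - twin_potential (z + 2 * b%:Z - 2 * a%:Z)
  - twin_potential z + twin_potential (z - 2 * a%:Z).
Proof.
pose G := twin_potential.
have sumj (w : int) : 4 * \sum_(0 <= j < b) twin_count (w + 2 * j%:Z) =
    (G (w + 2 * b%:Z) - G (w + 2 * b%:Z - 2)) - (G w - G (w - 2)).
  elim: b => [|b' IH]; first by rewrite big_nil !mulr0 !addr0 subrr.
  rewrite big_nat_recr //= mulrDr {}IH -twin_potential_diff -/G.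
  have -> : w + 2 * b'.+1%:Z = w + 2 * b'%:Z + 2 by lia.
  have -> : w + 2 * b'%:Z + 2 - 2 = w + 2 * b'%:Z by lia.
  by ring.
have sumi (w : int) : \sum_(0 <= i < a) (G (w - 2 * i%:Z) - G (w - 2 * i%:Z - 2)) =
    G w - G (w - 2 * a%:Z).
  elim: a => [|a' IH]; first by rewrite big_nil !mulr0 !subr0 subrr.
  rewrite big_nat_recr //= {}IH; have -> : w - 2 * a'.+1%:Z = w - 2 * a'%:Z - 2 by lia.
  by lia.
rewrite mulr_sumr.
have rowE (i : nat) : 4 * \sum_(0 <= j < b) twin_count (z + 2 * (j%:Z - i%:Z)) =
   (G (z + 2 * b%:Z - 2 * i%:Z) - G (z + 2 * b%:Z - 2 * i%:Z - 2)) -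
   (G (z - 2 * i%:Z) - G (z - 2 * i%:Z - 2)).
  have <- : z - 2 * i%:Z + 2 * b%:Z = z + 2 * b%:Z - 2 * i%:Z by lia.
  by rewrite -sumj; congr (_ * _); apply: eq_bigr => j _; congr twin_count; lia.
rewrite (eq_bigr _ (fun i _ => rowE i)) sumrB !sumi /G; lia.
Qed.

End RectangleCount.

Lemma perm_of_count n (x y : 'I_n -> int) :
  (forall v, \sum_k twin_count v (x k) = \sum_k twin_count v (y k)) ->
  exists p : 'S_n, forall k, x k = y (p k) \/ x k = - y (p k).
Proof.
move=> xy; have : perm_eq [tuple `|x k|%N | k < n] [tuple `|y k|%N | k < n].
  apply/allP => w _ /=; rewrite !count_map /=; apply/eqP.
  (* The factor compensates for the double count of 0 in [twin_count]; being nonzero, it cancels. *)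
  have cntE (u : 'I_n -> int) : (1 + (w == 0%N))%:Z * 
      (count (preim (fun k => `|u k|%N) (pred1 w)) (enum 'I_n))%:Z = \sum_k twin_count w%:Z (u k).
    rewrite -sum1_count big_enum_cond /= raddf_sum /= big_mkcond mulr_sumr; apply: eq_bigr => k _.
    rewrite /twin_count; case: (`|u k|%N =P w); case: (w =P 0%N); case: (u k =P w%:Z); case: (u k =P - w%:Z); lia.
  have := xy w%:Z; rewrite -!cntE -enumT => e.
  have x0 : (1 + (w == 0%N))%:Z != 0 by [].
  by have [] := mulfI x0 e.
case/tuple_permP => p pE; exists p => k.
have : `|x k|%N = `|y (p k)|%N.
  have := congr1 (fun t => nth 0%N t k) pE.
  by rewrite /= -!(tnth_nth 0%N [tuple _ | _ < n]) !tnth_mktuple.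
by lia.
Qed.

Definition juxt_shiftL (a a2 b2 : nat) := if (a2 <= a)%N then 0%N else b2.
Definition juxt_shiftR (a b a2 : nat) := if (a2 <= a)%N then b else 0%N.

(* Boxes of an a x b and an a2 x b2 rectangle, the taller one on the left. *)
Definition juxt_pos m s (a b a2 b2 : nat) (k : 'I_(m + s)) : nat * nat :=
  match split k with
  | inl i => ((box_of (nseq a b) i).1, (box_of (nseq a b) i).2 + juxt_shiftL a a2 b2)%N
  | inr i => ((box_of (nseq a2 b2) i).1, (box_of (nseq a2 b2) i).2 + juxt_shiftR a b a2)%N
  end.

Definition juxt_content m s (a b a2 b2 : nat) (k : 'I_(m + s)) : int :=
  (juxt_pos a b a2 b2 k).2%:Z - (juxt_pos a b a2 b2 k).1%:Z.

Section Juxtaposition.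
Variables (m s a b a2 b2 : nat).
Hypotheses (L_part : is_partition_of m (nseq a b)) (R_part : is_partition_of s (nseq a2 b2)).

Lemma juxt_posL (i : 'I_m) : juxt_pos a b a2 b2 (lshift s i) =
  ((box_of (nseq a b) i).1, (box_of (nseq a b) i).2 + juxt_shiftL a a2 b2)%N.
Proof. by rewrite /juxt_pos (unsplitK (inl _)). Qed.

Lemma juxt_posR (i : 'I_s) : juxt_pos a b a2 b2 (rshift m i) =
  ((box_of (nseq a2 b2) i).1, (box_of (nseq a2 b2) i).2 + juxt_shiftR a b a2)%N.
Proof. by rewrite /juxt_pos (unsplitK (inr _)). Qed.

Lemma box_rectangle n' a' b' (i : 'I_n') : is_partition_of n' (nseq a' b') ->
  ((box_of (nseq a' b') i).1 < a')%N /\ ((box_of (nseq a' b') i).2 < b')%N.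
Proof.
move=> part; have := box_of_mem part i; rewrite mem_boxes nth_nseq.
by case: ifP.
Qed.

Lemma juxt_content_sum v (z : int) : 
  4 * \sum_(k < m + s) twin_count v (z + 2 * juxt_content a b a2 b2 k) =
  4 * \sum_(0 <= i < a) \sum_(0 <= j < b)
         twin_count v (z + 2 * (juxt_shiftL a a2 b2)%:Z + 2 * (j%:Z - i%:Z)) +
  4 * \sum_(0 <= i < a2) \sum_(0 <= j < b2)
         twin_count v (z + 2 * (juxt_shiftR a b a2)%:Z + 2 * (j%:Z - i%:Z)).
Proof.
have rectE n' a' b' (g : nat * nat -> int) : is_partition_of n' (nseq a' b') ->
    \sum_(k < n') g (box_of (nseq a' b') k) = \sum_(0 <= i < a') \sum_(0 <= j < b') g (i, j).
  move=> part; rewrite sum_boxes // size_nseq !big_nat; apply: eq_bigr => i /andP[_ lt_i].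
  by rewrite nth_nseq lt_i.
rewrite big_split_ord mulrDr /=; congr (4 * _ + 4 * _).
  rewrite -(rectE m _ _ (fun x => twin_count v (z + 2 * (juxt_shiftL a a2 b2)%:Z + 2 * (x.2%:Z - x.1%:Z)))) //.
  apply: eq_bigr => i _; rewrite /juxt_content juxt_posL /=; congr twin_count; lia.
rewrite -(rectE s _ _ (fun x => twin_count v (z + 2 * (juxt_shiftR a b a2)%:Z + 2 * (x.2%:Z - x.1%:Z)))) //.
apply: eq_bigr => i _; rewrite /juxt_content juxt_posR /=; congr twin_count; lia.
Qed.

Lemma juxt_disjoint (i : 'I_m) (j : 'I_s) : (juxt_pos a b a2 b2 (lshift s i)).2 != (juxt_pos a b a2 b2 (rshift m j)).2.
Proof.
have [_ lti] := box_rectangle i L_part; have [_ ltj] := box_rectangle j R_part.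
rewrite juxt_posL juxt_posR /= /juxt_shiftL /juxt_shiftR; case: ifP; lia.
Qed.

Lemma juxt_left (k : 'I_(m + s)) c : (c < (juxt_pos a b a2 b2 k).2)%N ->
  exists j : 'I_(m + s), juxt_pos a b a2 b2 j = ((juxt_pos a b a2 b2 k).1, c).
Proof.
have exL i j : (i < a)%N -> (j < b)%N -> exists k : 'I_m, box_of (nseq a b) k = (i, j).
  by move=> lt_i lt_j; apply: box_of_ex => //; rewrite nth_nseq lt_i.
have exR i j : (i < a2)%N -> (j < b2)%N -> exists k : 'I_s, box_of (nseq a2 b2) k = (i, j).
  by move=> lt_i lt_j; apply: box_of_ex => //; rewrite nth_nseq lt_i.
move: k; apply: ord_sumP => i; rewrite ?juxt_posL ?juxt_posR /=.
  have [lt1 lt2] := box_rectangle i L_part; rewrite /juxt_shiftL => lt_c.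
  have [le_c|lt_c'] := leqP (juxt_shiftL a a2 b2) c.
    have [|j jE] := exL _ (c - juxt_shiftL a a2 b2)%N lt1.
      by move: le_c lt_c; rewrite /juxt_shiftL; case: ifP; lia.
    by exists (lshift s j); rewrite juxt_posL jE /= subnK.
  move: lt_c lt_c'; rewrite /juxt_shiftL; case: (leqP a2 a) => // lt_a lt_c lt_c'.
  have [j jE] := exR _ _ (ltn_trans lt1 lt_a) lt_c'.
  by exists (rshift m j); rewrite juxt_posR jE /juxt_shiftR leqNgt lt_a /= addn0.
have [lt1 lt2] := box_rectangle i R_part; rewrite /juxt_shiftR => lt_c.
have [le_c|lt_c'] := leqP (juxt_shiftR a b a2) c.
  have [|j jE] := exR _ (c - juxt_shiftR a b a2)%N lt1.
    by move: le_c lt_c; rewrite /juxt_shiftR; case: ifP; lia.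
  by exists (rshift m j); rewrite juxt_posR jE /= subnK.
move: lt_c lt_c'; rewrite /juxt_shiftR; case: (leqP a2 a) => // le_a lt_c lt_c'.
have [j jE] := exL _ _ (leq_trans lt1 le_a) lt_c'.
by exists (lshift s j); rewrite juxt_posL jE /juxt_shiftL le_a /= addn0.
Qed.

Lemma juxt_up (k : 'I_(m + s)) i : (i < (juxt_pos a b a2 b2 k).1)%N ->
  exists j : 'I_(m + s), juxt_pos a b a2 b2 j = (i, (juxt_pos a b a2 b2 k).2).
Proof.
move: k; apply: ord_sumP => k; rewrite ?juxt_posL ?juxt_posR /= => lt_i.
  by have [j jE] := box_of_up L_part lt_i; exists (lshift s j); rewrite juxt_posL jE.
by have [j jE] := box_of_up R_part lt_i; exists (rshift m j); rewrite juxt_posR jE.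
Qed.

Lemma ind_rectangles (F : numFieldType) (q c : F) (f : {mpoly F[m + s]}) (al : F) :
  symmetric_under_perms f ->
  mxeval (fun k => q%:M + c *: jm (ind_repr (@sym_embed m s)
      (outer_repr (specht F m (nseq a b)) (specht F s (nseq a2 b2)))) 1%g k) f = al%:M ->
  al = f.@[fun k => q + c * (juxt_content a b a2 b2 k)%:~R].
Proof.
move=> fS /(ind_juxtaposed L_part R_part juxt_posL juxt_posR juxt_disjoint juxt_left juxt_up fS) ->.
by apply: meval_eq => k; rewrite /juxt_content rmorphB.
Qed.

End Juxtaposition.

(** In [two_blocks] the constants are 2 q / kl and 2 ks / kl. The second diagram uses the transposed
    right rectangle, so which rectangle is the taller is decided separately on each side, giving
    four cases. *)
Lemma juxt_content_perm m s a b a2 b2 : is_partition_of m (nseq a b) ->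
  is_partition_of s (nseq a2 b2) -> is_partition_of s (nseq b2 a2) ->
  exists p : 'S_(m + s), forall k, let x := (b%:Z - a%:Z + b2%:Z - a2%:Z) - 2 * juxt_content a b a2 b2 k in
    let y := (b2%:Z - a2%:Z - b%:Z + a%:Z) + 2 * juxt_content a b b2 a2 (p k) in
    x = y \/ x = - y.
Proof.
move=> L_part R_part R'_part; 
apply: (@perm_of_count _
  (fun k => (b%:Z - a%:Z + b2%:Z - a2%:Z) - 2 * juxt_content a b a2 b2 k)
  (fun k => (b2%:Z - a2%:Z - b%:Z + a%:Z) + 2 * juxt_content a b b2 a2 k)) => v.
apply: (@mulfI _ (4 : int)) => //.
under eq_bigr => k _ do rewrite -twin_countN opprB addrC.
rewrite !juxt_content_sum // !sum_rectangle /juxt_shiftL /juxt_shiftR.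
pose G := twin_potential v.
have Geq (x y : int) : x = y \/ x = - y -> G x = G y by move=> [->|->] //; apply: twin_potentialN.
pose t (e1 e2 e3 : int) := G (a%:Z + e1 * b%:Z + e2 * a2%:Z + e3 * b2%:Z).
have tE (x e1 e2 e3 : int) : let y := a%:Z + e1 * b%:Z + e2 * a2%:Z + e3 * b2%:Z in
  x = y \/ x = - y -> twin_potential v x = t e1 e2 e3 by exact: Geq.
move: t tE => t tE.
case: ifP => _; case: ifP => _;
  repeat match goal with |- context [twin_potential v ?x] =>
    first [ have -> : twin_potential v x = t 1 1 1 by apply: tE; lia
          | have -> : twin_potential v x = t 1 1 (- 1) by apply: tE; lia
          | have -> : twin_potential v x = t 1 (- 1) 1 by apply: tE; lia
          | have -> : twin_potential v x = t 1 (- 1) (- 1) by apply: tE; lia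
          | have -> : twin_potential v x = t (- 1) 1 1 by apply: tE; lia
          | have -> : twin_potential v x = t (- 1) 1 (- 1) by apply: tE; lia
          | have -> : twin_potential v x = t (- 1) (- 1) 1 by apply: tE; lia
          | have -> : twin_potential v x = t (- 1) (- 1) (- 1) by apply: tE; lia ]
  end; ring.
Qed.

(** * The hyperoctahedral group and its bipartition representations *)

Section SignedPerms.
Variable n : nat.
Implicit Types (p q : 'S_n) (w x : bgroup n).

Definition bperm p : bgroup n := (p, [ffun => false]).
Definition bflip (i : 'I_n) : bgroup n := (1%g, [ffun k => k == i]).

Lemma bgroupP w x : w.1 = x.1 -> (forall i, w.2 i = x.2 i) -> w = x.
Proof. by case: w x => [p e] [q f] /= -> h; congr pair; apply/ffunP. Qed.

Lemma bgroup_mul1 w x : (w * x)%g.1 = (w.1 * x.1)%g. Proof. by []. Qed.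
Lemma bgroup_mul2 w x i : (w * x)%g.2 i = w.2 i (+) x.2 (w.1 i).
Proof. by rewrite ffunE. Qed.
Lemma bgroup_one2 i : (1%g : bgroup n).2 i = false. Proof. by rewrite ffunE. Qed.

Lemma bpermM p q : bperm (p * q)%g = (bperm p * bperm q)%g.
Proof. by apply: bgroupP => // i; rewrite bgroup_mul2 !ffunE. Qed.

Lemma bperm1 : bperm 1%g = 1%g.
Proof. by apply: bgroupP => // i; rewrite bgroup_one2 ffunE. Qed.

Lemma bflipM i : (bflip i * bflip i)%g = 1%g.
Proof.
apply: bgroupP => [|k]; first by rewrite bgroup_mul1 mulg1.
by rewrite bgroup_mul2 bgroup_one2 !ffunE perm1 addbb.
Qed.

Lemma bflipC i j : (bflip i * bflip j)%g = (bflip j * bflip i)%g.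
Proof. by apply: bgroupP => // k; rewrite !bgroup_mul2 !ffunE !perm1 addbC. Qed.

Lemma bflip_perm i p : (bflip i * bperm p)%g = (bperm p * bflip (p i))%g.
Proof.
apply: bgroupP => [|k]; first by rewrite !bgroup_mul1 mul1g mulg1.
by rewrite !bgroup_mul2 !ffunE (inj_eq perm_inj) addbF.
Qed.

Lemma bgroup_decomp w : w = ((\prod_(i | w.2 i) bflip i) * bperm w.1)%g.
Proof.
have prod1 (r : seq 'I_n) (P : pred 'I_n) : (\prod_(i <- r | P i) bflip i)%g.1 = 1%g.
  elim: r => [|i r IH]; first by rewrite big_nil.
  by rewrite big_cons; case: ifP => //; rewrite bgroup_mul1 IH mulg1.
apply: bgroupP => [|k]; first by rewrite bgroup_mul1 prod1 mul1g.
rewrite bgroup_mul2 prod1 perm1 ffunE addbF.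
suff prod2 (r : seq 'I_n) : uniq r ->
    (\prod_(i <- r | w.2 i) bflip i)%g.2 k = (k \in r) && w.2 k.
  by rewrite prod2 ?index_enum_uniq // mem_index_enum.
elim: r => [|i r IH] /=; first by rewrite big_nil bgroup_one2.
move=> /andP[ir ur]; rewrite big_cons inE; case: ifP => wi; last first.
  by rewrite IH //; case: eqVneq => // ->; rewrite wi andbF.
rewrite bgroup_mul2 ffunE perm1 IH //; case: eqVneq => [->|_] //=.
by rewrite wi (negbTE ir).
Qed.

Lemma bgroup_ind (P : bgroup n -> Prop) :
  (forall p, P (bperm p)) -> (forall i, P (bflip i)) ->
  (forall w x, P w -> P x -> P (w * x)%g) -> forall w, P w.
Proof.
move=> Pp Pf PM w; rewrite (bgroup_decomp w); apply: (PM) => //.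
by apply: big_ind => [|//|//]; rewrite -bperm1.
Qed.

End SignedPerms.

(** * Sign changes and the twisted action on a bipartition module *)

Section BipartitionEval.
Variables (F : numFieldType) (m s dL dR : nat).
Variables (rL : mx_representation F [set: 'S_m]%G dL) (rR : mx_representation F [set: 'S_s]%G dR).
Local Notation n := (m + s)%N.
Local Notation rK := (outer_repr (infl_repr rL) (infl_sign_repr rR)).
(* The interface of [ind_eval]: rows of 'rV_d are the equivariant functions. *)
Variables (d : nat) (bip : bgroup n -> 'M[F]_d) (ev : bgroup n -> 'M[F]_(d, dL * dR)).
Hypothesis ev_act : forall w x, bip w *m ev x = ev (w * x)%g.
Hypothesis ev_equiv : forall x k, ev (x * bgroup_embed k)%g = ev x *m rK k.
Hypothesis ev_inj : forall (p : nat) (M : 'M_(p, d)), (forall x, M *m ev x = 0) -> M = 0.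
Hypothesis ev_ex : forall (p : nat) (phi : bgroup n -> 'M[F]_(p, dL * dR)),
  (forall x k, phi (x * bgroup_embed k)%g = phi x *m rK k) ->
  exists M : 'M_(p, d), forall x, M *m ev x = phi x.
Implicit Types (p q : 'S_n) (x y : bgroup n) (i j : 'I_n).

Definition block_sign i : F := if split i is inl _ then 1 else - 1.

Lemma block_signL (i : 'I_m) : block_sign (lshift s i) = 1.
Proof. by rewrite /block_sign (unsplitK (inl _)). Qed.

Lemma block_signR (i : 'I_s) : block_sign (rshift m i) = - 1.
Proof. by rewrite /block_sign (unsplitK (inr _)). Qed.

Lemma block_sign2 i : block_sign i * block_sign i = 1.
Proof. by rewrite /block_sign; case: split => _; rewrite ?mulr1 ?mulrNN ?mulr1. Qed.

Lemma block_sign_neq0 i : block_sign i != 0.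
Proof. by apply: contra_eq_neq (block_sign2 i) => ->; rewrite mul0r eq_sym oner_eq0. Qed.

Lemma block_sign_embed (k : 'S_m * 'S_s) i : block_sign (sym_embed k i) = block_sign i.
Proof. by move: i; apply: ord_sumP => i; rewrite ?sym_embedL ?sym_embedR ?block_signL ?block_signR. Qed.

Lemma ev_eq e (M N : 'M[F]_(e, d)) : (forall x, M *m ev x = N *m ev x) -> M = N.
Proof. by move=> h; apply/eqP; rewrite -subr_eq0; apply/eqP/ev_inj => x; rewrite mulmxBl h subrr. Qed.

Lemma bip_repr1 p x : bip (bperm p) *m ev x = ev (bperm p * x)%g.
Proof. exact: ev_act. Qed.

Lemma ev_bflip x i : ev (x * bflip i)%g = block_sign i *: ev x.
Proof.
move: i; apply: ord_sumP => i.
  have -> : bflip (lshift s i) = bgroup_embed (bflip i, 1%g : bgroup s).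
    apply: bgroupP => [|k] /=; first by rewrite sym_embed1.
    rewrite !ffunE; move: k; apply: ord_sumP => k.
      by rewrite (unsplitK (inl _)) ffunE (inj_eq (@lshift_inj _ _)).
    by rewrite (unsplitK (inr _)) bgroup_one2 eq_rlshift.
  rewrite ev_equiv block_signL scale1r /= big1 => [|k _]; last by rewrite ffunE.
  by rewrite scale1r !repr_mx1 tprod1 mulmx1.
have -> : bflip (rshift m i) = bgroup_embed (1%g : bgroup m, bflip i).
  apply: bgroupP => [|k] /=; first by rewrite sym_embed1.
  rewrite !ffunE; move: k; apply: ord_sumP => k.
    by rewrite (unsplitK (inl _)) bgroup_one2 eq_lrshift.
  by rewrite (unsplitK (inr _)) ffunE (inj_eq (@rshift_inj _ _)).
rewrite ev_equiv block_signR /= (bigD1 i) //= big1 => [|k ki].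
  by rewrite ffunE eqxx mulr1 expr1 !repr_mx1 tprodZr tprod1 -scalemxAr mulmx1.
by rewrite ffunE (negbTE ki).
Qed.

(** Moving the sign change of i across [x] makes it the sign change of [x.1 i], an element of the
    inducing subgroup. So the evaluations diagonalise all tau_i, with joint eigenvalue the block
    pattern of [x]. *)
Lemma bip_flip i x : bip (bflip i) *m ev x = block_sign (x.1 i) *: ev x.
Proof.
rewrite ev_act -ev_bflip; congr ev; apply: bgroupP => [|k].
  by rewrite !bgroup_mul1 mul1g mulg1.
by rewrite !bgroup_mul2 !ffunE perm1 (inj_eq perm_inj) addbC.
Qed.

Lemma bip_sum_flips : \sum_i bip (bflip i) = (m%:R - s%:R)%:M.
Proof.
apply: ev_eq => x; rewrite mulmx_suml.
under eq_bigr => i _ do rewrite bip_flip.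
rewrite -scaler_suml mul_scalar_mx.
have -> : \sum_i block_sign (x.1 i) = \sum_i block_sign i.
  by rewrite [RHS](reindex_inj (@perm_inj _ x.1)).
congr (_ *: _); rewrite big_split_ord /=.
under eq_bigr => i _ do rewrite block_signL.
under [X in _ + X]eq_bigr => i _ do rewrite block_signR.
by rewrite sumrN !sumr_const !card_ord.
Qed.

Lemma block_perm_embed (z : 'S_n) : (forall i, block_sign (z i) = block_sign i) ->
  exists k : 'S_m * 'S_s, z = sym_embed k.
Proof.
move=> hz; have sgnE : (1 : F) != - 1.
  by rewrite -subr_eq0 opprK -(natrD _ 1 1) pnatr_eq0.
have /fin_all_exists[f fE] (i : 'I_m) : exists i' : 'I_m, z (lshift s i) = lshift s i'.
  have := hz (lshift s i); rewrite block_signL -[z _]splitK; case: (split _) => i' /=; first by exists i'.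
  by rewrite block_signR => /esym/eqP; rewrite (negbTE sgnE).
have /fin_all_exists[g gE] (i : 'I_s) : exists i' : 'I_s, z (rshift m i) = rshift m i'.
  have := hz (rshift m i); rewrite block_signR -[z _]splitK; case: (split _) => i' /=; last by exists i'.
  by rewrite block_signL => /eqP; rewrite (negbTE sgnE).
have f_inj : injective f.
  by move=> i j fij; apply/(@lshift_inj m s)/(@perm_inj _ z); rewrite !fE fij.
have g_inj : injective g.
  by move=> i j gij; apply/(@rshift_inj m s)/(@perm_inj _ z); rewrite !gE gij.
exists (perm f_inj, perm g_inj).
by apply/permP; apply: ord_sumP => i; rewrite ?sym_embedL ?sym_embedR ?fE ?gE permE.
Qed.

(** Distinct block patterns are separated by the tau_i, so an operator commuting with these
    preserves each joint eigenspace, on which [D] is a number. *)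
Lemma bip_diag_commute (Z D : 'M[F]_d) (dg : bgroup n -> F) :
  (forall x y, (forall i, block_sign (x.1 i) = block_sign (y.1 i)) -> dg x = dg y) ->
  (forall x, D *m ev x = dg x *: ev x) ->
  (forall i, Z *m bip (bflip i) = bip (bflip i) *m Z) -> Z *m D = D *m Z.
Proof.
move=> dE DE Ztau; apply: ev_eq => x; rewrite -!mulmxA DE -scalemxAr.
apply/eqP; rewrite -mul_scalar_mx -subr_eq0 -mulmxBl; apply/eqP.
pose A i := bip (bflip i) + (block_sign (x.1 i))%:M.
(* A nonzero multiple of the projection onto the joint eigenspace of the pattern of [x]: it kills
   every pattern that differs somewhere. *)
pose Pi := foldr (fun i M => A i *m M) 1%:M (enum 'I_n).
have PiE e (v : 'M_(_, e)) (a : 'I_n -> F) : (forall i, A i *m v = a i *: v) ->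
    Pi *m v = (\prod_(i <- enum 'I_n) a i) *: v.
  move=> Av; rewrite /Pi; elim: (enum _) => [|i r IH] /=; first by rewrite mul1mx big_nil scale1r.
  by rewrite -mulmxA IH -scalemxAr Av scalerA big_cons mulrC.
have PiZ : Pi *m (Z *m ev x) = (\prod_(i <- enum 'I_n) (block_sign (x.1 i) + block_sign (x.1 i))) *: (Z *m ev x).
  apply: (PiE _ _ (fun i => block_sign (x.1 i) + block_sign (x.1 i))) => i.
    rewrite mulmxDl mulmxA -Ztau -mulmxA bip_flip -scalemxAr mul_scalar_mx.
  by rewrite -scalerDl.
have pi0 : \prod_(i <- enum 'I_n) (block_sign (x.1 i) + block_sign (x.1 i)) != 0.
  rewrite prodf_seq_neq0; apply/allP => i _ /=.
  by rewrite -mulr2n -mulr_natr mulf_neq0 ?pnatr_eq0 // block_sign_neq0.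
have DPi : (dg x)%:M *m Pi = D *m Pi.
  apply: ev_eq => y; rewrite -!mulmxA.
  rewrite (PiE _ (ev y) (fun i => block_sign (y.1 i) + block_sign (x.1 i))) => [|i]; last first.
    by rewrite mulmxDl bip_flip mul_scalar_mx -scalerDl.
  rewrite -!scalemxAr DE mul_scalar_mx.
  have [/forallP xy|] := boolP [forall i, block_sign (x.1 i) == block_sign (y.1 i)].
    by rewrite (dE x y) // => i; apply/eqP.
  rewrite negb_forall => /existsP[i ne_i].
  rewrite (_ : \prod_(i0 <- _) _ = 0) ?scale0r //; apply/eqP.
  rewrite prodf_seq_eq0; apply/hasP; exists i; rewrite ?mem_enum //=.
  move: ne_i; rewrite /block_sign; do 2!case: split => _; rewrite ?eqxx // ?addNr ?subrr //.
have /eqP : (\prod_(i <- enum 'I_n) (block_sign (x.1 i) + block_sign (x.1 i))) *: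
    (((dg x)%:M - D) *m (Z *m ev x)) == 0.
  by rewrite scalemxAr -PiZ (mulmxA _ Pi) mulmxBl DPi subrr mul0mx.
move/eqP; rewrite scaler_eq0 (negbTE pi0) /= => /eqP.
by rewrite !mulmxBl => <-; rewrite ?mulmxA.
Qed.

Lemma ev_embed (x : bgroup n) (k : 'S_m * 'S_s) :
  ev (x * bperm (sym_embed k))%g = ev x *m tprod (rL k.1) (rR k.2).
Proof.
have -> : bperm (sym_embed k) = bgroup_embed (bperm k.1, bperm k.2).
  apply: bgroupP => [|i] /=; first by case: k.
  by rewrite !ffunE; case: split => j; rewrite ffunE.
rewrite ev_equiv /= big1 ?scale1r // => i _.
by rewrite ffunE.
Qed.

(** [c x] is the sign of the S_s component of x relative to a chosen representative of its coset x
    (S_m x S_s). *)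
Lemma sign_cocycle : exists c : 'S_n -> F,
  (forall p (k : 'S_m * 'S_s), c (p * sym_embed k)%g = c p * (-1) ^+ k.2) /\ (forall p, c p * c p = 1).
Proof.
pose in_coset (x y : 'S_n) := [exists k : 'S_m * 'S_s, x == (y * sym_embed k)%g].
pose r (x : 'S_n) := odflt 1%g [pick y | in_coset x y].
have rE (x : 'S_n) : exists k : 'S_m * 'S_s, x = (r x * sym_embed k)%g.
  rewrite /r; case: pickP => [y /existsP[k /eqP xE]|/(_ x)/existsP[]]; first by exists k.
  by exists (1%g, 1%g); rewrite sym_embed1 mulg1.
have rK' (x : 'S_n) (k : 'S_m * 'S_s) : r (x * sym_embed k)%g = r x.
  rewrite /r; congr odflt; apply: eq_pick => y; apply/existsP/existsP => -[k' /eqP e].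
    exists (k' * k^-1)%g; rewrite sym_embedM mulgA -e -mulgA -sym_embedM mulgV.
    by rewrite (_ : sym_embed 1%g = 1%g) ?mulg1 //; exact: sym_embed1.
  by exists (k' * k)%g; rewrite sym_embedM mulgA -e.
have /fin_all_exists[k kE] := rE.
exists (fun x : 'S_n => (-1) ^+ (k x).2); split=> [x h|x]; last by rewrite -expr2 sqrr_sign.
have : sym_embed (k (x * sym_embed h)%g) = sym_embed (k x * h)%g.
  by apply: (mulgI (r x)); rewrite -{1}(rK' x h) -kE sym_embedM mulgA -kE.
by move/sym_embed_inj => ->; rewrite odd_permM signr_addb.
Qed.

Section Twist.
Variables (c : 'S_n -> F) (sg : 'S_s -> F).
Hypothesis cK : forall p (k : 'S_m * 'S_s), c (p * sym_embed k)%g = c p * sg k.2.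
Hypothesis c2 : forall p, c p * c p = 1.

Lemma twist_sg2 (k : 'S_s) : sg k * sg k = 1.
Proof.
have := c2 (1 * sym_embed (1%g : 'S_m, k))%g.
by rewrite cK mulrACA c2 mul1r.
Qed.

(** Formally t_p conjugated by multiplication by c. That multiplication need not preserve
    equivariant functions, but in the product of two values of c the factor [sg] appears twice and
    cancels. Keeping [sg] general also covers the untwisted action. *)
Lemma twist_ex : exists sig : 'S_n -> 'M[F]_d,
  forall p x, sig p *m ev x = (c x.1 * c (p * x.1)%g) *: ev (bperm p * x)%g.
Proof.
have sig_ex p : exists M : 'M[F]_d,
    forall x, M *m ev x = (c x.1 * c (p * x.1)%g) *: ev (bperm p * x)%g.
  apply: ev_ex => x k; rewrite (mulgA (bperm p)) ev_equiv -scalemxAl; congr (_ *: _).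
  by rewrite !bgroup_mul1 mulgA !cK mulrACA twist_sg2 mulr1.
by have /fin_all_exists[sig sigE] := sig_ex; exists sig.
Qed.

Variable sig : 'S_n -> 'M[F]_d.
Hypothesis sigE : forall p x, sig p *m ev x = (c x.1 * c (p * x.1)%g) *: ev (bperm p * x)%g.

Lemma twist1 : sig 1%g = 1%:M.
Proof. by apply: ev_eq => x; rewrite sigE bperm1 !mul1g c2 scale1r mul1mx. Qed.

Lemma twistM p q : sig (p * q)%g = sig p *m sig q.
Proof.
apply: ev_eq => x; rewrite -mulmxA !sigE -scalemxAr sigE scalerA bpermM -!mulgA.
congr (_ *: _); rewrite !bgroup_mul1 /= mulrACA [c (q * x.1)%g * _]mulrC.
by rewrite mulrACA c2 mulr1 mulrC.
Qed.

Lemma twist_flip i p : bip (bflip i) *m sig p = sig p *m bip (bflip (p i)).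
Proof.
apply: ev_eq => x; rewrite -[LHS]mulmxA -[RHS]mulmxA sigE bip_flip -!scalemxAr sigE bip_flip.
by rewrite !scalerA mulrC bgroup_mul1 permM.
Qed.

(** The two actions of p differ by a diagonal operator. Its entries depend on the coset of [x.1]
    only, that is on the block pattern, so [bip_diag_commute] applies. *)
Lemma twist_commute_perm (Z : 'M[F]_d) p :
    (forall i, Z *m bip (bflip i) = bip (bflip i) *m Z) ->
    (forall p, Z *m sig p = sig p *m Z) ->
  Z *m bip (bperm p) = bip (bperm p) *m Z.
Proof.
move=> Zf Zs.
have [D DE] : exists D : 'M[F]_d,
    forall x, D *m ev x = (c x.1 * c (p * x.1)%g) *: ev x.
  apply: ev_ex => x k; rewrite ev_equiv -scalemxAl; congr (_ *: _).
  by rewrite !bgroup_mul1 mulgA !cK mulrACA twist_sg2 mulr1.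
have -> : bip (bperm p) = sig p *m D.
  apply: ev_eq => x; rewrite -mulmxA DE -scalemxAr sigE scalerA mulrACA !c2 mulr1 scale1r.
  exact: ev_act.
rewrite mulmxA Zs -[LHS]mulmxA -[RHS]mulmxA (bip_diag_commute _ DE) // => x y xy.
have [k kE] : exists k, (y.1^-1 * x.1)%g = sym_embed k.
  by apply: block_perm_embed => i; rewrite permM xy permKV.
by rewrite -(mulKVg y.1 x.1) kE mulgA !cK mulrACA twist_sg2 mulr1.
Qed.

(** A function on S_n is extended to W by the signs that the sign changes must produce; multiplying
    by c trades [rR'] for its [sg] twist [rR] and the translation action for [sig]. Evaluation at
    pure permutations gives back the function. *)
Lemma twist_intertwiner dR' (rR' : mx_representation F [set: 'S_s]%G dR') (Kc : 'M[F]_(dR', dR)) :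
    (forall (e : nat) (M : 'M_(e, _)), M *m Kc = 0 -> M = 0) ->
    (forall k : 'S_s, rR' k *m Kc = sg k *: (Kc *m rR k)) ->
  exists J, (forall (e : nat) (M : 'M_(e, _)), M *m J = 0 -> M = 0) /\
    (forall g, ind_repr (@sym_embed m s) (outer_repr rL rR') g *m J = J *m sig g).
Proof.
move=> Kinj Kequiv; pose evN := ind_eval (@sym_embed m s) (outer_repr rL rR').
(* The sign by which the flips of [x] act: each flipped i contributes the sign of the block
   containing [x.1 i]. *)
pose chi (x : bgroup n) : F := \prod_i (if x.2 i then block_sign (x.1 i) else 1).
have [J JE] : exists J : 'M_(_, d),
    forall x, J *m ev x = (c x.1 * chi x) *: (evN x.1 *m tprod (1%:M : 'M_dL) Kc).
  apply: ev_ex => x k.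
  have kE : (bgroup_embed k).1 = sym_embed (k.1.1, k.2.1) by [].
  have -> : chi (x * bgroup_embed k)%g = chi x * \prod_i (-1) ^+ k.2.2 i.
    rewrite /chi; have -> : \prod_i (-1) ^+ k.2.2 i =
        \prod_(i < m + s) (if (bgroup_embed k).2 i then block_sign i else 1) :> F.
      rewrite big_split_ord /= [X in _ = X * _]big1 ?mul1r => [|i _]; last first.
        by rewrite ffunE (unsplitK (inl _)) block_signL if_same.
      apply: eq_bigr => i _; rewrite ffunE (unsplitK (inr _)) block_signR.
      by case: (k.2.2 i).
    rewrite [X in _ * X](reindex_inj (@perm_inj _ x.1)) -big_split; apply: eq_bigr => i _.
    rewrite bgroup_mul2 permM kE block_sign_embed.
    by case: (x.2 i); case: ((bgroup_embed k).2 _); rewrite /= ?block_sign2 ?mulr1 ?mul1r.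
  rewrite bgroup_mul1 kE cK /evN ind_eval_equiv -mulmxA.
  have -> : outer_repr rL rR' (k.1.1, k.2.1) *m tprod (1%:M : 'M_dL) Kc =
            tprod (1%:M : 'M_dL) Kc *m (sg k.2.1 *: tprod (rL k.1.1) (rR k.2.1)).
    by rewrite -tprodZr /= -!tprodE mul1mx mulmx1 Kequiv scalemxAr.
  rewrite [outer_repr _ _ k]/= tprodZr -!scalemxAr -scalemxAl !scalerA mulmxA; congr (_ *: _).
  set P := \prod_(i < s) _; transitivity ((sg k.2.1 * sg k.2.1) * (P * (c x.1 * chi x))).
    by rewrite /=; ring.
  by rewrite twist_sg2 mul1r.
exists J; split=> [e M MJ0|g].
  apply: ind_eval_inj => x.
  have /eqP Mx : M *m (J *m ev (bperm x)) == 0 by rewrite mulmxA MJ0 mul0mx.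
  have chi1 : chi (bperm x) = 1 by apply: big1 => i _; rewrite ffunE.
  have Kfree : row_free Kc.
    by rewrite -kermx_eq0; apply/eqP/Kinj; rewrite mulmx_ker.
  have [K' KK'] := row_freeP Kfree.
  move: Mx; rewrite JE chi1 mulr1 -scalemxAr mulmxA => /eqP.
  rewrite scaler_eq0 => /orP[/eqP cx0|/eqP MK].
    by have := c2 x; rewrite [c x]cx0 mul0r => /eqP; rewrite eq_sym oner_eq0.
  have := congr1 (mulmx^~ (tprod (1%:M : 'M_dL) K')) MK.
  by rewrite /= -(mulmxA (M *m evN x)) -tprodE mulmx1 KK' tprod1 mulmx1 mul0mx.
apply: ev_eq => x; rewrite -[LHS]mulmxA -[RHS]mulmxA JE sigE -!scalemxAr JE !scalerA mulmxA ind_eval_act.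
congr (_ *: _); rewrite bgroup_mul1 /= mulrA -[_ * _ * c _]mulrA c2 mulr1; congr (_ * _).
rewrite [LHS](reindex_inj (@perm_inj _ g)); apply: eq_bigr => i _.
by rewrite bgroup_mul2 !ffunE addFb permM.
Qed.

End Twist.

Section SignTwist.
Variables (c : 'S_n -> F) (sig : 'S_n -> 'M[F]_d).
Hypothesis cK : forall p (k : 'S_m * 'S_s), c (p * sym_embed k)%g = c p * (-1) ^+ k.2.
Hypothesis c2 : forall p, c p * c p = 1.
Hypothesis sigE : forall p x, sig p *m ev x = (c x.1 * c (p * x.1)%g) *: ev (bperm p * x)%g.

Lemma sign_cocycle_tperm p i j : i != j -> block_sign (p i) = block_sign (p j) ->
  c p * c (tperm i j * p)%g = block_sign (p i).
Proof.
move=> ne_ij; rewrite [(tperm i j * p)%g]conjgC tpermJ.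
have : p i != p j by rewrite (inj_eq perm_inj).
move: (p i) (p j); apply: ord_sumP => a; apply: ord_sumP => b;
  rewrite ?block_signL ?block_signR => ne_ab e.
- have -> : tperm (lshift s a) (lshift s b) = sym_embed (tperm a b, 1%g : 'S_s).
    apply/permP; apply: ord_sumP => k; rewrite ?sym_embedL ?sym_embedR /=.
      by rewrite (inj_tperm _ _ _ (@lshift_inj m s)).
    by rewrite perm1 tpermD // eq_lrshift.
  by rewrite cK odd_perm1 mulr1 c2.
- by move/eqP: e; rewrite -subr_eq0 opprK -(natrD _ 1 1) pnatr_eq0.
- by move/eqP: e; rewrite eq_sym -subr_eq0 opprK -(natrD _ 1 1) pnatr_eq0.
have -> : tperm (rshift m a) (rshift m b) = sym_embed (1%g : 'S_m, tperm a b).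
  apply/permP; apply: ord_sumP => k; rewrite ?sym_embedL ?sym_embedR /=.
    by rewrite perm1 tpermD // eq_rlshift.
  by rewrite (inj_tperm _ _ _ (@rshift_inj m s)).
by rewrite cK odd_tperm -(inj_eq (@rshift_inj m s)) ne_ab mulrA c2 mul1r.
Qed.

(** At [x] both sides vanish if i and j go to different blocks; in a common block the two actions of
    the transposition differ exactly by the block sign. *)
Lemma twist_relation i j : i != j ->
  (1%:M + bip (bflip i) *m bip (bflip j)) *m sig (tperm i j) =
  (bip (bflip i) + bip (bflip j)) *m bip (bperm (tperm i j)).
Proof.
move=> ne_ij; apply: ev_eq => x; rewrite -[LHS]mulmxA -[RHS]mulmxA sigE bip_repr1.
rewrite -scalemxAr !mulmxDl mul1mx -mulmxA !bip_flip -scalemxAr bip_flip scalerA.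
rewrite bgroup_mul1 !permM /= tpermL tpermR -scalerDl -[X in X + _]scale1r -scalerDl scalerA.
congr (_ *: _); have [e|ne] := eqVneq (block_sign (x.1 i)) (block_sign (x.1 j)).
  by rewrite sign_cocycle_tperm // -e block_sign2 mulrDr mulr1.
move: ne; rewrite /block_sign; do 2!case: split => _; rewrite ?eqxx // => _; ring.
Qed.

End SignTwist.

Section Star.
Variables (kl q ks : F).
Hypothesis kl_neq0 : kl != 0.
Hypothesis starE : forall i, kl *: (\sum_(j | j != i) (bip (bperm (tperm j i)) *m bip (bflip i) +
    bip (bflip i) *m bip (bperm (tperm j i)))) = (2 * q) *: bip (bflip i) - (2 * ks)%:M.

(** Functions supported on the embedded subgroup split the evaluation at 1, which turns an operator
    identity into one between matrices of size dL * dR. *)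
Lemma ev1_ex : exists M : 'M_(dL * dR, d), M *m ev 1%g = 1%:M.
Proof.
have [M ME] : exists M : 'M_(dL * dR, d),
    forall x, M *m ev x = \sum_(k | bgroup_embed k == x) rK k.
  apply: ev_ex => x k; rewrite mulmx_suml (reindex_inj (mulIg k)).
  apply: eq_big => [k'|k' _]; first by rewrite bgroup_embedM (inj_eq (mulIg _)).
  by rewrite repr_mxM ?inE.
exists M; rewrite ME (big_pred1 1%g) ?repr_mx1 // => k.
have e1 : bgroup_embed (1%g : bgroup m * bgroup s) = 1%g.
  by apply: (mulgI (bgroup_embed 1%g)); rewrite -bgroup_embedM !mulg1.
by rewrite -e1 (inj_eq (@bgroup_embed_inj m s)).
Qed.

Lemma star_term i j : (bip (bperm (tperm j i)) *m bip (bflip i) +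
    bip (bflip i) *m bip (bperm (tperm j i))) *m ev 1%g =
  (block_sign i + block_sign j) *: ev (bperm (tperm j i)).
Proof.
rewrite mulmxDl -!mulmxA bip_flip bip_repr1 -scalemxAr bip_repr1 mulg1 bip_flip perm1.
by rewrite -scalerDl /= tpermR.
Qed.

Lemma tprod_entry e1 e2 (a b : 'I_e1) (u v : 'I_e2) :
  exists (R0 : 'rV[F]_(e1 * e2)) (C0 : 'cV[F]_(e1 * e2)),
    forall A B, (R0 *m tprod A B *m C0) 0 0 = A a b * B u v.
Proof.
exists (tprod (delta_mx 0 a : 'rV_e1) (delta_mx 0 u : 'rV_e2)).
exists (tprod (delta_mx b 0 : 'cV_e1) (delta_mx v 0 : 'cV_e2)) => A B.
transitivity ((tprod (delta_mx 0 a *m A *m delta_mx b 0 : 'M_1) (delta_mx 0 u *m B *m delta_mx v 0 : 'M_1) : 'M_1) 0 0).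
  rewrite (tprodE (delta_mx 0 a *m A) (delta_mx b 0) (delta_mx 0 u *m B) (delta_mx v 0)).
  by rewrite (tprodE (delta_mx 0 a) A (delta_mx 0 u) B).
by rewrite tprod11 -!rowE -!colE !mxE.
Qed.

(** At the identity a transposition across the blocks gets the factor 1 + (-1) = 0, and those inside
    the left block get 2. A diagonal entry of the right tensor factor, available since [dR] is
    positive, then isolates [rL]. *)
Lemma starL (i : 'I_m) : (0 < dR)%N ->
  kl *: \sum_(j | j != i) rL (tperm j i) = (q - ks)%:M.
Proof.
move=> dR_gt0; pose u := Ordinal dR_gt0.
have [M ME] := ev1_ex.
have E1 : kl *: (2 *: \sum_(j | j != i) tprod (rL (tperm j i)) (1%:M : 'M_dR)) = (2 * q - 2 * ks)%:M.
  have := congr1 (fun Z => M *m (Z *m ev 1%g)) (starE (lshift s i)).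
  rewrite /= mulmxBl -!scalemxAl bip_flip perm1 block_signL scale1r mul_scalar_mx -scalerBl.
  rewrite -!scalemxAr ME scalemx1 => <-; congr (_ *: _).
  rewrite mulmx_suml mulmx_sumr big_split_ord /= [X in _ = _ + X]big1 => [|j _]; last first.
    by rewrite star_term block_signL block_signR subrr scale0r mulmx0.
  rewrite addr0 scaler_sumr; apply: eq_big => [j|j _]; first by rewrite (inj_eq (@lshift_inj _ _)).
  rewrite star_term !block_signL; have -> : tperm (lshift s j) (lshift s i) = sym_embed (tperm j i, 1%g : 'S_s).
    apply/permP; apply: ord_sumP => k; rewrite ?sym_embedL ?sym_embedR /=.
      by rewrite (inj_tperm _ _ _ (@lshift_inj m s)).
    by rewrite perm1 tpermD // eq_lrshift.
  by rewrite -[bperm _]mul1g ev_embed -scalemxAr mulmxA ME mul1mx repr_mx1.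
apply/matrixP => a b; have [R0 [C0 RC]] := tprod_entry a b u u.
have phiZ z Z : (R0 *m (z *: Z) *m C0) 0 0 = z * (R0 *m Z *m C0) 0 0.
  by rewrite -scalemxAr -scalemxAl mxE.
have phi1 z : (R0 *m z%:M *m C0) 0 0 = z * (a == b)%:R.
  by rewrite -scalemx1 phiZ -tprod1 RC !mxE eqxx mulr1.
have := congr1 (fun Z => (R0 *m Z *m C0) 0 0) E1.
rewrite phi1 !phiZ mulmx_sumr mulmx_suml summxE.
under eq_bigr => j _ do rewrite RC [1%:M _ _]mxE eqxx mulr1.
move=> e; rewrite [RHS]mxE -mulr_natr mxE summxE; apply: (@mulfI _ (2 : F)); first by rewrite pnatr_eq0.
by rewrite mulrCA e mulrA mulrBr.
Qed.

Lemma starR (i : 'I_s) : (0 < dL)%N ->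
  kl *: \sum_(j | j != i) rR (tperm j i) = (q + ks)%:M.
Proof.
move=> dL_gt0; pose u := Ordinal dL_gt0.
have [M ME] := ev1_ex.
have E1 : kl *: (- 2 *: \sum_(j | j != i) tprod (1%:M : 'M_dL) (rR (tperm j i))) = (- (2 * q + 2 * ks))%:M.
  have := congr1 (fun Z => M *m (Z *m ev 1%g)) (starE (rshift m i)).
  rewrite /= mulmxBl -!scalemxAl bip_flip perm1 block_signR scalerA mulrN1 mul_scalar_mx -scalerBl.
  rewrite -!scalemxAr ME scalemx1 -opprD => <-; congr (_ *: _).
  rewrite mulmx_suml mulmx_sumr big_split_ord /= [X in _ = X + _]big1 => [|j _]; last first.
    by rewrite star_term block_signL block_signR addNr scale0r mulmx0.
  rewrite add0r scaler_sumr; apply: eq_big => [j|j _]; first by rewrite (inj_eq (@rshift_inj _ _)).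
  rewrite star_term !block_signR -opprD.
  have -> : tperm (rshift m j) (rshift m i) = sym_embed (1%g : 'S_m, tperm j i).
    apply/permP; apply: ord_sumP => k; rewrite ?sym_embedL ?sym_embedR /=.
      by rewrite perm1 tpermD // eq_rlshift.
    by rewrite (inj_tperm _ _ _ (@rshift_inj m s)).
  by rewrite -[bperm _]mul1g ev_embed -scalemxAr mulmxA ME mul1mx repr_mx1.
apply/matrixP => a b; have [R0 [C0 RC]] := tprod_entry u u a b.
have phiZ z Z : (R0 *m (z *: Z) *m C0) 0 0 = z * (R0 *m Z *m C0) 0 0.
  by rewrite -scalemxAr -scalemxAl mxE.
have phi1 z : (R0 *m z%:M *m C0) 0 0 = z * (a == b)%:R.
  by rewrite -scalemx1 phiZ -tprod1 RC !mxE eqxx mul1r.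
have := congr1 (fun Z => (R0 *m Z *m C0) 0 0) E1.
rewrite phi1 !phiZ mulmx_sumr mulmx_suml summxE.
under eq_bigr => j _ do rewrite RC [1%:M _ _]mxE eqxx mul1r.
move=> e; rewrite [RHS]mxE -mulr_natr mxE summxE; apply: (@mulfI _ (- 2 : F)); first by rewrite oppr_eq0 pnatr_eq0.
by rewrite mulrCA e; ring.
Qed.

End Star.

End BipartitionEval.

(** * Hecke relations between matrices *)

Lemma tperm_adjacent_ind n l (P : 'S_n -> Prop) :
  P 1%g -> (forall p q, P p -> P q -> P (p * q)%g) ->
  (forall i j : 'I_n, (l <= i)%N -> j = i.+1 :> nat -> P (tperm i j)) ->
  forall i j : 'I_n, (l <= i)%N -> (l <= j)%N -> P (tperm i j).
Proof.
move=> P1 PM Padj.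
have Plt (i j : 'I_n) : (l <= i)%N -> (i < j)%N -> P (tperm i j).
  move=> le_li; have [k] := ubnP (j - i); elim: k i j le_li => // k IHk i j le_li le_jik lt_ij.
  have [/eqP/esym eq_ij|ne_ij] := boolP (i.+1 == j :> nat); first exact: (Padj _ _ le_li eq_ij).
  have lt_j'n : (j.-1 < n)%N by apply: leq_ltn_trans (leq_pred j) _.
  pose j' := Ordinal lt_j'n; have j'E : j = j'.+1 :> nat by rewrite /= prednK //; case: (j : nat) lt_ij.
  have lt_ij' : (i < j')%N by rewrite ltn_neqAle -ltnS -j'E lt_ij -(eqn_add2r 1) !addn1 -j'E ne_ij.
  have <- : (tperm j' j * tperm i j' * tperm j' j)%g = tperm i j.
    rewrite -{1}[tperm j' j]tpermV -mulgA -conjgE tpermJ tpermL tpermD //.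
      by rewrite -val_eqE /= -?j'E gtn_eqF.
    by rewrite -val_eqE /= gtn_eqF.
  have le_j : (j' - i < k)%N by move: le_jik; rewrite ltnS j'E subSn // ltnW.
  have Pj : P (tperm j' j) by apply: (Padj _ _ _ j'E); apply: leq_trans le_li (ltnW lt_ij').
  exact: (PM _ _ (PM _ _ Pj (IHk _ _ le_li le_j lt_ij')) Pj).
move=> i j le_li le_lj; case: (ltngtP i j) => [/Plt|/Plt|/val_inj ->];
  rewrite ?tperm1 //; last by rewrite tpermC; apply.
by apply.
Qed.

Lemma mxeval_flip_commute (F : numFieldType) n d (x : 'I_n -> 'M[F]_d) (T : 'M[F]_d) (l : 'I_n) (c : F) f :
  (forall i j, x i *m x j = x j *m x i) ->
  (forall k, T *m x k = ((-1) ^+ (k == l) *: x k) *m T + (c * (k == l)%:R)%:M) ->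
  signed_subst (bflip l) f = f -> T *m mxeval x f = mxeval x f *m T.
Proof.
move=> xC Tx fl; have two0 : (2 : F) != 0 by rewrite pnatr_eq0.
apply: (@mxeval_cross F n d x T (bflip l) (2 *: 'X_l) c (fun k => (k == l)%:R)) => //.
- rewrite scaler_eq0 (negbTE two0) /=; apply/eqP => /(congr1 (meval (fun=> 1 : F))).
  by rewrite mevalXU meval0 => /eqP; rewrite oner_eq0.
- move=> k /=; rewrite ffunE perm1; case: (eqVneq k l) => [->|_].
    by rewrite expr1 scaleN1r opprK scale1r -mulr2n scaler_nat.
  by rewrite !scale1r subrr scale0r.
by move=> k /=; rewrite Tx ffunE perm1.
Qed.

Section HeckeMatrices.
Variables (F : numClosedFieldType) (n d : nat).
Variables (B : bgroup n -> 'M[F]_d) (E : 'I_n -> 'M[F]_d) (kl ks : F).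
Hypotheses (B1 : B 1%g = 1%:M) (BM : forall w x, B (w * x)%g = B w *m B x).
Local Notation t p := (B (bperm p)).
Local Notation tau i := (B (bflip i)).
Hypothesis EC : forall i j, E i *m E j = E j *m E i.
Hypothesis Ecross : forall (i j : 'I_n) k, j = i.+1 :> nat ->
  E k *m t (tperm i j) = t (tperm i j) *m E (tperm i j k) + (kl * ((k == i)%:R - (k == j)%:R))%:M.
Hypothesis Elast : forall l k : 'I_n, l.+1 = n ->
  E k *m tau l = tau l *m ((-1) ^+ (k == l) *: E k) + (2 * ks * (k == l)%:R)%:M.
Hypothesis Bschur : forall Z, (forall w, Z *m B w = B w *m Z) -> Z = 0 \/ Z \in unitmx.

Let t1 : t 1%g = 1%:M. Proof. by rewrite bperm1. Qed.
Let tM p q : t (p * q)%g = t p *m t q. Proof. by rewrite bpermM BM. Qed.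
Let tt i j : t (tperm i j) *m t (tperm i j) = 1%:M. Proof. by rewrite -tM tperm2 t1. Qed.
Let tautau i : tau i *m tau i = 1%:M. Proof. by rewrite -BM bflipM. Qed.
Let tauC i j : tau i *m tau j = tau j *m tau i. Proof. by rewrite -!BM bflipC. Qed.
Let tau_t i p : tau i *m t p = t p *m tau (p i). Proof. by rewrite -!BM bflip_perm. Qed.

Lemma commute_conj Z p i : Z *m t p = t p *m Z -> Z *m t p^-1%g = t p^-1%g *m Z ->
  Z *m tau i = tau i *m Z -> Z *m tau (p i) = tau (p i) *m Z.
Proof.
have tE : tau (p i) = t p^-1%g *m tau i *m t p.
  by rewrite -mulmxA tau_t mulmxA -tM mulVg t1 mul1mx.
by move=> Zp ZpV Zi; rewrite tE !mulmxA ZpV -!mulmxA -Zp (mulmxA Z) (mulmxA (tau i)) Zi -!mulmxA.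
Qed.

Lemma commute_adjacent Z :
  (forall i j : 'I_n, j = i.+1 :> nat -> Z *m t (tperm i j) = t (tperm i j) *m Z) ->
  (forall l : 'I_n, l.+1 = n -> Z *m tau l = tau l *m Z) ->
  forall w, Z *m B w = B w *m Z.
Proof.
move=> Zt Zl.
have Zp p : Z *m t p = t p *m Z.
  elim/perm_adjacent_ind: p => [|p q hp hq|i j ij]; [by rewrite t1 mulmx1 mul1mx | | exact: Zt].
  by rewrite tM mulmxA hp -!mulmxA hq.
elim/bgroup_ind => [//|i|w x hw hx]; last by rewrite BM mulmxA hw -!mulmxA hx.
have lt_l : (n.-1 < n)%N by rewrite prednK //; apply: leq_ltn_trans (ltn_ord i).
pose l := Ordinal lt_l; rewrite -(tpermL l i); apply: commute_conj => //.
by apply: Zl; rewrite /= prednK //; apply: leq_ltn_trans (ltn_ord i).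
Qed.

Lemma mxevalE_central (f : {mpoly F[n]}) : (forall w, signed_subst w f = f) ->
  forall w, mxeval E f *m B w = B w *m mxeval E f.
Proof.
move=> fW; apply: commute_adjacent => [i j ij|l ln].
  have ne_ij : i != j by rewrite -val_eqE /= ij ltn_eqF.
  symmetry; apply: (@mxeval_cross F n d E _ (bperm (tperm i j)) ('X_i - 'X_j) kl
     (fun k => (k == i)%:R - (k == j)%:R)) => //.
  - rewrite subr_eq0; apply: contraNneq ne_ij => /(congr1 (meval (fun k => (k == i)%:R : F))).
    by rewrite !mevalXU eqxx eq_sym; case: (i == j) => // /eqP; rewrite /= oner_eq0.
  - move=> k /=; rewrite ffunE scale1r; case: tpermP => [->|->|/eqP/negbTE-> /eqP/negbTE->].
    + by rewrite eqxx (negbTE ne_ij) subr0 scale1r.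
    + by rewrite eqxx eq_sym (negbTE ne_ij) sub0r scaleN1r opprB.
    + by rewrite !subrr scale0r.
  - have opp0 k : (tperm i j k == i)%:R - (tperm i j k == j)%:R + ((k == i)%:R - (k == j)%:R) = 0 :> F.
      case: tpermP => [->|->|/eqP/negbTE-> /eqP/negbTE->];
        rewrite ?eqxx ?[j == i]eq_sym ?(negbTE ne_ij); ring.
    move=> k /=; rewrite ffunE scale1r Ecross // tpermK -addrA -raddfD /= -mulrDr opp0.
    by rewrite mulr0 raddf0 addr0.
symmetry; apply: (@mxeval_flip_commute _ _ _ _ _ l (2 * ks)) => // k.
  have := Elast k ln; case: (k == l) => /= e; last first.
    by move: e; rewrite expr0 scale1r mulr0 raddf0 !addr0 => ->.
  by move: e; rewrite expr1 !scaleN1r mulr1 mulmxN mulNmx => ->; rewrite opprD opprK subrK.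
Qed.

Lemma central_eq Z c : (forall w, Z *m B w = B w *m Z) ->
  (Z - c%:M) \notin unitmx -> Z = c%:M.
Proof.
move=> ZB; have [|h|->//] := Bschur (Z := Z - c%:M).
  by move=> w; rewrite mulmxBl mulmxBr ZB scalar_mxC.
by move=> _; apply/eqP; rewrite -subr_eq0 h.
Qed.

Lemma central_scalar Z : (0 < d)%N -> (forall w, Z *m B w = B w *m Z) -> exists c, Z = c%:M.
Proof.
move=> d_gt0 ZB.
have : exists c, eigenvalue Z c.
  have /closed_rootP[c cE] : size (char_poly Z) != 1%N by rewrite size_char_poly eqSS -lt0n.
  by exists c; rewrite eigenvalue_root_char.
case=> c /eigenvalueP[v vZ v0]; exists c; apply: central_eq => //.
apply: contra v0 => Zu; apply/eqP; rewrite -(mulmxK Zu v) mulmxBr vZ scalar_mxC mul_scalar_mx.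
by rewrite subrr mul0mx.
Qed.

Definition flip_all : bgroup n := (1%g, [ffun => true]).

Lemma flip_all_central w : (flip_all * w)%g = (w * flip_all)%g.
Proof.
apply: bgroupP => [|i]; first by rewrite !bgroup_mul1 mul1g mulg1.
by rewrite !bgroup_mul2 !ffunE perm1 addbC.
Qed.

Lemma B_flip_all : exists2 e : F, B flip_all = e%:M & e != 0.
Proof.
have wC w : B flip_all *m B w = B w *m B flip_all by rewrite -!BM flip_all_central.
have ww : B flip_all *m B flip_all = 1%:M.
  rewrite -BM (_ : (_ * _)%g = 1%g) //; apply: bgroupP => [|i]; first by rewrite bgroup_mul1 mulg1.
  by rewrite bgroup_mul2 !ffunE.
have [|h|u] := Bschur (Z := B flip_all - 1%:M).
- by move=> w; rewrite mulmxBl mulmxBr wC mul1mx mulmx1.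
- by exists 1; rewrite ?oner_eq0 //; apply/eqP; rewrite -subr_eq0 h.
exists (- 1); last by rewrite oppr_eq0 oner_eq0.
have /(canRL (mulKmx u)) : (B flip_all - 1%:M) *m (B flip_all + 1%:M) = 0.
  by rewrite mulmxBl mul1mx mulmxDr ww mulmx1 [1%:M + _]addrC subrr.
by rewrite mulmx0 => /eqP; rewrite addr_eq0 => /eqP ->; rewrite raddfN.
Qed.

Section FirstIndex.
Variable i0 : 'I_n.
Hypothesis i0E : i0 = 0%N :> nat.

Lemma E0_t i j : i != i0 -> j != i0 -> E i0 *m t (tperm i j) = t (tperm i j) *m E i0.
Proof.
rewrite -!val_eqE /= i0E -!lt0n; move: i j.
apply: (@tperm_adjacent_ind n 1 (fun p => E i0 *m t p = t p *m E i0)) => [|p q hp hq|i j gt_i ij].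
- by rewrite t1 mulmx1 mul1mx.
- by rewrite tM mulmxA hp -!mulmxA hq.
have ne_i : (i0 == i) = false by rewrite -val_eqE /= i0E ltn_eqF.
have ne_j : (i0 == j) = false by rewrite -val_eqE /= i0E ij.
by rewrite Ecross // ne_i ne_j subrr mulr0 raddf0 addr0 tpermD // eq_sym ?ne_i ?ne_j.
Qed.

(** The cross relation of the last sign change leaves E_1 alone when n > 1, and [E0_t] allows
    conjugation by the transposition of the last index and k. *)
Lemma E0_tau_neq k : k != i0 -> E i0 *m tau k = tau k *m E i0.
Proof.
move=> ne_k; have n_gt0 : (0 < n)%N by apply: leq_ltn_trans (ltn_ord i0).
have lt_l : (n.-1 < n)%N by rewrite prednK.
pose l := Ordinal lt_l; have lE : l.+1 = n by rewrite /= prednK.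
have ne_l : l != i0.
  rewrite -val_eqE /= i0E -lt0n; have := ltn_ord k; move: ne_k; rewrite -val_eqE /= i0E; lia.
have tlk := E0_t ne_l ne_k.
rewrite -(tpermL l k); apply: commute_conj; rewrite ?tpermV //.
by rewrite Elast // [i0 == l]eq_sym (negbTE ne_l) mulr0 raddf0 addr0 scale1r.
Qed.

(* The longest element is -1, hence central, so it acts by a scalar and tau i0 is
   a multiple of the product of the other tau k. *)
Lemma E0_tau k : E i0 *m tau k = tau k *m E i0.
Proof.
have [->|/E0_tau_neq //] := eqVneq k i0.
pose w : bgroup n := (1%g, [ffun j => j != i0]).
have Ew : E i0 *m B w = B w *m E i0.
  rewrite (bgroup_decomp w) bperm1 mulg1.
  apply: (big_ind (fun g => E i0 *m B g = B g *m E i0)) => [|x y hx hy|j].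
  - by rewrite B1 mulmx1 mul1mx.
  - by rewrite BM mulmxA hx -!mulmxA hy.
  by rewrite ffunE; apply: E0_tau_neq.
have [e eE e0] := B_flip_all.
have tauE : tau i0 *m B w = e%:M.
  rewrite -eE -BM; congr B; apply: bgroupP => [|j]; first by rewrite bgroup_mul1 mulg1.
  by rewrite bgroup_mul2 !ffunE perm1; case: (j == i0).
have {}tauE : tau i0 = e *: B w.
  have ww : B w *m B w = 1%:M.
    rewrite -BM (_ : (_ * _)%g = 1%g) //; apply: bgroupP => [|j]; first by rewrite bgroup_mul1 mulg1.
    by rewrite bgroup_mul2 !ffunE perm1 addbb.
  by rewrite -[LHS]mulmx1 -ww mulmxA tauE mul_scalar_mx.
by rewrite tauE -scalemxAr -scalemxAl Ew.
Qed.

Let g i := t (tperm i0 i) *m E i0 *m t (tperm i0 i).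

Let g0 : g i0 = E i0. Proof. by rewrite /g tperm1 t1 mul1mx mulmx1. Qed.

Let g_tau i k : g i *m tau k = tau k *m g i.
Proof.
rewrite /g (mulmxA (tau k)) (mulmxA (tau k)) tau_t -!mulmxA; congr (_ *m _).
rewrite (mulmxA (tau _)) -E0_tau -!mulmxA tau_t; congr (_ *m (_ *m tau _)).
by rewrite tpermK.
Qed.

Let g_conj j k : j != i0 -> k != i0 -> j != k ->
  t (tperm i0 j) *m g k *m t (tperm i0 j) = g k.
Proof.
move=> j0 k0 jk; have pE : (tperm i0 j * tperm i0 k = tperm i0 k * tperm j k)%g.
  by rewrite (conjgC (tperm i0 j)) tpermJ tpermL tpermD // 1?eq_sym // tpermC [tperm k j]tpermC.
have pE' : (tperm i0 k * tperm i0 j = tperm j k * tperm i0 k)%g.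
  by apply: invg_inj; rewrite !invMg !tpermV pE.
have -> : t (tperm i0 j) *m g k *m t (tperm i0 j) =
    t (tperm i0 j * tperm i0 k)%g *m E i0 *m t (tperm i0 k * tperm i0 j)%g by rewrite !tM /g !mulmxA.
rewrite pE pE' !tM -!mulmxA (mulmxA (E i0)) E0_t // -mulmxA.
by rewrite (mulmxA (t (tperm j k)) (t (tperm j k))) tt mul1mx /g -mulmxA.
Qed.

Hypothesis kl_neq0 : kl != 0.

(* The commutator of E i0 and g i1 is kl (E i0 - g i1) t for t the action of
   (i0 i1), and it commutes with tau i0. *)
Let g_relation j : j != i0 -> (E i0 - g j) *m (tau i0 - tau j) = 0.
Proof.
move=> j0; have lt1 : (1 < n)%N.
  by apply: leq_ltn_trans (ltn_ord j); move: j0; rewrite -val_eqE /= i0E -lt0n.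
pose i1 : 'I_n := Ordinal lt1; have i1E : i1 = i0.+1 :> nat by rewrite i0E.
have ne10 : i1 != i0 by rewrite -val_eqE /= i0E.
have R1 : (E i0 - g i1) *m (tau i0 - tau i1) = 0.
  set T := t (tperm i0 i1); have TT : T *m T = 1%:M by exact: tt.
  have gT : g i1 *m T = T *m E i0 by rewrite /g -!mulmxA TT mulmx1.
  have E1 : E i1 = g i1 - kl *: T.
    have := Ecross i0 i1E; rewrite eqxx [i0 == i1]eq_sym (negbTE ne10) subr0 mulr1 tpermL -/T.
    move/(congr1 (mulmx T)); rewrite mulmxDr (mulmxA T T) TT mul1mx scalar_mxC mul_scalar_mx mulmxA.
    by move/esym/(canRL (addrK _)) ->.
  have comm : E i0 *m g i1 - g i1 *m E i0 = kl *: ((E i0 - g i1) *m T).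
    have := EC i0 i1; rewrite E1 mulmxBr mulmxBl -scalemxAr -scalemxAl -gT => /(canRL (subrK _)) ->.
    by rewrite mulmxBl scalerBr -(addrA (g i1 *m E i0)) [_ *m _ + _]addrC addrK addrC.
  have hT : kl *: ((E i0 - g i1) *m T) *m tau i0 = tau i0 *m (kl *: ((E i0 - g i1) *m T)).
    rewrite -comm mulmxBl mulmxBr -(mulmxA (E i0)) g_tau (mulmxA (E i0)) E0_tau -(mulmxA (tau i0)).
    by rewrite -(mulmxA (g i1)) E0_tau (mulmxA (g i1)) g_tau -(mulmxA (tau i0)).
  (* Moving tau across T changes its index, so commutation of [(E i0 - g i1) T] with [tau i0]
     becomes the stated product relation times T. *)
  have tT : T *m tau i0 = tau i1 *m T by rewrite tau_t tpermR.
  move/eqP: hT; rewrite -scalemxAl -scalemxAr (inj_eq (scalerI kl_neq0)) => /eqP.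
  rewrite -mulmxA tT !mulmxA [tau i0 *m _]mulmxBr -E0_tau -g_tau -mulmxBl => /(congr1 (mulmx^~ T)).
  by rewrite /= -!(mulmxA _ T T) TT !mulmx1 mulmxBr => ->; rewrite subrr.
have [->//|j1] := eqVneq j i1.
pose T := t (tperm i1 j); have TT : T *m T = 1%:M by exact: tt.
have := congr1 (fun Z => T *m Z *m T) R1; rewrite /= mulmx0 mul0mx.
have -> : T *m ((E i0 - g i1) *m (tau i0 - tau i1)) *m T =
   (T *m (E i0 - g i1) *m T) *m (T *m (tau i0 - tau i1) *m T).
  by rewrite !mulmxA -[_ *m T *m T]mulmxA TT mulmx1.
have tauT k : T *m tau k *m T = tau (tperm i1 j k).
  by rewrite -[LHS]mulmxA tau_t mulmxA TT mul1mx.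
have ET : T *m E i0 = E i0 *m T by rewrite E0_t.
have gT : T *m g i1 *m T = g j.
  have pE : (tperm i1 j * tperm i0 i1 = tperm i0 j * tperm i1 j)%g.
    by rewrite (conjgCV (tperm i1 j)) tpermV tpermJ tpermL tpermD // eq_sym.
  have pE' : (tperm i0 i1 * tperm i1 j = tperm i1 j * tperm i0 j)%g.
    by apply: invg_inj; rewrite !invMg !tpermV pE.
  have -> : T *m g i1 *m T = t (tperm i1 j * tperm i0 i1)%g *m E i0 *m t (tperm i0 i1 * tperm i1 j)%g.
    by rewrite !tM /g !mulmxA.
  rewrite pE pE' !tM -/T -!mulmxA (mulmxA T (E i0)) ET -!mulmxA (mulmxA T T) TT mul1mx.
  by rewrite /g -mulmxA.
by rewrite !(mulmxBr T) !(mulmxBl _ _ T) gT ET -[E i0 *m T *m T]mulmxA TT mulmx1 !tauT tpermL tpermD.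
Qed.

Let g_relation2 j k : j != i0 -> k != i0 -> j != k -> (g j - g k) *m (tau j - tau k) = 0.
Proof.
move=> j0 k0 jk; pose T := t (tperm i0 j); have TT : T *m T = 1%:M by exact: tt.
have := congr1 (fun Z => T *m Z *m T) (g_relation k0); rewrite /= mulmx0 mul0mx => <-.
have -> : T *m ((E i0 - g k) *m (tau i0 - tau k)) *m T =
   (T *m (E i0 - g k) *m T) *m (T *m (tau i0 - tau k) *m T).
  by rewrite !mulmxA -[_ *m T *m T]mulmxA TT mulmx1.
have tauT i : T *m tau i *m T = tau (tperm i0 j i).
  by rewrite -[LHS]mulmxA tau_t mulmxA TT mul1mx.
by rewrite !(mulmxBr T) !(mulmxBl _ _ T) g_conj // !tauT tpermL tpermD // eq_sym.
Qed.

Variable a : F.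
Hypothesis sum_tau : \sum_i tau i = a%:M.
Hypothesis a_neq : a ^+ 2 != n%:R ^+ 2.

(* By the relations above (E i0 - g j) tau k does not depend on k; summing over k
   multiplies E i0 - g j by a and by n tau i0, and a <> n, - n. *)
Let g_const j : g j = E i0.
Proof.
have [->|j0] := eqVneq j i0; first exact: g0.
pose h := E i0 - g j.
suff h0 : h = 0 by apply/esym/eqP; rewrite -subr_eq0 -/h h0.
have Rj := g_relation j0.
have htau0 k : h *m tau k = h *m tau i0.
  have [->//|k0] := eqVneq k i0.
  have hj : h *m tau j = h *m tau i0.
    by move/eqP: Rj; rewrite mulmxBr subr_eq0 => /eqP ->.
  have [->//|kj] := eqVneq k j.
  (* Here h = u - v. Right multiplication by [tau i0 *m tau j] fixes u - v and u + v, hence v after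
     halving; so [tau i0] and [tau j] agree on v. *)
  pose u := E i0 - g k; pose v := g j - g k.
  have huv : h = u - v by rewrite /u /v opprB addrA subrK.
  have uk : u *m tau i0 = u *m tau k.
    by have /eqP := g_relation k0; rewrite mulmxBr subr_eq0 => /eqP.
  have vk : v *m tau j = v *m tau k.
    by have /eqP := g_relation2 j0 k0 (contra_neq esym kj); rewrite mulmxBr subr_eq0 => /eqP.
  clearbody h u v.
  have u1 : u *m tau i0 *m tau k = u by rewrite -mulmxA tauC mulmxA -uk -mulmxA tautau mulmx1.
  have v1 : v *m tau j *m tau k = v by rewrite -mulmxA tauC mulmxA -vk -mulmxA tautau mulmx1.
  have e1 : h *m tau i0 *m tau j = h by rewrite -hj -mulmxA tautau mulmx1.
  have e2 : (u + v) *m tau i0 *m tau j = u + v.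
    have := congr1 (mulmx^~ (tau k)) hj; rewrite /= huv !mulmxBl u1 v1.
    rewrite -[v *m tau i0 *m tau k]mulmxA tauC mulmxA -vk -[v *m tau j *m tau i0]mulmxA [tau j *m _]tauC mulmxA.
    rewrite -[u *m tau j *m tau k]mulmxA [tau j *m _]tauC mulmxA -uk.
    move=> /eqP; rewrite subr_eq addrAC eq_sym subr_eq => /eqP e.
    by rewrite !mulmxDl e addrC.
  have e3 : v *m tau i0 *m tau j = v.
    have two0 : (2 : F) != 0 by rewrite pnatr_eq0.
    apply: (scalerI two0); rewrite !scalemxAl.
    have -> : 2 *: v = (u + v) - h by rewrite huv opprB addrC addrA subrK scaler_nat mulr2n.
    by rewrite (mulmxBl _ h) (mulmxBl _ (h *m _)) e1 e2.
  have vj : v *m tau j = v *m tau i0.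
    by rewrite -{1}e3 -mulmxA tautau mulmx1.
  by rewrite huv !mulmxBl -uk -vk vj.
have n0 : (n%:R : F) != 0.
  by rewrite pnatr_eq0 -lt0n; apply: leq_ltn_trans (ltn_ord j).
have hS : a *: h = n%:R *: (h *m tau i0).
  rewrite -mul_mx_scalar -sum_tau mulmx_sumr (eq_bigr _ (fun k _ => htau0 k)).
  by rewrite sumr_const card_ord scaler_nat.
have hS2 : (a ^+ 2) *: h = (n%:R ^+ 2) *: h.
  have := congr1 (fun Z => n%:R *: (Z *m tau i0)) hS.
  by rewrite /= -!scalemxAl -mulmxA tautau mulmx1 !scalerA [n%:R * a]mulrC -(scalerA a) -hS scalerA -!expr2.
by move/eqP: hS2; rewrite -subr_eq0 -scalerBl scaler_eq0 subr_eq0 (negbTE a_neq) => /eqP.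
Qed.

Lemma E0_scalar : (0 < d)%N -> exists q, E i0 = q%:M.
Proof.
move=> d_gt0; apply: central_scalar => //; apply: commute_adjacent => [i j _|l _]; last exact: E0_tau.
have E0j k : E i0 *m t (tperm i0 k) = t (tperm i0 k) *m E i0.
  by have := g_const k; rewrite /g => /(congr1 (mulmx^~ (t (tperm i0 k)))) /=; rewrite -!mulmxA tt mulmx1.
have [->|ni] := eqVneq i i0; first exact: E0j.
have [->|nj] := eqVneq j i0; first by rewrite tpermC.
exact: E0_t.
Qed.

(** The cross relation gives E_(k+1) = T E_k T - kl T, the recursion of Jucys-Murphy elements scaled
    by -kl. *)
Lemma E_jm q k : E i0 = q%:M -> E k = q%:M + (- kl) *: jm (fun p => t p) 1%g k.
Proof.
move=> E0q; have [m] := ubnP (k : nat); elim: m k => // m IH k; rewrite ltnS => le_km.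
have [k0|k_gt0] := posnP k.
  have -> : k = i0 by apply: val_inj; rewrite /= k0 i0E.
  by rewrite E0q /jm big1 ?scaler0 ?addr0 // => j; rewrite !perm1 i0E.
have lt_k' : (k.-1 < n)%N by apply: leq_ltn_trans (leq_pred k) _.
pose k' := Ordinal lt_k'; have kE : k = k'.+1 :> nat by rewrite /= prednK.
have ne_k : k' != k by rewrite -(inj_eq val_inj) [val k]kE ltn_eqF.
have TT := tt k' k.
have := Ecross k' kE; rewrite eqxx (negbTE ne_k) subr0 mulr1 tpermL.
move/(congr1 (mulmx (t (tperm k' k)))); rewrite mulmxDr mulmxA mulmxA TT mul1mx scalar_mxC mul_scalar_mx.
move/esym/(canRL (addrK _)) ->; rewrite (IH k') ?(leq_trans _ le_km) //=; last by rewrite prednK.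
rewrite (jm_adjacent (r := fun p => t p) t1 tM (o := 1%g) (i := k') (j := k)) ?perm1 //.
rewrite mulmxDr mulmxDl scalar_mxC -(mulmxA q%:M) TT mulmx1 -scalemxAr -scalemxAl scalerDr.
by rewrite -addrA; congr (_ + (_ + _)); rewrite scaleNr.
Qed.

End FirstIndex.

End HeckeMatrices.

(** * Consequences of the short root relation for affine Jucys-Murphy elements *)

Section StarRelation.
Variables (F : numFieldType) (n d : nat).
Variables (B : bgroup n -> 'M[F]_d) (E : 'I_n -> 'M[F]_d) (kl ks q : F).
Hypotheses (B1 : B 1%g = 1%:M) (BM : forall w x, B (w * x)%g = B w *m B x).
Local Notation t p := (B (bperm p)).
Local Notation tau i := (B (bflip i)).
Hypothesis Elast : forall l k : 'I_n, l.+1 = n ->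
  E k *m tau l = tau l *m ((-1) ^+ (k == l) *: E k) + (2 * ks * (k == l)%:R)%:M.
Hypothesis E_jm : forall k, E k = q%:M + (- kl) *: jm (fun p => t p) 1%g k.

Lemma last_ordinal (i : 'I_n) : exists l : 'I_n, l.+1 = n.
Proof.
have n_gt0 : (0 < n)%N by apply: leq_ltn_trans (ltn_ord i).
have lt_l : (n.-1 < n)%N by rewrite prednK.
by exists (Ordinal lt_l); rewrite /= prednK.
Qed.

Lemma jm_last (r : 'S_n -> 'M[F]_d) (l : 'I_n) : l.+1 = n ->
  jm r 1%g l = \sum_(j | j != l) r (tperm j l).
Proof.
move=> ln; apply: eq_bigl => j; rewrite !perm1 ltn_neqAle.
by rewrite -(inj_eq val_inj) -ltnS ln ltn_ord andbT.
Qed.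

(** For the last index the Jucys-Murphy element is the full star sum, and the relation is the short
    cross relation E_l tau_l + tau_l E_l = 2 ks; conjugation by (i l) moves it to any i. *)
Lemma star_relation i : kl *: (\sum_(j | j != i) (t (tperm j i) *m tau i + tau i *m t (tperm j i))) =
  (2 * q) *: tau i - (2 * ks)%:M.
Proof.
have [l ln] := last_ordinal i.
have starl : kl *: (\sum_(j | j != l) (t (tperm j l) *m tau l + tau l *m t (tperm j l))) =
    (2 * q) *: tau l - (2 * ks)%:M.
  have : E l *m tau l + tau l *m E l = (2 * ks)%:M.
    by rewrite Elast // eqxx expr1 scaleN1r mulr1 mulmxN addrAC addNr add0r.
  rewrite E_jm mulmxDl mulmxDr mul_scalar_mx mul_mx_scalar -scalemxAr -scalemxAl.
  rewrite addrACA -!scalerDr -mulr2n -scaler_nat scalerA mulrC (jm_last _ ln) mulmx_suml mulmx_sumr -big_split.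
  by move=> <-; rewrite opprD addNKr scaleNr opprK.
pose T := t (tperm i l).
have TT : T *m T = 1%:M by rewrite -BM -bpermM tperm2 bperm1.
have tauT k : T *m tau k *m T = tau (tperm i l k).
  by rewrite -[LHS]mulmxA -BM bflip_perm BM mulmxA TT mul1mx.
have tT j : T *m t (tperm j l) *m T = t (tperm (tperm i l j) i).
  by rewrite -!BM -!bpermM -{1}[tperm i l]tpermV -mulgA -conjgE tpermJ tpermR.
have conjM X Y : T *m (X *m Y) *m T = (T *m X *m T) *m (T *m Y *m T).
  by rewrite !mulmxA -[_ *m T *m T]mulmxA TT mulmx1.
have := congr1 (fun Z => T *m Z *m T) starl.
rewrite /= mulmxBr mulmxBl -!scalemxAr -!scalemxAl tauT tpermR scalar_mxC -(mulmxA (2 * ks)%:M) TT mulmx1 => <-.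
congr (_ *: _); rewrite mulmx_sumr mulmx_suml (reindex_inj (@perm_inj _ (tperm i l))).
apply: eq_big => [j|j _].
  by rewrite (canF_eq (tpermK i l)) tpermL.
by rewrite mulmxDr mulmxDl !conjM tauT tT tpermR.
Qed.

Section TwistedContents.
Variable sig : 'S_n -> 'M[F]_d.
Hypothesis tau_sig : forall i p, tau i *m sig p = sig p *m tau (p i).
Hypothesis sig_rel : forall i j, i != j -> (1%:M + tau i *m tau j) *m sig (tperm i j) =
  (tau i + tau j) *m t (tperm i j).
Let L k := ks%:M + kl *: jm sig 1%g k.

(** A short root cross relation in which q and ks have exchanged roles: [sig_rel] converts the
    anticommutator of [tau l] with the twisted star sum into the sum evaluated by
    [star_relation]. *)
Lemma tau_twisted_content (l k : 'I_n) : l.+1 = n ->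
  tau l *m L k = ((-1) ^+ (k == l) *: L k) *m tau l + (2 * q * (k == l)%:R)%:M.
Proof.
move=> ln; have [->|ne] := eqVneq k l; last first.
  rewrite expr0 scale1r mulr0 raddf0 addr0 mulmxDr mulmxDl scalar_mxC -scalemxAl -scalemxAr.
  congr (_ + _ *: _); rewrite mulmx_sumr mulmx_suml; apply: eq_bigr => j; rewrite !perm1 => lt_jk.
  have lt_kl : (k < l)%N.
    by have := ltn_ord k; move: ne ln; rewrite -(inj_eq val_inj) /=; lia.
  have jl : j != l by rewrite -(inj_eq val_inj) neq_ltn [(_ < _)%N](ltn_trans lt_jk lt_kl).
  by rewrite tau_sig tpermD.
have tautau : tau l *m tau l = 1%:M by rewrite -BM bflipM.
have key j : j != l -> tau l *m sig (tperm j l) + sig (tperm j l) *m tau l =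
    tau l *m (t (tperm j l) *m tau l + tau l *m t (tperm j l)).
  move=> jl; have -> : sig (tperm j l) *m tau l = tau j *m sig (tperm j l).
    by rewrite tau_sig tpermL.
  have -> : t (tperm j l) *m tau l = tau j *m t (tperm j l) by rewrite -!BM bflip_perm tpermL.
  have lj : l != j by rewrite eq_sym.
  rewrite [tau j *m t _ + _]addrC -(mulmxDl (tau l) (tau j) (t _)) tpermC -(sig_rel lj).
  by rewrite mulmxA mulmxDr mulmx1 mulmxA tautau mul1mx mulmxDl.
rewrite expr1 scaleN1r mulr1 mulNmx; apply/eqP; rewrite addrC -subr_eq opprK; apply/eqP.
rewrite mulmxDr mulmxDl scalar_mxC -scalemxAl -scalemxAr addrACA -scalerDr (jm_last _ ln).
rewrite mulmx_sumr mulmx_suml -big_split (eq_bigr _ key) /= -mulmx_sumr scalemxAr star_relation.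
rewrite mulmxBr -scalemxAr tautau !mul_scalar_mx !mul_mx_scalar -scalerDl.
by rewrite -mulr2n -[ks *+ 2]mulr_natl addrC subrK scalemx1.
Qed.

End TwistedContents.
End StarRelation.

(** * The central character of a one W-type *)

Lemma hom_dim_ex (F : fieldType) (gT : finGroupType) d1 d2
    (r1 : mx_representation F [set: gT]%G d1) (r2 : mx_representation F [set: gT]%G d2) :
  hom_dim r1 r2 <> 0%N -> exists2 A : 'M_(d1, d2), A <> 0 & forall g, r1 g *m A = A *m r2 g.
Proof.
rewrite /hom_dim; set M := (\bigcap_(g : gT) _)%MS => rM0.
have M0 : M != 0 by apply: contra_notN rM0 => /eqP->; rewrite mxrank0.
have /sub_bigcapmxP hM : (nz_row M <= M)%MS by exact: nz_row_sub.
exists (vec_mx (nz_row M)) => [|g].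
  by move/(congr1 mxvec); rewrite vec_mxK linear0; apply/eqP; rewrite nz_row_eq0.
have /sub_kermxP := hM g isT; rewrite -[nz_row M]vec_mxK mulmxBr !mul_vec_lin /= => /eqP.
by rewrite subr_eq0 => /eqP/(can_inj mxvecK); rewrite vec_mxK.
Qed.

Lemma intertwiner_comp (F : fieldType) (T : Type) d1 d2 d3 (r1 : T -> 'M[F]_d1) (r2 : T -> 'M[F]_d2)
    (r3 : T -> 'M[F]_d3) (A : 'M_(d1, d2)) (J : 'M_(d2, d3)) :
  (forall g, r1 g *m A = A *m r2 g) -> (forall g, r2 g *m J = J *m r3 g) ->
  forall g, r1 g *m (A *m J) = A *m J *m r3 g.
Proof. by move=> rA rJ g; rewrite mulmxA rA -!mulmxA rJ. Qed.

Section Intertwiner.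
Variables (F : fieldType) (n d e : nat) (r : 'S_n -> 'M[F]_d) (r' : 'S_n -> 'M[F]_e).
Variables (J : 'M[F]_(d, e)) (q c : F) (f : {mpoly F[n]}).
Hypothesis rJ : forall g, r g *m J = J *m r' g.

Lemma mxeval_jm_intertwine :
  mxeval (fun k => q%:M + c *: jm r 1%g k) f *m J = J *m mxeval (fun k => q%:M + c *: jm r' 1%g k) f.
Proof.
apply: mxeval_intertwine => k; rewrite mulmxDl mulmxDr scalar_mxC -scalemxAl -scalemxAr.
by congr (_ + _ *: _); rewrite mulmx_suml mulmx_sumr; apply: eq_bigr => j _.
Qed.

Lemma mxeval_jm_scalar al : (forall e (M : 'M_(e, d)), M *m J = 0 -> M = 0) ->
  mxeval (fun k => q%:M + c *: jm r' 1%g k) f = al%:M ->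
  mxeval (fun k => q%:M + c *: jm r 1%g k) f = al%:M.
Proof.
move=> Jinj e1; apply/eqP; rewrite -subr_eq0; apply/eqP/Jinj.
by rewrite mulmxBl mxeval_jm_intertwine e1 scalar_mxC subrr.
Qed.
End Intertwiner.

Lemma mxeval_eq (F : fieldType) n d (x y : 'I_n -> 'M[F]_d) f : x =1 y -> mxeval x f = mxeval y f.
Proof.
by move=> xy; apply: eq_bigr => M _; congr (_ *: _); apply: eq_bigr => i _; rewrite xy.
Qed.

Lemma mxeval_scalars (F : fieldType) n d (c : 'I_n -> F) f :
  mxeval (fun i => (c i)%:M : 'M_d) f = (f.@[c])%:M.
Proof.
rewrite -[LHS]mul1mx (@mxeval_rowE _ _ _ _ _ _ c) ?scalemx1 // => i.
by rewrite mul1mx scalemx1.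
Qed.

Lemma specht_rank_gt0 (F : numFieldType) n la : is_partition_of n la ->
  (0 < \rank (cyclic_mx (regular_repr F [set: 'S_n]%G) (young_symmetrizer F n la)))%N.
Proof.
move=> la_part; rewrite lt0n mxrank_eq0;
apply: contraTneq (cyclic_mx_id (regular_repr F [set: 'S_n]%G) (young_symmetrizer F n la)) => ->.
by rewrite submx0 young_symmetrizerE young_neq0 //; apply: box_of_inj.
Qed.

Lemma conj_part_rectangle a b : (0 < a)%N -> conj_part (nseq a b) = nseq b a.
Proof.
case: a => // a _; apply: (@eq_from_nth _ 0%N); rewrite !size_map size_iota ?size_nseq // => j lt_j.
by rewrite (nth_map 0%N) ?size_iota // nth_iota // count_nseq nth_nseq lt_j mul1n.
Qed.

Lemma rectangle_transpose n a b : (0 < a)%N -> is_partition_of n (nseq a b) -> is_partition_of n (nseq b a).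
Proof.
move=> a_gt0 /and3P[_ _]; rewrite sumn_nseq mulnC -sumn_nseq => nE.
apply/and3P; split=> //; last by apply: contraL a_gt0 => /nseqP[<-].
by case: b {nE} => //= b; elim: b => //= b ->; rewrite /= leqnn.
Qed.

Lemma ind_rectangles_eq (F : numFieldType) m s la1 la2 a b a2 b2 (q c : F) (f : {mpoly F[m + s]}) al :
  la1 = nseq a b -> la2 = nseq a2 b2 -> is_partition_of m la1 -> is_partition_of s la2 ->
  symmetric_under_perms f ->
  mxeval (fun k => q%:M + c *: jm (ind_repr (@sym_embed m s)
      (outer_repr (specht F m la1) (specht F s la2))) 1%g k) f = al%:M ->
  al = f.@[fun k => q + c * (juxt_content a b a2 b2 k)%:~R].
Proof. by move=> -> -> hL hR fS; apply: (ind_rectangles hL hR fS). Qed.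

Section OneWType.
Variables (F : numClosedFieldType) (m s : nat) (laL laR la : seq nat).
Hypotheses (laL_part : is_partition_of m laL) (laR_part : is_partition_of s laR).
Local Notation n := (m + s)%N.
Hypothesis la_part : is_partition_of n la.
Local Notation rL := (specht F m laL).
Local Notation rR := (specht F s laR).
Local Notation dL := (\rank (cyclic_mx (regular_repr F [set: 'S_m]%G) (young_symmetrizer F m laL))).
Local Notation dR := (\rank (cyclic_mx (regular_repr F [set: 'S_s]%G) (young_symmetrizer F s laR))).
Local Notation rK := (outer_repr (infl_repr rL) (infl_sign_repr rR)).
Variables (d : nat) (B : bgroup n -> 'M[F]_d) (ev : bgroup n -> 'M[F]_(d, dL * dR)).
Hypothesis ev_act : forall w x, B w *m ev x = ev (w * x)%g.
Hypothesis ev_equiv : forall x k, ev (x * bgroup_embed k)%g = ev x *m rK k.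
Hypothesis ev_inj : forall (p : nat) (M : 'M_(p, d)), (forall x, M *m ev x = 0) -> M = 0.
Hypothesis ev_ex : forall (p : nat) (phi : bgroup n -> 'M[F]_(p, dL * dR)),
  (forall x k, phi (x * bgroup_embed k)%g = phi x *m rK k) ->
  exists M : 'M_(p, d), forall x, M *m ev x = phi x.
Hypotheses (B1 : B 1%g = 1%:M) (BM : forall w x, B (w * x)%g = B w *m B x).
Hypothesis Bschur : forall Z, (forall w, Z *m B w = B w *m Z) -> Z = 0 \/ Z \in unitmx.
Hypothesis LR_neq0 : LR_coef F m s la laL (conj_part laR) <> 0%N.
Local Notation t p := (B (bperm p)).
Local Notation tau i := (B (bflip i)).

Variables (kl ks : F) (f : {mpoly F[n]}).
Hypothesis fW : forall w, signed_subst w f = f.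
Let nu (k : 'I_n) := ks + kl * ((box_of la k).2%:R - (box_of la k).1%:R).

Let fS : symmetric_under_perms f. Proof. by move=> p; apply: fW. Qed.

Section Sign.
Variables (c : 'S_n -> F) (sig : 'S_n -> 'M[F]_d).
Hypothesis cK : forall p (k : 'S_m * 'S_s), c (p * sym_embed k)%g = c p * (-1) ^+ k.2.
Hypothesis c2 : forall p, c p * c p = 1.
Hypothesis sigE : forall p x, sig p *m ev x = (c x.1 * c (p * x.1)%g) *: ev (bperm p * x)%g.
Let L k := ks%:M + kl *: jm sig 1%g k.

Lemma sign_intertwiner : exists J, (forall (e : nat) (M : 'M_(e, _)), M *m J = 0 -> M = 0) /\
  (forall g, ind_repr (@sym_embed m s) (outer_repr rL (specht F s (conj_part laR))) g *m J = J *m sig g).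
Proof.
have [K [Kinj KE]] := specht_conj F laR_part.
have [J [J1 J2]] := twist_intertwiner ev_inj ev_ex cK c2 sigE Kinj KE; exists J; split; [exact: J1 | exact: J2].
Qed.

(** A nonzero Littlewood-Richardson coefficient gives a nonzero map from the Specht module of [la]
    to X with action [sig]. The difference from the scalar kills its image, so it is not invertible
    and Schur's lemma makes it zero. *)
Lemma twisted_contents_scalar :
  (forall w, mxeval L f *m B w = B w *m mxeval L f) -> mxeval L f = (f.@[nu])%:M.
Proof.
move=> LB; have [A A0 AE] := hom_dim_ex LR_neq0.
have [J [Jinj JE]] := sign_intertwiner.
have AJ := intertwiner_comp AE JE.
apply: (central_eq Bschur LB); apply/negP => u; apply/A0/Jinj.
rewrite -[A *m J](mulmxK u) (_ : _ *m (_ - _) = 0) ?mul0mx //.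
rewrite mulmxBr -(mxeval_jm_intertwine ks kl f AJ) (specht_content ks kl fS la_part).
by rewrite scalar_mxC subrr.
Qed.

End Sign.

Variable E : 'I_n -> 'M[F]_d.
Hypothesis EC : forall i j, E i *m E j = E j *m E i.
Hypothesis Ecross : forall (i j : 'I_n) k, j = i.+1 :> nat ->
  E k *m t (tperm i j) = t (tperm i j) *m E (tperm i j k) + (kl * ((k == i)%:R - (k == j)%:R))%:M.
Hypothesis Elast : forall l k : 'I_n, l.+1 = n ->
  E k *m tau l = tau l *m ((-1) ^+ (k == l) *: E k) + (2 * ks * (k == l)%:R)%:M.

Let EfB : forall w, mxeval E f *m B w = B w *m mxeval E f.
Proof. exact: (mxevalE_central B1 BM EC Ecross Elast fW). Qed.

Section OneBlock.
Variable eps : F.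
Hypotheses (eps2 : eps * eps = 1) (tau_eps : forall i, tau i = eps%:M).
Variables (c : 'S_n -> F) (sig : 'S_n -> 'M[F]_d).
Hypothesis cK : forall p (k : 'S_m * 'S_s), c (p * sym_embed k)%g = c p * (-1) ^+ k.2.
Hypothesis c2 : forall p, c p * c p = 1.
Hypothesis sigE : forall p x, sig p *m ev x = (c x.1 * c (p * x.1)%g) *: ev (bperm p * x)%g.
Let o : 'S_n := perm (@rev_ord_inj n).

Lemma one_block_t i j : i != j -> t (tperm i j) = eps *: sig (tperm i j).
Proof.
move=> ij; have two0 : (2 : F) != 0 by rewrite pnatr_eq0.
have := twist_relation ev_act ev_equiv ev_inj cK c2 sigE ij.
rewrite !tau_eps -!scalar_mxM eps2 -!raddfD /= !mul_scalar_mx => e.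
by apply: (scalerI two0); rewrite scalerA mulrC -scalerA [2 *: sig _]e scalerA mulrDr eps2.
Qed.

(** Descending induction: the short root fixes E at the last index to eps ks, and each long root
    relation steps down by one. Starting from the end is what reverses the order. *)
Lemma one_block_E k : E k = eps *: (ks%:M + kl *: jm sig o k).
Proof.
have sig1 := twist1 ev_inj c2 sigE; have sigM := twistM ev_inj c2 sigE.
have two0 : (2 : F) != 0 by rewrite pnatr_eq0.
have [r] := ubnP (n - k); elim: r k => // r IH k; rewrite ltnS => le_r.
have [lt_k'|] := ltnP k.+1 n; last first.
  move=> le_n; have kn : k.+1 = n by apply/eqP; rewrite eqn_leq le_n ltn_ord.
  rewrite /jm big1 => [|j]; last by rewrite !permE /= kn subnn.
  have := Elast k kn; rewrite eqxx expr1 scaleN1r mulr1 tau_eps mul_mx_scalar mul_scalar_mx.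
  move/eqP; rewrite scalerN addrC -subr_eq opprK -mulr2n -scaler_nat => /eqP e.
  rewrite scaler0 addr0 -[LHS]scale1r -eps2 -scalerA; congr (_ *: _).
  by apply: (scalerI two0); rewrite e scale_scalar_mx.
pose k' := Ordinal lt_k'; have kE : k' = k.+1 :> nat by [].
have ne_k : k' != k by rewrite -(inj_eq val_inj) /= gtn_eqF.
have TT : t (tperm k k') *m t (tperm k k') = 1%:M by rewrite -BM -bpermM tperm2 bperm1.
have := Ecross k kE; rewrite eqxx [k == k']eq_sym (negbTE ne_k) subr0 mulr1 tpermL.
move/(congr1 (mulmx^~ (t (tperm k k')))); rewrite /= mulmxDl -(mulmxA (E k)) TT mulmx1 => ->.
rewrite IH //; last by rewrite /= subnS -ltnS prednK ?subn_gt0.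
have oE : o k = (o k').+1 :> nat by rewrite !permE /= subnSK.
rewrite (jm_adjacent sig1 sigM oE) tpermC one_block_t // mul_scalar_mx.
set S := sig _; have SS : S *m S = 1%:M by rewrite -sigM tperm2.
have sc (X Y Z : 'M_d) : (eps *: X) *m (eps *: Y) *m (eps *: Z) = eps *: (X *m Y *m Z).
  by rewrite !(=^~ scalemxAl, =^~ scalemxAr) !scalerA eps2 ?mul1r ?mulr1.
rewrite sc mulmxDr mulmxDl scalar_mxC -(mulmxA ks%:M) SS mulmx1 -scalemxAr -scalemxAl.
by rewrite !scalerDr !scalerA -addrA [kl * eps]mulrC.
Qed.

Lemma one_block : mxeval E f = (f.@[nu])%:M.
Proof.
have sig1 := twist1 ev_inj c2 sigE; have sigM := twistM ev_inj c2 sigE.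
suff Ef : mxeval E f = mxeval (fun k => ks%:M + kl *: jm sig 1%g k) f.
  by rewrite Ef; apply: (twisted_contents_scalar cK c2 sigE) => w; rewrite -Ef EfB.
rewrite -(mxeval_jm_order sig1 sigM ks kl fS o).
(* If eps = -1, flipping all coordinates absorbs the common sign. *)
pose w : bgroup n := (1%g, [ffun => eps != 1]).
rewrite -[in RHS](fW w) mxeval_subst => [|i j]; last exact: (affine_jm_comm sigM).
apply: mxeval_eq => k; rewrite one_block_E ffunE perm1; congr (_ *: _).
have [//|ne] := eqVneq eps 1; rewrite expr1; apply/eqP.
have : (eps - 1) * (eps + 1) == 0 by rewrite -subr_sqr expr2 eps2 expr1n subrr.
by rewrite mulf_eq0 subr_eq0 (negbTE ne) addr_eq0.
Qed.

End OneBlock.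

Lemma no_long_roots : kl = 0 -> mxeval E f = (f.@[nu])%:M.
Proof.
move=> kl0; have two0 : (2 : F) != 0 by rewrite pnatr_eq0.
have EtE i j k : E k *m t (tperm i j) = t (tperm i j) *m E (tperm i j k).
  apply: (@tperm_adjacent_ind n 0 (fun p => forall k, E k *m t p = t p *m E (p k)) _ _ _ i j (leq0n _) (leq0n _)).
  - by move=> k'; rewrite bperm1 B1 mul1mx mulmx1 perm1.
  - by move=> p p' hp hp' k'; rewrite bpermM BM mulmxA hp -!mulmxA hp' permM.
  by move=> i' j' _ e k'; rewrite Ecross // kl0 mul0r raddf0 addr0.
have n0 (k : 'I_n) : (0 < n)%N by apply: leq_ltn_trans (ltn_ord k).
have Etau k k' : E k *m tau k' = tau k' *m E k.
  pose i0 := Ordinal (n0 k); pose T := t (tperm i0 k).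
  have TT : T *m T = 1%:M by rewrite -BM -bpermM tperm2 bperm1.
  have TE : T *m E i0 *m T = E k by rewrite -mulmxA EtE tpermL mulmxA TT mul1mx.
  have tauT j : T *m tau j *m T = tau (tperm i0 k j).
    by rewrite -[LHS]mulmxA -BM bflip_perm BM mulmxA TT mul1mx.
  have := E0_tau B1 BM Ecross Elast Bschur (erefl : i0 = 0%N :> nat) (tperm i0 k k') => e.
  have tk' : tau k' = T *m tau (tperm i0 k k') *m T by rewrite tauT tpermK.
  have conjM X Y : (T *m X *m T) *m (T *m Y *m T) = T *m (X *m Y) *m T.
    by rewrite !mulmxA -[_ *m T *m T]mulmxA TT mulmx1.
  by rewrite -TE tk' !conjM e.
have Eks k : E k = ks *: tau k.
  have [l ln] := last_ordinal k; pose T := t (tperm k l).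
  have TT : T *m T = 1%:M by rewrite -BM -bpermM tperm2 bperm1.
  have El : E l = ks *: tau l.
    have tt : tau l *m tau l = 1%:M by rewrite -BM bflipM.
    have := Elast l ln; rewrite eqxx expr1 scaleN1r mulr1 mulmxN Etau => /eqP.
    rewrite addrC -subr_eq opprK -mulr2n -scaler_nat -scale_scalar_mx => /eqP/(scalerI two0) e.
    by rewrite -[E l]mul1mx -tt -mulmxA e mul_mx_scalar.
  have -> : E k = T *m E l *m T by rewrite -mulmxA EtE tpermR mulmxA TT mul1mx.
  rewrite El -scalemxAr -scalemxAl; congr (_ *: _).
  by rewrite -mulmxA -BM bflip_perm BM mulmxA TT mul1mx tpermR.
rewrite (mxeval_eq f Eks); apply: (ev_eq ev_inj) => x.
rewrite (mxeval_intertwine f (y := fun i => (ks * block_sign F (x.1 i))%:M)) => [|i]; last first.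
  by rewrite -scalemxAl (bip_flip ev_act ev_equiv) mul_mx_scalar scalerA.
rewrite mxeval_scalars scalar_mxC; congr (_%:M *m _).
(* All coordinates of the weight at [x] are ks or -ks; flipping those of negative block sign gives
   [nu], which is constant as kl = 0. *)
pose w : bgroup n := (1%g, [ffun i => block_sign F (x.1 i) != 1]).
rewrite -[in RHS](fW w) meval_subst; apply: meval_eq => i.
rewrite ffunE /nu kl0 mul0r addr0 mulrC; congr (_ * _).
by rewrite /block_sign; case: split => _; rewrite ?eqxx //= -subr_eq0 -opprD oppr_eq0 -(natrD _ 1 1) pnatr_eq0.
Qed.

Section TwoBlocks.
Hypotheses (kl_neq0 : kl != 0) (m_gt0 : (0 < m)%N) (s_gt0 : (0 < s)%N) (d_gt0 : (0 < d)%N).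

Lemma E_affine_jm : exists q, forall k, E k = q%:M + (- kl) *: jm (fun p => t p) 1%g k.
Proof.
have n_gt0 : (0 < n)%N by rewrite addn_gt0 m_gt0.
pose i0 := Ordinal n_gt0; have i0E : i0 = 0%N :> nat by [].
(* The difference of the squares is 4 m s, nonzero because both blocks are nonempty. *)
have a_neq : (m%:R - s%:R) ^+ 2 != (n%:R : F) ^+ 2.
  rewrite natrD -subr_eq0.
  rewrite (_ : _ - _ = - (4 * m%:R * s%:R)); last by ring.
  by rewrite oppr_eq0 !mulf_neq0 // pnatr_eq0 -lt0n.
have [q E0q] := E0_scalar B1 BM EC Ecross Elast Bschur i0E kl_neq0
  (bip_sum_flips ev_act ev_equiv ev_inj) a_neq d_gt0.
by exists q => k; apply: (E_jm B1 BM Ecross i0E).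
Qed.

Lemma two_blocks : mxeval E f = (f.@[nu])%:M.
Proof.
have [q Eq] := E_affine_jm.
have star := star_relation B1 BM Elast Eq.
have [a [b [laLE a_gt0 b_gt0 abE]]] :
  exists a b, [/\ laL = nseq a b, (0 < a)%N, (0 < b)%N & (q - ks) / kl = b%:R - a%:R].
  apply: (star_sum_rectangle laL_part m_gt0) => i.
  have := starL ev_act ev_equiv ev_ex star i (specht_rank_gt0 F laR_part).
  move/(congr1 (fun Z => kl^-1 *: Z)); rewrite scalerA mulVf // scale1r scale_scalar_mx mulrC => ->.
  by rewrite mul_mx_scalar.
have [a2 [b2 [laRE a2_gt0 b2_gt0 abE2]]] :
  exists a b, [/\ laR = nseq a b, (0 < a)%N, (0 < b)%N & (q + ks) / kl = b%:R - a%:R].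
  apply: (star_sum_rectangle laR_part s_gt0) => i.
  have := starR ev_act ev_equiv ev_ex star i (specht_rank_gt0 F laL_part).
  move/(congr1 (fun Z => kl^-1 *: Z)); rewrite scalerA mulVf // scale1r scale_scalar_mx mulrC => ->.
  by rewrite mul_mx_scalar.
have laRcE : conj_part laR = nseq b2 a2 by rewrite laRE conj_part_rectangle.
have laRc_part : is_partition_of s (conj_part laR).
  by rewrite laRcE; apply: rectangle_transpose => //; rewrite -laRE.
have [al Eal] := central_scalar Bschur d_gt0 EfB.
(* With c = 1 and sg = 1 the intertwiner embeds the module induced from laL and laR itself, with
   action t, so the scalar f(E) can be read on their juxtaposition. *)
have alE : al = f.@[fun k => q + (- kl) * (juxt_content a b a2 b2 k)%:~R].
  apply: (ind_rectangles_eq laLE laRE laL_part laR_part fS).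
  have tE p x : t p *m ev x = (1 * 1) *: ev (bperm p * x)%g by rewrite mulr1 scale1r ev_act.
  have [J [Jinj JE]] := twist_intertwiner ev_inj ev_ex (c := fun=> 1) (sg := fun=> 1)
    (fun _ _ => esym (mulr1 1)) (fun=> mulr1 1) tE (rR' := rR) (Kc := 1%:M)
    (fun e M => etrans (esym (mulmx1 M)))
    (fun k => etrans (etrans (mulmx1 _) (esym (mul1mx _))) (esym (scale1r _))).
  by apply: (mxeval_jm_scalar JE Jinj); rewrite -Eal; apply: mxeval_eq => k; rewrite Eq.
have [c [cK c2]] := sign_cocycle F m s.
have [sig sigE] := twist_ex ev_equiv ev_ex (sg := fun k => (-1) ^+ odd_perm k) cK c2.
have sig1 := twist1 ev_inj c2 sigE; have sigM := twistM ev_inj c2 sigE.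
have tau_sig := twist_flip ev_act ev_equiv ev_inj sigE.
have sig_rel := twist_relation ev_act ev_equiv ev_inj cK c2 sigE.
pose L k := ks%:M + kl *: jm sig 1%g k.
have Lsig p : mxeval L f *m sig p = sig p *m mxeval L f.
  exact: (mxeval_jm_central sig1 sigM ks kl fS p).
have Ltaul (l : 'I_n) : l.+1 = n -> mxeval L f *m tau l = tau l *m mxeval L f.
  move=> ln; symmetry; apply: (@mxeval_flip_commute _ _ _ L _ l (2 * q)) => //.
    exact: (affine_jm_comm sigM).
  by move=> k; apply: (tau_twisted_content B1 BM Elast Eq (fun i p => tau_sig i p) (fun i j => sig_rel i j)).
have Ltau i : mxeval L f *m tau i = tau i *m mxeval L f.
  have [l ln] := last_ordinal i; pose S := sig (tperm l i).
  have -> : tau i = S *m tau l *m S.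
    by rewrite -mulmxA tau_sig mulmxA -sigM tperm2 sig1 mul1mx tpermL.
  by rewrite !mulmxA Lsig -!mulmxA -Lsig (mulmxA (mxeval L f)) Ltaul // -!mulmxA.
have LB w : mxeval L f *m B w = B w *m mxeval L f.
  move: w; apply: (commute_adjacent B1 BM) => [i j _|l _]; last exact: Ltau.
  exact: (twist_commute_perm ev_act ev_equiv ev_inj ev_ex (sg := fun k => (-1) ^+ odd_perm k) cK c2 sigE).
have Lnu := twisted_contents_scalar cK c2 sigE LB.
(* The scalar f(L), already computed through [la], is read a second time on the juxtaposition of laL
   with the transpose of laR. *)
have nuE : f.@[nu] = f.@[fun k => ks + kl * (juxt_content a b b2 a2 k)%:~R].
  apply: (ind_rectangles_eq laLE laRcE laL_part laRc_part fS).
  have [J [Jinj JE]] := sign_intertwiner cK c2 sigE.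
  exact: (mxeval_jm_scalar JE Jinj).
rewrite Eal; congr (_%:M); rewrite alE nuE.
pose x k : int := (b%:Z - a%:Z + b2%:Z - a2%:Z) - 2 * @juxt_content m s a b a2 b2 k.
pose y k : int := (b2%:Z - a2%:Z - b%:Z + a%:Z) + 2 * @juxt_content m s a b b2 a2 k.
have [p pE] : exists p : 'S_n, forall k, x k = y (p k) \/ x k = - y (p k).
  by apply: juxt_content_perm; rewrite -?laLE -?laRE -?laRcE.
have two0 : (2 : F) != 0 by rewrite pnatr_eq0.
(* Sum and difference of the two star sum scalars b - a = (q - ks) / kl and b2 - a2 = (q + ks) /
   kl. *)
have qE : 2 * q = kl * (b%:R - a%:R + b2%:R - a2%:R).
  by rewrite -addrA -abE -abE2 mulrDr ![kl * _]mulrC !divfK //; ring.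
have ksE : 2 * ks = kl * (b2%:R - a2%:R - b%:R + a%:R).
  rewrite (_ : _ - _ + _ = (b2%:R - a2%:R) - (b%:R - a%:R)); last by ring.
  by rewrite -abE -abE2 mulrBr ![kl * _]mulrC !divfK //; ring.
have xE k : 2 * (q + - kl * (juxt_content a b a2 b2 k)%:~R) = kl * (x k)%:~R.
  by rewrite mulrDr qE /x !(rmorphD, rmorphB, rmorphM, rmorphN) /= !pmulrn; ring.
have yE k : 2 * (ks + kl * (juxt_content a b b2 a2 k)%:~R) = kl * (y k)%:~R.
  by rewrite mulrDr ksE /y !(rmorphD, rmorphB, rmorphM, rmorphN) /= !pmulrn; ring.
(* One signed permutation collects the permutation [p] and the signs; invariance of f under it
   finishes the comparison. *)
clearbody x y; pose w : bgroup n := (p, [ffun k => x k != y (p k)]).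
rewrite -[in RHS](fW w) meval_subst; apply: meval_eq => k.
apply: (mulfI two0); rewrite ffunE [RHS]mulrCA xE yE.
have [->|ne] := eqVneq (x k) (y (p k)); first by rewrite mul1r.
by case: (pE k) => [e|->]; [rewrite e eqxx in ne | rewrite expr1 rmorphN mulrN mulN1r].
Qed.

End TwoBlocks.

Lemma one_W_type_eval : (0 < d)%N -> mxeval E f = (f.@[nu])%:M.
Proof.
move=> d_gt0; have [c [cK c2]] := sign_cocycle F m s.
have [sig sigE] := twist_ex ev_equiv ev_ex (sg := fun k => (-1) ^+ odd_perm k) cK c2.
have tauE i b : (forall i', @block_sign F m s i' = b) -> tau i = b%:M.
  by move=> bE; apply: (ev_eq ev_inj) => x; rewrite (bip_flip ev_act ev_equiv) bE mul_scalar_mx.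
have [s0|s_gt0] := posnP s.
  have bE (i : 'I_n) : @block_sign F m s i = 1.
    by rewrite /block_sign; case: split => // j; have := ltn_ord j; rewrite {2}s0.
  by apply: (one_block (mulr1 1) _ cK c2 sigE) => i; apply: tauE.
have [m0|m_gt0] := posnP m.
  have bE (i : 'I_n) : @block_sign F m s i = - 1.
    by rewrite /block_sign; case: split => // j; have := ltn_ord j; rewrite {2}m0.
  by apply: (one_block (eps := -1) _ _ cK c2 sigE) => [|i]; [rewrite mulrNN mulr1 | apply: tauE].
have [/no_long_roots //|kl_neq0] := eqVneq kl 0.
exact: two_blocks.
Qed.

End OneWType.

(** * From modules to matrices *)

Local Open Scope complex_scope.

Section HeckeModule.
Variables (R : realType) (n : nat) (kl ks : R).
Local Notation C := R[i].
Local Notation H := (hecke n kl ks).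

Lemma hecke_omC (u v : 'rV[C]_n) : hecke_om kl ks u * hecke_om kl ks v = hecke_om kl ks v * hecke_om kl ks u.
Proof.
apply: etrans (hmulE kl ks (hOm u) (hOm v)) (etrans _ (esym (hmulE kl ks (hOm v) (hOm u)))).
by apply/hpiP; apply: hr_OmC.
Qed.

Lemma hecke_scE (c : C) : hsc n kl ks c = c%:A.
Proof. by rewrite -[LHS]mulr1. Qed.

Lemma hecke_omZ c (v : 'rV[C]_n) : hecke_om kl ks (c *: v) = c *: hecke_om kl ks v.
Proof. by apply: etrans (esym (hmulE kl ks (hSc n c) (hOm v))); apply/hpiP; apply: hr_OmZ. Qed.

Lemma hecke_cross (i : 'I_n) (v : 'rV[C]_n) : hecke_om kl ks v * hecke_t kl ks (simple_refl i) =
  hecke_t kl ks (simple_refl i) * hecke_om kl ks (wact (simple_refl i) v) +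
  ((kparam kl ks i)%:C * (2 * dot (simple_root C i) v / dot (simple_root C i) (simple_root C i)))%:A.
Proof.
rewrite -hecke_scE; apply: etrans (hmulE kl ks (hOm v) (hT R (simple_refl i))) _.
apply: etrans (congr1 (fun z => hadd z _) (esym (hmulE kl ks (hT R (simple_refl i)) (hOm _)))).
apply: etrans (esym (haddE kl ks _ _)).
by apply/hpiP; apply: hr_cross.
Qed.

Lemma wact_delta (w : bgroup n) k :
  wact w (delta_mx 0 k : 'rV[C]_n) = (-1) ^+ w.2 k *: delta_mx 0 (w.1 k).
Proof.
rewrite /wact (bigD1 k) //= mxE !eqxx mulr1 big1 ?addr0 // => i ik.
by rewrite mxE (negbTE ik) mulr0 scale0r.
Qed.

Lemma dot_delta (u : 'rV[C]_n) k : dot u (delta_mx 0 k) = u 0 k.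
Proof.
rewrite /dot (bigD1 k) //= mxE !eqxx mulr1 big1 ?addr0 // => i ik.
by rewrite mxE (negbTE ik) mulr0.
Qed.

Lemma hecke_cross_adjacent (i j k : 'I_n) : j = i.+1 :> nat ->
  hecke_om kl ks (delta_mx 0 k) * hecke_t kl ks (bperm (tperm i j)) =
  hecke_t kl ks (bperm (tperm i j)) * hecke_om kl ks (delta_mx 0 (tperm i j k)) +
  (kl%:C * ((k == i)%:R - (k == j)%:R))%:A.
Proof.
move=> ji; have lt_j : (i.+1 < n)%N by rewrite -ji.
have jE : insub i.+1 = Some j by rewrite insubT; congr Some; apply: val_inj.
have := hecke_cross i (delta_mx 0 k).
rewrite /simple_refl /kparam /simple_root jE wact_delta ffunE scale1r dot_delta => ->; congr (_ + _%:A).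
have ne_ij : i != j by rewrite -(inj_eq val_inj) [val j]ji ltn_eqF.
have -> : dot (delta_mx 0 i - delta_mx 0 j : 'rV[C]_n) (delta_mx 0 i - delta_mx 0 j) = 2.
  have dotB (u v w : 'rV[C]_n) : dot u (v - w) = dot u v - dot u w.
    by rewrite /dot -sumrB; apply: eq_bigr => l _; rewrite !mxE mulrBr.
  by rewrite dotB !dot_delta !mxE !eqxx [j == i]eq_sym (negbTE ne_ij) !andbF ?subr0 ?sub0r ?opprK.
by congr (_ * _); rewrite mulrAC divff ?pnatr_eq0 // mul1r !mxE !eqxx.
Qed.

Lemma hecke_cross_last (l k : 'I_n) : l.+1 = n ->
  hecke_om kl ks (delta_mx 0 k) * hecke_t kl ks (bflip l) =
  hecke_t kl ks (bflip l) * ((-1) ^+ (k == l) *: hecke_om kl ks (delta_mx 0 k)) +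
  (2 * ks%:C * (k == l)%:R)%:A.
Proof.
move=> ln; have lE : insub l.+1 = None :> option 'I_n by rewrite insubF // ln ltnn.
have := hecke_cross l (delta_mx 0 k).
rewrite /simple_refl /kparam /simple_root lE wact_delta ffunE perm1 hecke_omZ !dot_delta => ->.
by congr (_ + _%:A); rewrite !mxE !eqxx divr1; ring.
Qed.

Variables (X : lmodType H) (d : nat) (rW : mx_representation C [set: bgroup n]%G d).
Variables (f : 'cV[C]_d -> X) (g : X -> 'cV[C]_d).
Hypotheses (fK : cancel f g) (gK : cancel g f).
Hypothesis fD : forall a b, f (a + b) = f a + f b.
Hypothesis fZ : forall (c : C) a, f (c *: a) = c%:A *: f a.
Hypothesis fW : forall w a, f (rW w *m a) = hecke_t kl ks w *: f a.

(** The coordinates [f] are on columns, so h becomes left multiplication and products keep their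
    order. *)
Definition module_mx (h : H) : 'M[C]_d := \matrix_(i, j) g (h *: f (delta_mx j 0)) i 0.

Lemma scalarA_comm (h : H) (c : C) (u : X) : h *: (c%:A *: u) = c%:A *: (h *: u).
Proof. by rewrite !scalerA -scalerAr mulr1 -scalerAl mul1r. Qed.

Lemma module_mxE h a : f (module_mx h *m a) = h *: f a.
Proof.
have f0 : f 0 = 0 by apply: (addIr (f 0)); rewrite -fD !add0r.
have fsum (I : Type) (r : seq I) (F : I -> 'cV[C]_d) : f (\sum_(i <- r) F i) = \sum_(i <- r) f (F i).
  exact: (big_morph f fD f0).
have -> : module_mx h *m a = \sum_j a j 0 *: g (h *: f (delta_mx j 0)).
  apply/matrixP => i k; rewrite ord1 mxE summxE; apply: eq_bigr => j _.
  by rewrite !mxE mulrC.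
have {2}-> : a = \sum_j a j 0 *: delta_mx j 0.
  rewrite {1}[a]matrix_sum_delta; apply: eq_bigr => j _.
  by rewrite big_ord1.
rewrite !fsum scaler_sumr; apply: eq_bigr => j _.
by rewrite !fZ gK scalarA_comm.
Qed.

Lemma module_mx_unique M h : (forall a, f (M *m a) = h *: f a) -> M = module_mx h.
Proof.
move=> ME; apply/matrixP => i j; have := ME (delta_mx j 0).
by rewrite -module_mxE => /(can_inj fK)/matrixP/(_ i 0); rewrite -!colE !mxE.
Qed.

Lemma module_mxD h k : module_mx (h + k) = module_mx h + module_mx k.
Proof. by apply/esym/module_mx_unique => a; rewrite mulmxDl fD !module_mxE scalerDl. Qed.

Lemma module_mxM h k : module_mx (h * k) = module_mx h *m module_mx k.
Proof. by apply/esym/module_mx_unique => a; rewrite -mulmxA !module_mxE scalerA. Qed.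

Lemma module_mx_sc (c : C) : module_mx c%:A = c%:M.
Proof. by apply/esym/module_mx_unique => a; rewrite mul_scalar_mx fZ. Qed.

Lemma module_mxZ (c : C) h : module_mx (c *: h) = c *: module_mx h.
Proof. by rewrite -[h in LHS]mul1r scalerAl module_mxM module_mx_sc mul_scalar_mx. Qed.

Lemma module_mx0 : module_mx 0 = 0.
Proof. by rewrite -(scale0r 1) module_mxZ scale0r. Qed.

Lemma module_mx1 : module_mx 1 = 1%:M.
Proof. by rewrite -(scale1r 1) module_mx_sc. Qed.

Lemma module_mx_t w : module_mx (hecke_t kl ks w) = rW w.
Proof. exact/esym/module_mx_unique. Qed.

Let E i := module_mx (hecke_om kl ks (delta_mx 0 i)).

Lemma module_mx_poly p : module_mx (hecke_poly kl ks p) = mxeval E p.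
Proof.
rewrite /hecke_poly /mmap (big_morph _ module_mxD module_mx0); apply: eq_bigr => e _.
rewrite -scalerAl mul1r module_mxZ; congr (_ *: _).
rewrite /mmap1 (big_morph _ module_mxM module_mx1); apply: eq_bigr => i _.
by elim: (e i) => [|k IH]; rewrite ?expr0 ?module_mx1 // !exprS module_mxM IH.
Qed.

(** The kernel of Z, transported to X, is a W-stable subspace, hence zero or everything. *)
Lemma module_mx_schur : is_W_irreducible X ->
  forall Z, (forall w, Z *m rW w = rW w *m Z) -> Z = 0 \/ Z \in unitmx.
Proof.
move=> [_ irr] Z Zc; have f0 : f 0 = 0 by apply: (addIr (f 0)); rewrite -fD !add0r.
have g0 : g 0 = 0 by rewrite -f0 fK.
have gD u v : g (u + v) = g u + g v by rewrite -{1}(gK u) -{1}(gK v) -fD fK.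
have gZ (c : C) u : g (c%:A *: u) = c *: g u by rewrite -{1}(gK u) -fZ fK.
have gW w u : g (hecke_t kl ks w *: u) = rW w *m g u by rewrite -{1}(gK u) -fW fK.
have [|u v|c u|w u|inj|all0] := irr (fun u => Z *m g u = 0).
- by rewrite g0 mulmx0.
- by rewrite gD mulmxDr => -> ->; rewrite addr0.
- by rewrite gZ -scalemxAr => ->; rewrite scaler0.
- by rewrite gW mulmxA Zc -mulmxA => ->; rewrite mulmx0.
- right; rewrite -unitmx_tr -row_free_unit -kermx_eq0; apply/rowV0P => v /sub_kermxP vZ.
  have := inj (f v^T); rewrite fK -{1}[Z]trmxK -trmx_mul vZ trmx0 => /(_ erefl) fv.
  by rewrite -[v]trmxK -(fK v^T) fv g0 trmx0.
left; apply/matrixP => i j; have := all0 (f (delta_mx j 0)); rewrite fK -colE.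
by move/matrixP/(_ i 0); rewrite !mxE.
Qed.

End HeckeModule.

Theorem mainTheorem6 (R : realType) (kl ks : R) (m s : nat)
    (star : hecke (m + s) kl ks -> hecke (m + s) kl ks)
    (star_spec : is_star star)
    (laL laR : seq nat)
    (laL_part : is_partition_of m laL) (laR_part : is_partition_of s laR)
    (X : lmodType (hecke (m + s) kl ks))
    (X_one_W_type : one_W_type X star)
    (X_restr : W_restriction_iso X (bipartition_repr R[i] m s laL laR))
    (la : seq nat) (la_part : is_partition_of (m + s) la)
    (LR_neq0 : LR_coef R[i] m s la laL (conj_part laR) <> 0%N) :
  has_central_character X (fun k => (nu_vec kl ks la k)%:C).
Proof.
have [_ _ Xirr] := X_one_W_type.
have [f [[g fK gK] fD fZ fW]] := X_restr.
move=> p pW u; pose E i := module_mx f g (hecke_om kl ks (delta_mx 0 i)).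
set rK := outer_repr (infl_repr (specht R[i] m laL)) (infl_sign_repr (specht R[i] s laR)).
have mxM := module_mxM fK gK fD fZ.
have mxD := module_mxD fK gK fD fZ.
have mx_t := module_mx_t fK gK fD fZ fW.
have mxZ := module_mxZ fK gK fD fZ.
have mx_sc := module_mx_sc fK gK fD fZ.
(* X is nonzero and in bijection with the columns of this height; [central_scalar] needs an
   eigenvalue and so a positive size. *)
have d_gt0 : (0 < \rank (ind_space (@bgroup_embed m s) rK))%N.
  rewrite lt0n; have [[v v0] _] := Xirr; apply: contra_notN v0 => /eqP d0.
  have all_eq (a b : 'cV[R[i]]_(\rank (ind_space (@bgroup_embed m s) rK))) : a = b.
    by apply/matrixP => i; have := ltn_ord i; rewrite {2}d0.
  have f0 : f 0 = 0 by apply: (addIr (f 0)); rewrite -fD !add0r.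
  by rewrite -(gK v) (all_eq (g v) 0) f0.
have Ep : mxeval E p = (p.@[fun k => (nu_vec kl ks la k)%:C])%:M.
  rewrite (one_W_type_eval (kl := kl%:C) (ks := ks%:C) laL_part laR_part la_part
    (ind_eval_act (@bgroup_embed m s) rK) (ind_eval_equiv (@bgroup_embed m s) rK)
    (@ind_eval_inj _ _ _ (@bgroup_embed m s) _ rK) (@ind_eval_ex _ _ _ (@bgroup_embed m s) _ rK)
    _ _ (module_mx_schur fK gK fD fZ fW Xirr) LR_neq0 pW _ _ _ d_gt0).
  - congr (_%:M); apply: meval_eq => k.
    by rewrite /nu_vec rmorphD rmorphM rmorphB !rmorph_nat.
  - exact: repr_mx1.
  - by move=> w x; rewrite repr_mxM ?inE.
  - by move=> i j; rewrite /E -!mxM hecke_omC.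
  - by move=> i j k ij; rewrite /E -!mx_t -!mxM hecke_cross_adjacent // mxD mx_sc.
  by move=> l k ln; rewrite /E -!mx_t -mxZ -!mxM hecke_cross_last // mxD mx_sc.
rewrite -{1}(gK u) -(module_mxE gK fD fZ) (module_mx_poly fK gK fD fZ).
by rewrite -/E Ep mul_scalar_mx fZ gK.
Qed.
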